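(* Let $\beta>1$, $\mathbf{b}\in\mathbb{C}^n\setminus\{0\}$, let $F$ be an analytic function in $\mathbb{B}_n$, $L\in Q_{\mathbf{b},\beta}(\mathbb{B}_n)$ and $\mathbb{B}_n\setminus G^{\mathbf{b}}_\beta(F)\ne\emptyset$. Then $F$ is of bounded $L$-index in the direction $\mathbf{b}$ if and only if both of the following hold: 1) for every $r\in(0,\beta]$ there exists $P=P(r)>0$ such that for each $z\in\mathbb{B}_n\setminus G^{\mathbf{b}}_r(F)$ $$\left|\frac{1}{F(z)}\frac{\partial F(z)}{\partial\mathbf{b}}\right|\le P L(z);$$ 2) for every $r\in(0,\beta]$ there exists $\widetilde n(r)\in\mathbb{Z}_+$ such that for each $z^0\in\mathbb{B}_n$ with $F(z^0+t\mathbf{b})\not\equiv0$ (as a function of $t\in S_{z^0}$) and for each $t_0\in S_{z^0}$ $$n\left(\frac{r}{L(z^0+t_0\mathbf{b})},z^0,t_0,\frac1F\right)\le\widetilde n(r).$$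
   Context: $|\cdot|$ is the Euclidean norm on $\mathbb{C}^n$, $\mathbb{B}_n=\{z\in\mathbb{C}^n:|z|<1\}$, $\mathbb{R}_+=(0,\infty)$, $\mathbb{Z}_+=\{0,1,2,\dots\}$. For $z\in\mathbb{C}^n$, $S_z=\{t\in\mathbb{C}: z+t\mathbf{b}\in\mathbb{B}_n\}$. Directional derivatives: $\frac{\partial^0F}{\partial\mathbf{b}^0}=F$, $\frac{\partial F}{\partial\mathbf{b}}=\sum_{j=1}^n\frac{\partial F}{\partial z_j}b_j$, $\frac{\partial^kF}{\partial\mathbf{b}^k}=\frac{\partial}{\partial\mathbf{b}}\big(\frac{\partial^{k-1}F}{\partial\mathbf{b}^{k-1}}\big)$ for $k\ge2$. For a positive continuous $L$ on $\mathbb{B}_n$, an analytic function $F$ in $\mathbb{B}_n$ is of bounded $L$-index in the direction $\mathbf{b}$ if there is $m_0\in\mathbb{Z}_+$ such that for all $m\in\mathbb{Z}_+$ and all $z\in\mathbb{B}_n$ $$\frac{1}{m!L^m(z)}\left|\frac{\partial^mF(z)}{\partial\mathbf{b}^m}\right|\le\max\left\{\frac{1}{k!L^k(z)}\left|\frac{\partial^kF(z)}{\partial\mathbf{b}^k}\right|:0\le k\le m_0\right\}.$$ Class $Q_{\mathbf{b},\beta}(\mathbb{B}_n)$: the set of continuous $L:\mathbb{B}_n\to\mathbb{R}_+$ with $L(z)>\frac{\beta|\mathbf{b}|}{1-|z|}$ for all $z\in\mathbb{B}_n$ and such that $0<\lambda_1^{\mathbf{b}}(\eta)\le\lambda_2^{\mathbf{b}}(\eta)<+\infty$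 for every $\eta\in[0,\beta]$, where $\lambda_1^{\mathbf{b}}(\eta)$ and $\lambda_2^{\mathbf{b}}(\eta)$ are respectively the infimum and the supremum of $\frac{L(z+t\mathbf{b})}{L(z+t_0\mathbf{b})}$ over all $z\in\mathbb{B}_n$, $t_0\in S_z$ and $t\in\mathbb{C}$ with $|t-t_0|\le\frac{\eta}{L(z+t_0\mathbf{b})}$ (for such $t$ one has $z+t\mathbf{b}\in\mathbb{B}_n$). Sets $G^{\mathbf{b}}_r(F)$: for $z^0\in\mathbb{B}_n$ let $g_{z^0}(t)=F(z^0+t\mathbf{b})$, $t\in S_{z^0}$, and $r>0$. If $g_{z^0}$ has no zeros in $S_{z^0}$, put $G^{\mathbf{b}}_r(F,z^0)=\emptyset$; if $g_{z^0}\equiv0$, put $G^{\mathbf{b}}_r(F,z^0)=\{z^0+t\mathbf{b}:t\in S_{z^0}\}$; otherwise, with $a_k^0$ the zeros of $g_{z^0}$, put $G^{\mathbf{b}}_r(F,z^0)=\bigcup_k\big\{z^0+t\mathbf{b}:|t-a_k^0|\le\frac{r}{L(z^0+a_k^0\mathbf{b})}\big\}$. Finally $G^{\mathbf{b}}_r(F)=\bigcup_{z^0\in\mathbb{B}_n}G^{\mathbf{b}}_r(F,z^0)$. Counting function: when $g_{z^0}\not\equiv0$, $n(r,z^0,t_0,1/F)=\sum_{|a_k^0-t_0|\le r}1$ is the number of zeros $a_k^0$ of $g_{z^0}$, counted with multiplicity, in the disc $|t-t_0|\le r$. *)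

(* Defs.v *)
(* The complex numbers are R[i], for R : realType. *)
From HB Require Import structures.
From mathcomp Require Import all_boot all_order all_algebra finmap.
From mathcomp Require Import complex.
From mathcomp Require Import all_classical all_reals all_analysis.
From mathcomp.analysis.showcase Require summability.

Set Implicit Arguments.
Unset Strict Implicit.
Unset Printing Implicit Defensive.

Import Order.TTheory GRing.Theory Num.Theory numFieldNormedType.Exports.

Local Open Scope classical_set_scope.
Local Open Scope ring_scope.

(* R[i] as a one-dimensional normed space over itself, in the way in which
   numFieldNormedType equips an abstract numClosedFieldType. *)
#[export, non_forgetful_inheritance]
HB.instance Definition _ (R : rcfType) := GRing.ComAlgebra.copy R[i] (R[i])^o.
#[export, non_forgetful_inheritance]
HB.instance Definition _ (R : rcfType) := Vector.copy R[i] (R[i])^o.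
#[export, non_forgetful_inheritance]
HB.instance Definition _ (R : rcfType) := NormedModule.copy R[i] (R[i])^o.

(* The modulus with values in R; the library's `|z| lives in R[i]. *)
Notation cabs := Normc.normc.

(* The norm that the library puts on 'rV[R[i]]_n is the maximum norm; it is
   used only through its topology. *)
Definition enorm (R : realType) (n : nat) (z : 'rV[R[i]]_n) : R :=
  Num.sqrt (\sum_(j < n) cabs (z 0 j) ^+ 2).

Definition unit_ball (R : realType) (n : nat) : set 'rV[R[i]]_n :=
  [set z | enorm z < 1].
Arguments unit_ball R n : clear implicits.

(* Functions on the ball are total functions whose values outside the ball are
   irrelevant. *)

Definition monomial (R : realType) (n : nat) (k : {ffun 'I_n -> nat})
    (w : 'rV[R[i]]_n) : R[i] :=
  \prod_(j < n) w 0 j ^+ k j.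

(* Near every point of the ball F is the sum of a power series in n variables;
   the series is summed unconditionally, i.e. along the finite sets of
   multi-indices ordered by inclusion. *)
Definition analytic_in_ball (R : realType) (n : nat) (F : 'rV[R[i]]_n -> R[i]) :
    Prop :=
  forall z0, unit_ball R n z0 ->
    exists a : {ffun 'I_n -> nat} -> R[i],
      \forall z \near z0,
        summability.partial_sum (fun k => a k * monomial k (z - z0))
          @ summability.totally --> F z.

Definition dir_deriv (R : realType) (n : nat) (b : 'rV[R[i]]_n)
    (F : 'rV[R[i]]_n -> R[i]) : 'rV[R[i]]_n -> R[i] :=
  fun z => \sum_(j < n) 'D_(delta_mx 0 j) F z * b 0 j.

Definition dir_derivn (R : realType) (n : nat) (b : 'rV[R[i]]_n) (k : nat)
    (F : 'rV[R[i]]_n -> R[i]) : 'rV[R[i]]_n -> R[i] :=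
  iter k (dir_deriv b) F.

(* The maximum is taken over a nonempty family of nonnegative numbers, so that
   the default value 0 is harmless. *)
Definition bounded_L_index (R : realType) (n : nat) (b : 'rV[R[i]]_n)
    (L : 'rV[R[i]]_n -> R) (F : 'rV[R[i]]_n -> R[i]) : Prop :=
  exists m0 : nat, forall (m : nat) z, unit_ball R n z ->
    cabs (dir_derivn b m F z) / (m`!%:R * L z ^+ m) <=
    \big[Num.max/0]_(k < m0.+1) (cabs (dir_derivn b k F z) / (k`!%:R * L z ^+ k)).

Definition slice_dom (R : realType) (n : nat) (b z : 'rV[R[i]]_n) : set R[i] :=
  [set t | unit_ball R n (z + t *: b)].

Definition slice_fun (R : realType) (n : nat) (b : 'rV[R[i]]_n)
    (F : 'rV[R[i]]_n -> R[i]) (z : 'rV[R[i]]_n) : R[i] -> R[i] :=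
  fun t => F (z + t *: b).

Definition L_ratios (R : realType) (n : nat) (b : 'rV[R[i]]_n)
    (L : 'rV[R[i]]_n -> R) (eta : R) : set (\bar R) :=
  [set x | exists z t0 t, [/\ unit_ball R n z, slice_dom b z t0,
     cabs (t - t0) <= eta / L (z + t0 *: b)
     & x = (L (z + t *: b) / L (z + t0 *: b))%:E]].

Definition lambda1 (R : realType) (n : nat) (b : 'rV[R[i]]_n)
    (L : 'rV[R[i]]_n -> R) (eta : R) : \bar R := ereal_inf (L_ratios b L eta).

Definition lambda2 (R : realType) (n : nat) (b : 'rV[R[i]]_n)
    (L : 'rV[R[i]]_n -> R) (eta : R) : \bar R := ereal_sup (L_ratios b L eta).

Definition classQ (R : realType) (n : nat) (b : 'rV[R[i]]_n) (beta : R)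
    (L : 'rV[R[i]]_n -> R) : Prop :=
  [/\ {within unit_ball R n, continuous L},
      forall z, unit_ball R n z -> 0 < L z,
      forall z, unit_ball R n z -> beta * enorm b / (1 - enorm z) < L z
    & forall eta, 0 <= eta <= beta ->
        [/\ (0 < lambda1 b L eta)%E, (lambda1 b L eta <= lambda2 b L eta)%E
          & (lambda2 b L eta < +oo)%E]].

Definition slice_zeros (R : realType) (n : nat) (b : 'rV[R[i]]_n)
    (F : 'rV[R[i]]_n -> R[i]) (z0 : 'rV[R[i]]_n) : set R[i] :=
  [set t | slice_dom b z0 t /\ slice_fun b F z0 t = 0].

Definition slice_vanishes (R : realType) (n : nat) (b : 'rV[R[i]]_n)
    (F : 'rV[R[i]]_n -> R[i]) (z0 : 'rV[R[i]]_n) : Prop :=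
  forall t, slice_dom b z0 t -> slice_fun b F z0 t = 0.

Definition Gset_at (R : realType) (n : nat) (b : 'rV[R[i]]_n)
    (L : 'rV[R[i]]_n -> R) (F : 'rV[R[i]]_n -> R[i]) (r : R)
    (z0 : 'rV[R[i]]_n) : set 'rV[R[i]]_n :=
  if `[< slice_zeros b F z0 = set0 >] then set0
  else if `[< slice_vanishes b F z0 >] then
    [set z0 + t *: b | t in slice_dom b z0]
  else \bigcup_(a in slice_zeros b F z0)
    [set z0 + t *: b | t in [set t | cabs (t - a) <= r / L (z0 + a *: b)]].

Definition Gset (R : realType) (n : nat) (b : 'rV[R[i]]_n)
    (L : 'rV[R[i]]_n -> R) (F : 'rV[R[i]]_n -> R[i]) (r : R) :
    set 'rV[R[i]]_n :=
  \bigcup_(z0 in unit_ball R n) Gset_at b L F r z0.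

(* Multiplicity of a as a zero of g: the index of the first derivative that does
   not vanish at a (0 if there is none, which does not happen for an analytic
   function that is not identically zero on a connected open set). *)
Definition zero_mult (R : realType) (g : R[i] -> R[i]) (a : R[i]) : nat :=
  xget 0%N [set m | g^`(m)%classic a <> 0 /\
                    forall k, (k < m)%N -> g^`(k)%classic a = 0].

(* The zeros of F(z0 + t b) in the disc |t - t0| <= rho, counted with
   multiplicity. *)
Definition zero_count (R : realType) (n : nat) (b : 'rV[R[i]]_n)
    (F : 'rV[R[i]]_n -> R[i]) (rho : R) (z0 : 'rV[R[i]]_n) (t0 : R[i]) :
    \bar R :=
  \esum_(a in [set a | slice_zeros b F z0 a /\ cabs (a - t0) <= rho])
     (zero_mult (slice_fun b F z0) a)%:R%:E.

(* Main.v *)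
(* Fix z in the ball and put h(w) = F(z + (w / L(z)) b).  The Taylor coefficients
   of h at 0 are the normalized directional derivatives of F at z, h is defined a
   little beyond |w| <= beta, and L is comparable to L(z) on this disc.

   If F has bounded index, then chaining local Taylor estimates bounds |h| by a
   multiple of its largest coefficient of order <= m0.  Jensen's inequality
   (Blaschke factors) then bounds the number of zeros of h, and once they are
   divided out, Borel-Caratheodory and a Harnack argument bound h'/h away from
   the zeros.

   Conversely, let h = p u with p the monic polynomial whose zeros are those of h.
   Their number is bounded, so some circle |w| = rho with 1 < rho < beta stays
   away from them.  There u'/u = h'/h - p'/p is bounded, hence, by the maximum
   principle, it is bounded inside as well, so |u| is almost constant and
   max |h| over |w| <= rho is at most C max |h| over |w| <= 1.  Cauchy's
   estimates turn this into bounded index.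

   Holomorphic functions enter as uniform limits of polynomials on closed discs.
   For polynomials, Cauchy's estimates and the maximum principle follow from
   averaging over roots of unity. *)
Require Import Defs.
Set Warnings "-notation-overridden,-notation-incompatible-prefix,-ambiguous-paths".
From HB Require Import structures.
From mathcomp Require Import all_boot all_order all_algebra finmap.
From mathcomp Require Import complex.
From mathcomp Require Import all_classical all_reals all_analysis.
From mathcomp Require cyclic separable cyclotomic.
From mathcomp Require Import ring lra zify.

Import Order.TTheory GRing.Theory Num.Theory numFieldNormedType.Exports.

Local Open Scope classical_set_scope.
Local Open Scope ring_scope.

(** No contour integral occurs, so everything holomorphic has to be inherited from polynomials. The
    obstacle: analyticity in several variables, and likewise the inversion of a zero-free function,
    give polynomial approximations only near each point, while Cauchy's estimates, the maximum
    principle and the division by zeros need one approximation on a whole disc. [papprox_glue]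
    bridges the gap. Cauchy's estimates on small discs about all points of a disc of radius s show
    that the Taylor series converges beyond s, by an amount independent of s, and finitely many such
    enlargements reach the required radius.

    Complex logarithms are avoided as well: ln |u| is differentiated along segments as a real
    function, and the mean value theorem replaces integration of u'/u.

    All bounds must be uniform in z. Hence the constants of [zero_bound], [log_deriv_core] and
    [index_from_growth] are quantified before the function to which they apply, and sizes are
    measured against a number A that is compared with the leading Taylor coefficients. *)

Section Modulus.
Variable R : realType.
Implicit Types x y : R[i].

Lemma cabs_ge0 x : 0 <= cabs x.
Proof. by case: x => a b; rewrite /= sqrtr_ge0. Qed.

Lemma cabs0 : cabs (0 : R[i]) = 0.
Proof. exact: Normc.normc0. Qed.

Lemma cabs1 : cabs (1 : R[i]) = 1.
Proof. exact: Normc.normc1. Qed.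

Lemma cabs_eq0 x : (cabs x == 0) = (x == 0).
Proof. by apply/eqP/eqP => [/Normc.eq0_normc//|->]; exact: cabs0. Qed.

Lemma cabs_gt0 x : (0 < cabs x) = (x != 0).
Proof. by rewrite lt_def cabs_eq0 cabs_ge0 andbT. Qed.

Lemma cabsM x y : cabs (x * y) = cabs x * cabs y.
Proof. exact: Normc.normcM. Qed.

Lemma cabsV x : cabs x^-1 = (cabs x)^-1.
Proof. exact: Normc.normcV. Qed.

Lemma cabsN x : cabs (- x) = cabs x.
Proof. by case: x => a c; rewrite /= !sqrrN. Qed.

Lemma cabsD x y : cabs (x + y) <= cabs x + cabs y.
Proof. exact: le_normcD. Qed.

Lemma cabsB x y : cabs (x - y) <= cabs x + cabs y.
Proof. by rewrite -[cabs y]cabsN cabsD. Qed.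

Lemma cabs_distC x y : cabs (x - y) = cabs (y - x).
Proof. by rewrite -cabsN opprB. Qed.

Lemma cabs_tri y x z : cabs (x - z) <= cabs (x - y) + cabs (y - z).
Proof. by apply: le_trans (cabsD _ _); rewrite addrA subrK. Qed.

Lemma cabs_lower x y : cabs x - cabs y <= cabs (x - y).
Proof. by rewrite lerBlDr; apply: le_trans (cabsD _ _); rewrite subrK. Qed.

Lemma cabsX x n : cabs (x ^+ n) = cabs x ^+ n.
Proof. by elim: n => [|n IH]; rewrite ?expr0 ?cabs1 // !exprS cabsM IH. Qed.

Lemma cabs_sum (I : Type) (r : seq I) (P : pred I) (f : I -> R[i]) :
  cabs (\sum_(i <- r | P i) f i) <= \sum_(i <- r | P i) cabs (f i).
Proof.
elim/big_rec2: _ => [|i y x _ H]; first by rewrite cabs0.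
by apply: le_trans (cabsD _ _) _; rewrite lerD2l.
Qed.

Lemma cabs_prod (I : Type) (r : seq I) (P : pred I) (f : I -> R[i]) :
  cabs (\prod_(i <- r | P i) f i) = \prod_(i <- r | P i) cabs (f i).
Proof.
by elim/big_rec2: _ => [|i y x _ H]; rewrite ?cabs1 // cabsM H.
Qed.

Lemma cabs_real (a : R) : cabs a%:C%C = `|a|.
Proof. by rewrite /= expr0n /= addr0 sqrtr_sqr. Qed.

Lemma cabs_nat k : cabs (k%:R : R[i]) = k%:R.
Proof. by rewrite -(rmorph_nat (real_complex R)) cabs_real normr_nat. Qed.

Lemma normr_cabs x : `|x| = (cabs x)%:C%C :> R[i].
Proof. by []. Qed.

Lemma abs_Re_le x : `|complex.Re x| <= cabs x.
Proof.
by case: x => a b /=; rewrite -sqrtr_sqr ler_wsqrtr // lerDl sqr_ge0.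
Qed.

Lemma abs_Im_le x : `|complex.Im x| <= cabs x.
Proof.
by case: x => a b /=; rewrite -sqrtr_sqr ler_wsqrtr // lerDr sqr_ge0.
Qed.

Lemma cabs_le_ReIm x : cabs x <= `|complex.Re x| + `|complex.Im x|.
Proof.
case: x => a b /=; rewrite -[leRHS]ger0_norm ?addr_ge0 // -sqrtr_sqr.
rewrite ler_wsqrtr // sqrrD !real_normK ?num_real //.
by rewrite -addrA lerD2l lerDr mulrn_wge0 // mulr_ge0.
Qed.

Lemma sqr_cabs x : cabs x ^+ 2 = complex.Re x ^+ 2 + complex.Im x ^+ 2.
Proof. by case: x => a b; rewrite /= sqr_sqrtr // addr_ge0 // sqr_ge0. Qed.

End Modulus.

(** * Cauchy's estimates for polynomials, by averaging over roots of unity *)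

Section PolyDisc.
Variable R : realType.
Implicit Types (q : {poly R[i]}) (t w : R[i]) (r M : R).

Lemma complex_prim_root n : (0 < n)%N -> {z : R[i] | n.-primitive_root z}.
Proof.
move=> n_gt0; pose p : {poly R[i]} := 'X^n - 1.
have [r Dp] := closed_field_poly_normal p.
move: Dp; rewrite (monicP _) ?monicXnsubC // scale1r => Dp.
apply/sigW; have rn1 : all n.-unity_root r.
  by apply/allP => z; rewrite -root_prod_XsubC -Dp.
have sz_r : (n < (size r).+1)%N.
  by rewrite -(size_prod_XsubC r id) -Dp size_XnsubC.
have [|z] := hasP (cyclic.has_prim_root n_gt0 rn1 _ sz_r); last by exists z.
by rewrite -separable.separable_prod_XsubC -Dp cyclotomic.separable_Xn_sub_1 // pnatr_eq0 -lt0n.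
Qed.

Lemma cabs_prim_root n z : (0 < n)%N -> n.-primitive_root z -> cabs (z : R[i]) = 1.
Proof.
move=> n0 /prim_expr_order /(congr1 (@Normc.normc R)); rewrite cabsX cabs1 => /eqP.
by rewrite pexpr_eq1 ?cabs_ge0 // => /eqP.
Qed.

Lemma prim_root_sum n (z : R[i]) m : n.-primitive_root z ->
  \sum_(j < n) (z ^+ m) ^+ j = if (n %| m)%N then n%:R else 0.
Proof.
move=> pz; have [nm|nm] := boolP (n %| m)%N.
  rewrite (eq_bigr (fun=> 1)) ?sumr_const ?card_ord // => j _.
  by move: nm; rewrite (prim_order_dvd pz) => /eqP ->; rewrite expr1n.
have zm : z ^+ m - 1 != 0 by rewrite subr_eq0 -(prim_order_dvd pz).
apply: (mulfI zm); rewrite mulr0 -subrX1 -exprM mulnC exprM.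
by rewrite (prim_expr_order pz) expr1n subrr.
Qed.

(** Discrete Cauchy formula: [z ^+ (N - m)] stands for z^(-m), so only exponents congruent to m
    modulo N survive, and among those below N this is m alone. *)
Lemma coef_average q (r : R[i]) N z m : (size q <= N)%N -> (m < N)%N ->
  N.-primitive_root z ->
  \sum_(j < N) (z ^+ (N - m)) ^+ j * q.[r * z ^+ j] = N%:R * (q`_m * r ^+ m).
Proof.
move=> sq mN pz.
under eq_bigr => j _ do rewrite (horner_coef_wide _ sq) mulr_sumr.
rewrite exchange_big /= (bigD1 (Ordinal mN)) //= [X in _ + X]big1 ?addr0.
  rewrite (eq_bigr (fun=> q`_m * r ^+ m)) => [|j _].
    by rewrite sumr_const card_ord mulr_natl.
  have E : z ^+ ((N - m) * j) * z ^+ (j * m) = 1.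
    rewrite [(j * m)%N]mulnC -exprD -mulnDl subnK 1?ltnW // exprM.
    by rewrite (prim_expr_order pz) expr1n.
  rewrite exprMn -!exprM /=.
  transitivity (q`_m * r ^+ m * (z ^+ ((N - m) * j) * z ^+ (j * m))); first by ring.
  by rewrite E mulr1.
move=> k km.
transitivity (q`_k * r ^+ k * \sum_(j < N) (z ^+ (N - m + k)) ^+ j).
  rewrite mulr_sumr; apply: eq_bigr => j _.
  by rewrite exprD !exprMn -!exprM [(k * j)%N]mulnC; ring.
rewrite (prim_root_sum _ _ _ pz) ifN ?mulr0 //.
(* [N - m + k] lies strictly between 0 and 2 N; as a multiple of N it would equal N, that is k =
   m. *)
apply/negP => /dvdnP[c Hc].
have kN := ltn_ord k; have : (c * N < 2 * N)%N.
  by rewrite -Hc; lia.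
rewrite ltn_pmul2r; last by lia.
case: c Hc => [|[|//]] Hc _; first by lia.
by move/negP: km; apply; apply/eqP/val_inj => /=; lia.
Qed.

Lemma poly_cauchy q r M m : 0 <= r ->
  (forall t, cabs t = r -> cabs q.[t] <= M) -> cabs q`_m * r ^+ m <= M.
Proof.
move=> r0 HM.
have M0 : 0 <= M by apply: le_trans (HM r%:C%C _); rewrite ?cabs_ge0 // cabs_real ger0_norm.
pose N := (maxn (size q) m.+1).
have N0 : (0 < N)%N by rewrite /N leq_max ltn0Sn orbT.
have [z pz] := complex_prim_root N N0.
have cz := cabs_prim_root _ _ N0 pz.
have := coef_average q r%:C%C N z m (leq_maxl _ _) (leq_maxr _ _) pz.
move=> /(congr1 (@Normc.normc R)); rewrite !cabsM cabs_nat cabsX cabs_real (ger0_norm r0) => E.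
have : N%:R * (cabs q`_m * r ^+ m) <= N%:R * M.
  rewrite -E; apply: le_trans (cabs_sum _ _ _ _ _) _.
  have -> : N%:R * M = \sum_(j < N) M by rewrite sumr_const card_ord mulr_natl.
  apply: ler_sum => j _; rewrite cabsM !cabsX cz !expr1n mul1r; apply: HM.
  by rewrite cabsM cabsX cz expr1n mulr1 cabs_real ger0_norm.
by rewrite ler_pM2l // ltr0n.
Qed.
End PolyDisc.

(** * Epsilon arguments and geometric decay *)

Section RealAux.
Variable R : realType.
Implicit Types (x y e M : R).

(** The usual exit from an approximation argument: the error e of an approximating polynomial enters
    with a factor B fixed beforehand, and e is sent to 0. *)
Lemma le_eps_mul x y B : 0 <= B -> (forall e, 0 < e -> x <= y + e * B) -> x <= y.
Proof.
move=> B0 H; apply/ler_addgt0Pr => e e0.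
have B1 : 0 < B + 1 by rewrite ltr_wpDl.
apply: le_trans (H (e / (B + 1)) (divr_gt0 e0 B1)) _.
by rewrite lerD2l -mulrA ger_pMr // mulrC ler_pdivrMr // mul1r lerDl.
Qed.

Lemma geo_sum_le x N : 0 <= x < 1 -> \sum_(k < N) x ^+ k <= (1 - x)^-1.
Proof.
case/andP=> x0 x1; rewrite -[leRHS]mul1r ler_pdivlMr ?subr_gt0 //.
have E := subrX1 x N; have H : 0 <= x ^+ N by exact: exprn_ge0.
by move: E H; set S := \sum_(_ < _) _ => E H; lra.
Qed.

Lemma pow_small x M e : 0 <= x < 1 -> 0 < e ->
  exists N, forall n, (N <= n)%N -> M * x ^+ n <= e.
Proof.
case/andP=> x0 x1 e0.
have : (fun n => x ^+ n) @ \oo --> (0 : R).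
  by apply: cvg_expr; rewrite ger0_norm.
have M1 : 0 < `|M| + 1 by rewrite ltr_wpDl.
move=> /cvgrPdist_le /(_ (e / (`|M| + 1)) (divr_gt0 e0 M1)) [N _ HN].
exists N => n /HN /=; rewrite sub0r normrN ger0_norm ?exprn_ge0 // => Hn.
apply: le_trans (_ : `|M| * x ^+ n <= e).
  by apply: ler_wpM2r; rewrite ?exprn_ge0 // ler_norm.
apply: le_trans (ler_wpM2l (normr_ge0 _) Hn) _.
by rewrite mulrCA ger_pMr // ler_pdivrMr // mul1r lerDl.
Qed.

Lemma pow_small1 x M e : 0 <= x < 1 -> 0 < e -> exists N, M * x ^+ N <= e.
Proof. by move=> hx he; have [N /(_ N (leqnn _))] := pow_small x M e hx he; exists N. Qed.

Lemma inv_succ_small e : 0 < e ->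
  exists N, forall n, (N <= n)%N -> n.+1%:R^-1 <= e.
Proof.
move=> e0; exists (Num.truncn e^-1) => n Hn.
rewrite invf_ple ?posrE ?ltr0n //; apply: ltW.
apply: lt_le_trans (truncnS_gt _) _; by rewrite ler_nat ltnS.
Qed.
End RealAux.

(** * Taylor tails, maximum principle and Borel-Caratheodory for polynomials *)

Section PolyDisc2.
Variable R : realType.
Implicit Types (q : {poly R[i]}) (t w : R[i]) (r M : R).

Lemma poly_tail q r M t N : 0 < r -> (forall m, cabs q`_m * r ^+ m <= M) ->
  cabs t < r ->
  cabs (q.[t] - \sum_(k < N) q`_k * t ^+ k) <= M * (cabs t / r) ^+ N / (1 - cabs t / r).
Proof.
move=> r0 HM tr; set x := cabs t / r.
have x0 : 0 <= x by rewrite divr_ge0 ?cabs_ge0 // ltW.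
have x1 : x < 1 by rewrite ltr_pdivrMr // mul1r.
have M0 : 0 <= M by apply: le_trans (HM 0%N); rewrite expr0 mulr1 cabs_ge0.
(* Padding the sum to length N + size q allows it to be cut at N whatever the degree of q. *)
rewrite (@horner_coef_wide _ (N + size q)) ?leq_addl // big_split_ord /=.
rewrite [X in X - _]addrC addrK; apply: le_trans (cabs_sum _ _ _ _ _) _.
apply: le_trans (_ : \sum_(k < size q) M * x ^+ N * x ^+ k <= _).
  apply: ler_sum => k _; rewrite cabsM cabsX -mulrA -exprD.
  have -> : cabs t = r * x by rewrite /x mulrCA divff ?mulr1 // gt_eqF.
  by rewrite exprMn mulrA ler_wpM2r ?exprn_ge0.
rewrite -mulr_sumr ler_wpM2l ?mulr_ge0 ?exprn_ge0 //.
by apply: geo_sum_le; rewrite x0.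
Qed.

Lemma poly_bound q r M t : 0 < r -> (forall m, cabs q`_m * r ^+ m <= M) ->
  cabs t < r -> cabs q.[t] <= M / (1 - cabs t / r).
Proof.
move=> r0 HM tr; have := poly_tail q r M t 0 r0 HM tr.
by rewrite big_ord0 subr0 expr0 mulr1.
Qed.

(* Cauchy's estimates applied to q ^ k lose a constant which is independent
   of k and so disappears in the k-th root. *)
Lemma poly_max q r M : 0 < r -> (forall t, cabs t = r -> cabs q.[t] <= M) ->
  forall t, cabs t <= r -> cabs q.[t] <= M.
Proof.
move=> r0 HM t; rewrite le_eqVlt => /orP[/eqP/HM //|tr].
have M0 : 0 <= M by apply: le_trans (HM r%:C%C _); rewrite ?cabs_ge0 // cabs_real gtr0_norm.
set x := cabs t / r; have x1 : x < 1 by rewrite ltr_pdivrMr // mul1r.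
rewrite leNgt; apply/negP => Mq.
have q0 := le_lt_trans M0 Mq; set Y := cabs q.[t] in Mq q0.
have H k : Y ^+ k <= M ^+ k / (1 - x).
  rewrite -cabsX -horner_exp; apply: poly_bound => // m.
  apply: poly_cauchy => [|s hs]; first exact: ltW.
  by rewrite horner_exp cabsX lerXn2r ?nnegrE ?cabs_ge0 // HM.
have MY : 0 <= M / Y < 1 by rewrite divr_ge0 ?(ltW q0) //= ltr_pdivrMr // mul1r.
have d0 : 0 < (1 - x) / 2 by rewrite divr_gt0 // subr_gt0.
have [N HN] := pow_small1 _ _ 1 _ MY d0.
have := H N; rewrite ler_pdivlMr ?subr_gt0 // => H1.
move: HN; rewrite mul1r expr_div_n ler_pdivrMr ?exprn_gt0 // => H2.
have := le_trans H1 H2; rewrite mulrC ler_pM2r ?exprn_gt0 //.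
by rewrite leNgt => /negP; apply; rewrite ltr_pdivrMr // ltr_pMr ?subr_gt0 // ltr1n.
Qed.

Lemma poly_disc_bounded q r : 0 <= r ->
  exists2 M, 0 <= M & forall t, cabs t <= r -> cabs q.[t] <= M.
Proof.
move=> r0; exists (\sum_(k < size q) cabs q`_k * r ^+ k).
  by apply: sumr_ge0 => k _; rewrite mulr_ge0 ?cabs_ge0 ?exprn_ge0.
move=> t tr; rewrite horner_coef; apply: le_trans (cabs_sum _ _ _ _ _) _.
apply: ler_sum => k _; rewrite cabsM cabsX ler_wpM2l ?cabs_ge0 //.
by rewrite lerXn2r ?nnegrE ?cabs_ge0.
Qed.

Lemma poly_diff_quot q t : exists s : {poly R[i]}, q = s * ('X - t%:P) + q.[t]%:P.
Proof.
have : root (q - q.[t]%:P) t by rewrite rootE !hornerE subrr.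
by move=> /factor_theorem[s Hs]; exists s; rewrite -Hs subrK.
Qed.

Lemma poly_ucont q r e : 0 <= r -> 0 < e ->
  forall t, exists2 d, 0 < d & forall t', cabs t' <= r -> cabs (t' - t) <= d ->
    cabs (q.[t'] - q.[t]) <= e.
Proof.
move=> r0 e0 t; have [s Hs] := poly_diff_quot q t.
have [M M0 HM] := poly_disc_bounded s r r0.
have M1 : 0 < M + 1 by rewrite ltr_wpDl.
exists (e / (M + 1)); first exact: divr_gt0.
move=> t' tr' tt; rewrite {1}Hs !hornerE addrK cabsM.
apply: le_trans (ler_pM (cabs_ge0 _ _) (cabs_ge0 _ _) (HM _ tr') tt) _.
by rewrite mulrCA ger_pMr // ler_pdivrMr // mul1r lerDl.
Qed.

(* Averaging against z^-j kills the conjugate of q, whence twice the real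
   part; the constants drop out since the mean of Re q is Re q(0) = 0. *)
Lemma poly_borel_caratheodory q r (a : R) : 0 <= r -> q.[0] = 0 ->
  (forall t, cabs t = r -> complex.Re q.[t] <= a) -> cabs q`_1 * r <= 2 * a.
Proof.
move=> r0 q0 Ha.
(* With this N the index N - 1 is beyond the degree of q, so averaging against z^j, which extracts
   the coefficient of index N - 1, gives 0 in [S2]. *)
pose N := (size q).+2; have [z pz] := complex_prim_root R N isT.
have cz := cabs_prim_root R N z isT pz.
have hN : (size q <= N)%N by rewrite /N ltnW.
pose v (j : 'I_N) := q.[r%:C%C * z ^+ j].
have zz (j : nat) : z ^+ j * (z ^+ (N - 1)) ^+ j = 1.
  rewrite -exprMn -exprS subn1 prednK // (prim_expr_order pz).
  by rewrite expr1n.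
have conjz (j : nat) : (z ^+ j)^* = (z ^+ (N - 1)) ^+ j.
  have := zz j; set u := z ^+ j; set w := _ ^+ j => uw.
  have u1 : cabs u = 1 by rewrite cabsX cz expr1n.
  have u0 : u != 0 by rewrite -cabs_eq0 u1 oner_eq0.
  apply: (mulfI u0); rewrite uw.
  by rewrite -normCK normr_cabs u1 rmorph1 expr1n.
have S1 : \sum_(j < N) (z ^+ (N - 1)) ^+ j * v j = N%:R * (q`_1 * r%:C%C).
  exact: (coef_average R q r%:C%C N z 1 hN).
have S2 : \sum_(j < N) z ^+ j * v j = 0.
  transitivity (\sum_(j < N) (z ^+ (N - (size q).+1)) ^+ j * v j).
    by apply: eq_bigr => j _; rewrite /N subSnn expr1.
  rewrite (coef_average _ q r%:C%C N z (size q).+1 hN (ltnSn _) pz).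
  by rewrite nth_default ?mul0r ?mulr0 // ltnW.
have S3 : \sum_(j < N) v j = 0.
  transitivity (\sum_(j < N) (z ^+ (N - 0)) ^+ j * v j).
    apply: eq_bigr => j _.
    by rewrite subn0 (prim_expr_order pz) expr1n mul1r.
  rewrite (coef_average _ q r%:C%C N z 0 hN isT pz).
  by rewrite -horner_coef0 q0 mul0r mulr0.
have S4 : \sum_(j < N) (z ^+ (N - 1)) ^+ j = 0.
  by rewrite (prim_root_sum _ _ _ _ pz) ifN // subn1 gtnNdvd.
have S5 : \sum_(j < N) (z ^+ (N - 1)) ^+ j * (a - complex.Re (v j))%:C%C
          = - (2^-1 * (N%:R * (q`_1 * r%:C%C))).
  rewrite -S1.
  have -> : \sum_(j < N) (z ^+ (N - 1)) ^+ j * (a - complex.Re (v j))%:C%C =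
     a%:C%C * \sum_(j < N) (z ^+ (N - 1)) ^+ j -
     2^-1 * (\sum_(j < N) (z ^+ (N - 1)) ^+ j * v j + (\sum_(j < N) z ^+ j * v j)^*).
    rewrite rmorph_sum /= -big_split /= !mulr_sumr -sumrB; apply: eq_bigr => j _.
    rewrite rmorphM /= conjz.
    have -> : (v j)^* = 2 * (complex.Re (v j))%:C%C - v j.
      by rewrite -addcJ addrAC subrr add0r; case: (v j).
    by rewrite rmorphB /=; field.
  by rewrite S4 S2 rmorph0 mulr0 addr0 sub0r.
have T : cabs (2^-1 * (N%:R * (q`_1 * r%:C%C))) <= N%:R * a.
  rewrite -cabsN -S5; apply: le_trans (cabs_sum _ _ _ _ _) _.
  have -> : N%:R * a = \sum_(j < N) (a - complex.Re (v j)).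
    rewrite sumrB sumr_const card_ord mulr_natl.
    have : complex.Re (\sum_(j < N) v j) = 0 by rewrite S3.
    have -> : complex.Re (\sum_(j < N) v j) = \sum_(j < N) complex.Re (v j).
      by elim/big_rec2: _ => //= j x y _ <-; case: (v j) y => ? ? [].
    by move=> ->; rewrite subr0.
  apply: ler_sum => j _; rewrite cabsM cabs_real !cabsX cz !expr1n mul1r.
  rewrite ger0_norm // subr_ge0 Ha // cabsM cabsX cz expr1n mulr1 cabs_real.
  by rewrite ger0_norm.
move: T; rewrite !cabsM cabsV !cabs_nat cabs_real (ger0_norm r0).
rewrite mulrCA ler_pM2l ?ltr0n // mulrC ler_pdivrMr ?ltr0n // => T.
by rewrite [2 * a]mulrC.
Qed.
End PolyDisc2.

(** * Uniform limits of polynomials on closed discs *)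

Section Papprox.
Variable R : realType.
Implicit Types (g f : R[i] -> R[i]) (p t : R[i]) (r e M : R).

(** This is the disc algebra: functions continuous on the closed disc and holomorphic inside. Being
    a closure of polynomials, it lets each polynomial estimate pass to g with an error that is then
    sent to 0. *)
Definition papprox p r g : Prop :=
  forall e, 0 < e -> exists q : {poly R[i]},
    forall t, cabs (t - p) <= r -> cabs (g t - q.[t]) <= e.

Lemma papprox_affine p r g a b p' r' :
  (forall t, cabs (t - p') <= r' -> cabs (a + b * t - p) <= r) ->
  papprox p r g -> papprox p' r' (fun t => g (a + b * t)).
Proof.
move=> H Hg e /Hg[q Hq]; exists (q \Po (a%:P + b *: 'X)) => t /H /Hq.
by rewrite horner_comp !hornerE.
Qed.

Lemma papprox_ext p r g f : (forall t, cabs (t - p) <= r -> g t = f t) ->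
  papprox p r g -> papprox p r f.
Proof. by move=> H Hg e /Hg[q Hq]; exists q => t Ht; rewrite -H // Hq. Qed.

Lemma papprox_sub p r g p' r' :
  (forall t, cabs (t - p') <= r' -> cabs (t - p) <= r) ->
  papprox p r g -> papprox p' r' g.
Proof. by move=> H Hg e /Hg[q Hq]; exists q => t /H /Hq. Qed.

Lemma papprox_le p r g r' : r' <= r -> papprox p r g -> papprox p r' g.
Proof. by move=> rr; apply: papprox_sub => t /le_trans; apply. Qed.

Lemma papprox_disc p r g p' r' : cabs (p' - p) + r' <= r ->
  papprox p r g -> papprox p' r' g.
Proof.
move=> H; apply: papprox_sub => t Ht.
by apply: le_trans (cabs_tri _ p' _ _) _; lra.
Qed.

Lemma papprox_shift p r g a : papprox (a + p) r g -> papprox p r (fun t => g (a + t)).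
Proof.
move=> H; apply: papprox_ext (papprox_affine (a + p) r g a 1 p r _ H) => t.
  by rewrite mul1r.
by rewrite mul1r; congr (cabs _ <= _); ring.
Qed.

Lemma papprox_unshift p r g a : papprox p r (fun t => g (a + t)) -> papprox (a + p) r g.
Proof.
move=> H; apply: papprox_ext (papprox_affine p r _ (- a) 1 (a + p) r _ H) => t.
  by rewrite mul1r addNKr.
by rewrite mul1r; congr (cabs _ <= _); ring.
Qed.

Lemma papprox_poly p r q : papprox p r (fun t => q.[t]).
Proof. by move=> e e0; exists q => t _; rewrite subrr cabs0 ltW. Qed.

Lemma papprox_cst p r c : papprox p r (fun=> c).
Proof. by move=> e e0; exists c%:P => t _; rewrite hornerC subrr cabs0 ltW. Qed.

Lemma papprox_bounded p r g : 0 <= r -> papprox p r g ->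
  exists2 M, 0 < M & forall t, cabs (t - p) <= r -> cabs (g t) <= M.
Proof.
move=> r0 /(_ 1 ltr01) [q Hq].
have [|M M0 HM] := poly_disc_bounded _ q (cabs p + r).
  by rewrite addr_ge0 ?cabs_ge0.
exists (M + 1); first by rewrite ltr_wpDl.
move=> t Ht; rewrite -[g t](subrK q.[t]).
apply: le_trans (cabsD _ _ _) _; rewrite addrC lerD ?Hq // HM //.
by have := cabs_lower _ t p; lra.
Qed.

Lemma papproxD p r g f : papprox p r g -> papprox p r f ->
  papprox p r (fun t => g t + f t).
Proof.
move=> Hg Hf e e0; have e2 : 0 < e / 2 by rewrite divr_gt0.
have [q Hq] := Hg _ e2; have [q' Hq'] := Hf _ e2.
exists (q + q') => t Ht; rewrite hornerD opprD addrACA.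
apply: le_trans (cabsD _ _ _) _; rewrite (splitr e).
by rewrite lerD ?Hq ?Hq'.
Qed.

Lemma papproxM p r g f : 0 <= r -> papprox p r g -> papprox p r f ->
  papprox p r (fun t => g t * f t).
Proof.
move=> r0 Hg Hf e e0.
have [A A0 HA] := papprox_bounded _ _ _ r0 Hf.
have e2 : 0 < e / 2 by rewrite divr_gt0.
have [q Hq] := Hg _ (divr_gt0 e2 A0).
have [B B0 HB] := papprox_bounded _ _ _ r0 (papprox_poly p r q).
have [q' Hq'] := Hf _ (divr_gt0 e2 B0).
exists (q * q') => t Ht; rewrite hornerM.
have -> : g t * f t - q.[t] * q'.[t] = (g t - q.[t]) * f t + q.[t] * (f t - q'.[t]).
  by ring.
apply: le_trans (cabsD _ _ _) _; rewrite (splitr e) !cabsM; apply: lerD.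
  apply: le_trans (ler_pM (cabs_ge0 _ _) (cabs_ge0 _ _) (Hq _ Ht) (HA _ Ht)) _.
  by rewrite divfK // gt_eqF.
apply: le_trans (ler_pM (cabs_ge0 _ _) (cabs_ge0 _ _) (HB _ Ht) (Hq' _ Ht)) _.
by rewrite mulrC divfK // gt_eqF.
Qed.

Lemma papproxZ p r g c : 0 <= r -> papprox p r g -> papprox p r (fun t => c * g t).
Proof. by move=> r0; apply: papproxM => //; exact: papprox_cst. Qed.

Lemma papproxB p r g f : 0 <= r -> papprox p r g -> papprox p r f ->
  papprox p r (fun t => g t - f t).
Proof.
move=> r0 Hg Hf; apply: papprox_ext (papproxD _ _ _ _ Hg (papproxZ _ _ _ (-1) r0 Hf)).
by move=> t _; rewrite mulN1r.
Qed.

Lemma papprox_unif p r g :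
  (forall e, 0 < e -> exists2 f, papprox p r f &
     forall t, cabs (t - p) <= r -> cabs (g t - f t) <= e) ->
  papprox p r g.
Proof.
move=> H e e0; have e2 : 0 < e / 2 by rewrite divr_gt0.
have [f Hf Hgf] := H _ e2; have [q Hq] := Hf _ e2; exists q => t Ht.
apply: le_trans (cabs_tri _ (f t) _ _) _; rewrite (splitr e).
by rewrite lerD ?Hq ?Hgf.
Qed.

Lemma papprox_max r g M : 0 < r -> papprox 0 r g ->
  (forall t, cabs t = r -> cabs (g t) <= M) ->
  forall t, cabs t <= r -> cabs (g t) <= M.
Proof.
move=> r0 Hg HM t Ht; apply: (le_eps_mul _ _ _ 2) => // e e0.
have [q Hq] := Hg _ e0.
have H s : cabs s <= r -> cabs (g s - q.[s]) <= e by move=> Hs; apply: Hq; rewrite subr0.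
have : cabs q.[t] <= M + e.
  apply: (poly_max _ _ r) => // s Hs.
  have := H s; rewrite Hs lexx => /(_ isT).
  have := HM s Hs; have := cabs_lower _ q.[s] (g s); rewrite cabs_distC; lra.
have := H t Ht; have := cabs_lower _ (g t) q.[t]; lra.
Qed.

Lemma papprox_cont p r g t e : 0 <= r -> papprox p r g -> cabs (t - p) <= r ->
  0 < e -> exists2 d, 0 < d &
    forall s, cabs (s - p) <= r -> cabs (s - t) <= d -> cabs (g s - g t) <= e.
Proof.
move=> r0 Hg Ht e0; have e3 : 0 < e / 3 by rewrite divr_gt0.
have [q Hq] := Hg _ e3.
have [|d d0 Hd] := poly_ucont _ q (cabs p + r) _ _ e3 t.
  by rewrite addr_ge0 ?cabs_ge0.
exists d => // s Hs Hst.
have H1 := Hq s Hs; have H2 := Hq t Ht.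
have H3 : cabs (q.[s] - q.[t]) <= e / 3.
  by apply: Hd => //; have := cabs_lower _ s p; lra.
have -> : g s - g t = (g s - q.[s]) + (q.[s] - q.[t]) + (q.[t] - g t) by ring.
have := cabsD _ ((g s - q.[s]) + (q.[s] - q.[t])) (q.[t] - g t).
have := cabsD _ (g s - q.[s]) (q.[s] - q.[t]).
rewrite [cabs (q.[t] - _)]cabs_distC; lra.
Qed.

Lemma complex_complete (u : nat -> R[i]) :
  (forall e, 0 < e -> exists N, forall n m, (N <= n)%N -> (N <= m)%N ->
     cabs (u n - u m) <= e) ->
  exists l, forall e, 0 < e -> exists N, forall n, (N <= n)%N -> cabs (u n - l) <= e.
Proof.
move=> H.
have aux (P : R[i] -> R) : (forall x y, `|P x - P y| <= cabs (x - y)) ->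
    exists l : R, forall e, 0 < e -> exists N, forall n, (N <= n)%N -> `|P (u n) - l| <= e.
  move=> HP; have : cauchy ((P \o u) @ \oo).
    apply: cauchy_exP => e e0; have [N HN] := H (e / 2) (divr_gt0 e0 (ltr0n _ 2)).
    exists (P (u N)), N => // n /= Nn; rewrite /ball /=.
    apply: le_lt_trans (HP _ _) _; apply: le_lt_trans (HN _ _ (leqnn N) Nn) _.
    by rewrite ltr_pdivrMr // ltr_pMr // ltr1n.
  move=> /cauchy_cvgP /cvg_ex[l /cvgrPdist_le Hl]; exists l => e /Hl[N _ HN].
  by exists N => n /HN /=; rewrite distrC.
have [|a Ha] := aux (@complex.Re R).
  by move=> x y; apply: le_trans (abs_Re_le _ (x - y)); case: x y => ? ? [].
have [|b Hb] := aux (@complex.Im R).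
  by move=> x y; apply: le_trans (abs_Im_le _ (x - y)); case: x y => ? ? [].
exists (a +i* b)%C => e e0; have e2 : 0 < e / 2 by rewrite divr_gt0.
have [N HN] := Ha _ e2; have [N' HN'] := Hb _ e2.
exists (maxn N N') => n; rewrite geq_max => /andP[/HN H1 /HN' H2].
apply: le_trans (cabs_le_ReIm _ _) _; rewrite (splitr e).
by move: H1 H2; case: (u n) => x y /= H1 H2; exact: lerD.
Qed.

(* c is the sequence of Taylor coefficients of g at 0, characterized by Cauchy's
   estimates for g - q, with q polynomial, instead of derivatives of g. *)
Definition has_coef r g (c : nat -> R[i]) : Prop :=
  forall (q : {poly R[i]}) e,
    (forall t, cabs t <= r -> cabs (g t - q.[t]) <= e) ->
    forall m, cabs (c m - q`_m) * r ^+ m <= e.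

(** Cauchy's estimate applied to differences of approximants makes their m-th coefficients a Cauchy
    sequence. Comparing the approximants with an arbitrary polynomial in the same way gives the
    defining property of the limit. *)
Lemma papprox_coef r g : 0 < r -> papprox 0 r g -> exists c, has_coef r g c.
Proof.
move=> r0 Hg.
have /choice[q Hq] n : exists q : {poly R[i]},
    forall t, cabs t <= r -> cabs (g t - q.[t]) <= n.+1%:R^-1.
  have [|q Hq] := Hg n.+1%:R^-1; first by rewrite invr_gt0 ltr0n.
  by exists q => t Ht; apply: Hq; rewrite subr0.
have D (q1 q2 : {poly R[i]}) e1 e2 m :
    (forall t, cabs t <= r -> cabs (g t - q1.[t]) <= e1) ->
    (forall t, cabs t <= r -> cabs (g t - q2.[t]) <= e2) ->
    cabs (q1`_m - q2`_m) * r ^+ m <= e1 + e2.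
  move=> H1 H2; rewrite -coefB; apply: poly_cauchy (ltW r0) _ => t Ht.
  rewrite hornerD hornerN; apply: le_trans (cabs_tri _ (g t) _ _) _.
  by rewrite cabs_distC lerD ?H1 ?H2 // Ht.
have /choice[c Hc] m : exists l, forall e, 0 < e ->
    exists N, forall n, (N <= n)%N -> cabs ((q n)`_m - l) <= e.
  apply: complex_complete => e e0.
  have e2 : 0 < e * r ^+ m / 2 by rewrite divr_gt0 // mulr_gt0 // exprn_gt0.
  have [N HN] := inv_succ_small _ _ e2; exists N => n k Hn Hk.
  have := D _ _ _ _ m (Hq n) (Hq k); rewrite -ler_pdivlMr ?exprn_gt0 // => H.
  apply: le_trans H _; rewrite ler_pdivrMr ?exprn_gt0 //.
  by rewrite (splitr (e * _)) lerD ?HN.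
exists c => p e He m; apply: (le_eps_mul _ _ _ (1 + r ^+ m)).
  by rewrite addr_ge0 // exprn_ge0 // ltW.
move=> d d0; have [N HN] := Hc m d d0; have [N' HN'] := inv_succ_small _ _ d0.
have H1 := HN _ (leq_maxl N N'); have H2 := HN' _ (leq_maxr N N').
have H3 := D _ _ _ _ m (Hq (maxn N N')) He.
set x := (q _)`_m in H1 H3.
have rm : 0 < r ^+ m by exact: exprn_gt0.
apply: le_trans (_ : (cabs (x - c m) + cabs (x - p`_m)) * r ^+ m <= _).
  by rewrite ler_wpM2r ?(ltW rm) // [cabs (x - c m)]cabs_distC cabs_tri.
have := ler_wpM2r (ltW rm) H1; move: H2 H3; rewrite mulrDl mulrDr mulr1.
by move: (_^-1) (_ * r ^+ m) (_ * r ^+ m) (d * r ^+ m) => *; lra.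
Qed.

Lemma has_coef_bound r g c M : (forall t, cabs t <= r -> cabs (g t) <= M) ->
  has_coef r g c -> forall m, cabs (c m) * r ^+ m <= M.
Proof.
move=> HM /(_ 0 M) H m; have := H _ m; rewrite coef0 subr0; apply => t Ht.
by rewrite horner0 subr0 HM.
Qed.

Lemma papprox0 r g : papprox 0 r g -> forall e, 0 < e ->
  exists q : {poly R[i]}, forall t, cabs t <= r -> cabs (g t - q.[t]) <= e.
Proof. by move=> Hg e /Hg[q Hq]; exists q => t Ht; rewrite Hq // subr0. Qed.

Lemma has_coef_restr r r' g c : 0 < r' <= r -> papprox 0 r g ->
  has_coef r g c -> has_coef r' g c.
Proof.
move=> /andP[r0 rr] Hg Hc q e He m; apply: (le_eps_mul _ _ _ 2) => // d d0.
have [p Hp] := papprox0 _ _ Hg _ d0.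
have H1 := Hc _ _ Hp m.
have H2 : cabs (p`_m - q`_m) * r' ^+ m <= d + e.
  rewrite -coefB; apply: poly_cauchy (ltW r0) _ => t Ht.
  rewrite hornerD hornerN; apply: le_trans (cabs_tri _ (g t) _ _) _.
  by rewrite cabs_distC lerD ?Hp ?He // Ht.
have H3 : cabs (c m - p`_m) * r' ^+ m <= d.
  apply: le_trans _ H1; rewrite ler_wpM2l ?cabs_ge0 //.
  by rewrite lerXn2r ?nnegrE // ltW // (lt_le_trans r0).
have : cabs (c m - q`_m) * r' ^+ m <= (cabs (c m - p`_m) + cabs (p`_m - q`_m)) * r' ^+ m.
  by rewrite ler_wpM2r ?cabs_tri // exprn_ge0 // ltW.
by rewrite mulrDl; lra.
Qed.

Lemma has_coef_taylor r g c M N t : 0 < r -> papprox 0 r g -> has_coef r g c ->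
  (forall t, cabs t <= r -> cabs (g t) <= M) -> cabs t < r ->
  cabs (g t - \sum_(k < N) c k * t ^+ k) <= M * (cabs t / r) ^+ N / (1 - cabs t / r).
Proof.
move=> r0 Hg Hc HM tr; set x := cabs t / r.
have x0 : 0 <= x by rewrite divr_ge0 ?cabs_ge0 // ltW.
have x1 : 0 < 1 - x by rewrite subr_gt0 ltr_pdivrMr // mul1r.
have y0 : 0 <= (1 - x)^-1 by rewrite invr_ge0 ltW.
have xN : 0 <= x ^+ N by exact: exprn_ge0.
apply: (le_eps_mul _ _ _ (1 + x ^+ N / (1 - x) + (1 - x)^-1)).
  by rewrite !addr_ge0 // mulr_ge0.
move=> e e0; have [q Hq] := papprox0 _ _ Hg _ e0.
have Hb s : cabs s = r -> cabs q.[s] <= M + e.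
  move=> Hs; have := Hq s; have := HM s; rewrite Hs lexx => /(_ isT) H1 /(_ isT) H2.
  by have := cabs_lower _ q.[s] (g s); rewrite cabs_distC; lra.
have H1 := poly_tail _ q r _ t N r0 (fun m => poly_cauchy _ q r _ m (ltW r0) Hb) tr.
have H2 : cabs (\sum_(k < N) q`_k * t ^+ k - \sum_(k < N) c k * t ^+ k) <= e / (1 - x).
  rewrite -sumrB; apply: le_trans (cabs_sum _ _ _ _ _) _.
  apply: le_trans (_ : \sum_(k < N) e * x ^+ k <= _); last first.
    rewrite -mulr_sumr ler_wpM2l ?(ltW e0) // geo_sum_le // x0 /=.
    by rewrite -subr_gt0.
  apply: ler_sum => k _; rewrite -mulrBl cabsM cabsX cabs_distC.
  have -> : cabs t = r * x by rewrite /x mulrCA divff ?mulr1 // gt_eqF.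
  by rewrite exprMn mulrA ler_wpM2r ?exprn_ge0 // Hc.
have H3 := Hq t (ltW tr).
rewrite -/x in H1.
have := cabs_tri _ q.[t] (g t) (\sum_(k < N) c k * t ^+ k).
have := cabs_tri _ (\sum_(k < N) q`_k * t ^+ k) q.[t] (\sum_(k < N) c k * t ^+ k).
have -> : M * x ^+ N / (1 - x) + e * (1 + x ^+ N / (1 - x) + (1 - x)^-1) =
  e + (M + e) * x ^+ N / (1 - x) + e / (1 - x) by ring.
lra.
Qed.

Lemma has_coef0 r g c : 0 < r -> papprox 0 r g -> has_coef r g c -> g 0 = c 0%N.
Proof.
move=> r0 Hg Hc; have [M M0 HM] := papprox_bounded _ _ _ (ltW r0) Hg.
have HM' t : cabs t <= r -> cabs (g t) <= M by move=> Ht; apply: HM; rewrite subr0.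
have := has_coef_taylor r g c M 1 0 r0 Hg Hc HM'; rewrite cabs0 => /(_ r0).
rewrite big_ord1 expr0 mulr1 mul0r expr1 mulr0 mul0r => H.
by apply/eqP; rewrite -subr_eq0 -cabs_eq0 eq_le H cabs_ge0.
Qed.

(** Identity theorem at the centre: the coefficients do not depend on the radius, so they vanish by
    Cauchy's estimate on the small disc, and the Taylor expansion on the large one is 0. *)
Lemma papprox_zero r g s : 0 < s -> papprox 0 r g ->
  (forall t, cabs t <= s -> g t = 0) -> forall t, cabs t < r -> g t = 0.
Proof.
move=> s0 Hg H0 t tr; have r0 : 0 < r by apply: le_lt_trans tr; exact: cabs_ge0.
have [c Hc] := papprox_coef _ _ r0 Hg.
have [M M0 HM] := papprox_bounded _ _ _ (ltW r0) Hg.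
have HM' u : cabs u <= r -> cabs (g u) <= M by move=> Hu; apply: HM; rewrite subr0.
pose s' := Num.min s r.
have s'0 : 0 < s' <= r by rewrite lt_min s0 r0 ge_min lexx orbT.
have c0 m : c m = 0.
  have := has_coef_bound s' g c 0 _ (has_coef_restr _ _ _ _ s'0 Hg Hc) m.
  case/andP: s'0 => s'0 _.
  rewrite pmulr_lle0 ?exprn_gt0 // => H; apply/eqP.
  rewrite -cabs_eq0 eq_le cabs_ge0 H //.
  by move=> u; rewrite le_min => /andP[/H0 -> _]; rewrite cabs0.
apply/eqP; rewrite -cabs_eq0 eq_le cabs_ge0 andbT; apply/ler_addgt0Pr => e e0.
rewrite add0r.
have x1 : 0 <= cabs t / r < 1.
  by rewrite divr_ge0 ?cabs_ge0 ?(ltW r0) //= ltr_pdivrMr // mul1r.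
have [N HN] := pow_small1 _ _ (M / (1 - cabs t / r)) _ x1 e0.
have := has_coef_taylor r g c M N t r0 Hg Hc HM' tr.
rewrite big1 ?subr0 => [H|k _]; last by rewrite c0 mul0r.
by apply: le_trans H _; rewrite mulrAC.
Qed.

Lemma papprox_zero_at p r g s : 0 < s -> papprox p r g ->
  (forall t, cabs (t - p) <= s -> g t = 0) -> forall t, cabs (t - p) < r -> g t = 0.
Proof.
move=> s0 Hg H0 t tr.
have := papprox_zero r (fun t => g (p + t)) s s0 _ _ (t - p) tr.
rewrite [p + _]addrC subrK; apply.
  by apply: papprox_shift; rewrite addr0.
by move=> u Hu; apply: H0; rewrite addrC addKr.
Qed.

(** Partial sums are polynomials with coefficients controlled by M, so [poly_tail] makes them
    Cauchy. The explicit tail bound serves later both to approximate G uniformly and to identify it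
    with a given function. *)
Lemma power_series r (c : nat -> R[i]) M : 0 < r ->
  (forall m, cabs (c m) * r ^+ m <= M) ->
  exists G, forall t N, cabs t < r ->
   cabs (G t - \sum_(k < N) c k * t ^+ k) <= M * (cabs t / r) ^+ N / (1 - cabs t / r).
Proof.
move=> r0 HM.
have T t N K : (N <= K)%N -> cabs t < r ->
    cabs (\sum_(k < K) c k * t ^+ k - \sum_(k < N) c k * t ^+ k) <=
    M * (cabs t / r) ^+ N / (1 - cabs t / r).
  move=> NK tr.
  have HM' m : cabs (\poly_(k < K) c k)`_m * r ^+ m <= M.
    rewrite coef_poly; case: ifP => // _; rewrite cabs0 mul0r.
    by apply: le_trans (HM 0%N); rewrite expr0 mulr1 cabs_ge0.
  have := poly_tail _ (\poly_(k < K) c k) r M t N r0 HM' tr.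
  rewrite horner_poly; congr (cabs (_ - _) <= _).
  by apply: eq_bigr => k _; rewrite coef_poly (leq_trans (ltn_ord k)).
have /choice[G HG] t : exists l, cabs t < r -> forall e, 0 < e ->
    exists N, forall n, (N <= n)%N -> cabs (\sum_(k < n) c k * t ^+ k - l) <= e.
  have [tr|] := ltP (cabs t) r; last by exists 0.
  have [|l Hl] := complex_complete (fun n => \sum_(k < n) c k * t ^+ k).
    move=> e e0; have x1 : 0 <= cabs t / r < 1.
      by rewrite divr_ge0 ?cabs_ge0 ?(ltW r0) //= ltr_pdivrMr // mul1r.
    have e2 : 0 < e / 2 by rewrite divr_gt0.
    have [N HN] := pow_small1 _ _ (M / (1 - cabs t / r)) _ x1 e2.
    exists N => n m Hn Hm.
    apply: le_trans (cabs_tri _ (\sum_(k < N) c k * t ^+ k) _ _) _.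
    rewrite (splitr e) [X in _ + X <= _]cabs_distC.
    by apply: lerD; (apply: le_trans (T _ _ _ _ tr) _; rewrite // mulrAC).
  by exists l.
exists G => t N tr; apply/ler_addgt0Pr => e e0.
have [K HK] := HG t tr e e0; have H1 := HK _ (leq_maxl K N).
have H2 := T t N _ (leq_maxr K N) tr.
apply: le_trans (cabs_tri _ _ _ _) (_ : cabs (G t - \sum_(k < maxn K N) c k * t ^+ k) + _ <= _).
by rewrite addrC lerD // cabs_distC.
Qed.

Lemma power_series_papprox r (c : nat -> R[i]) M G s : 0 < r -> 0 <= s < r -> 
  (forall t N, cabs t < r ->
   cabs (G t - \sum_(k < N) c k * t ^+ k) <= M * (cabs t / r) ^+ N / (1 - cabs t / r)) ->
  papprox 0 s G.
Proof.
move=> r0 /andP[s0 sr] H e e0.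
have x1 : 0 <= s / r < 1 by rewrite divr_ge0 ?(ltW r0) //= ltr_pdivrMr // mul1r.
have [N HN] := pow_small1 _ _ (`|M| / (1 - s / r)) _ x1 e0.
exists (\poly_(k < N) c k) => t; rewrite subr0 => ts.
rewrite horner_poly; apply: le_trans (H _ _ (le_lt_trans ts sr)) _.
apply: le_trans HN; rewrite [leRHS]mulrAC.
have xy : cabs t / r <= s / r by rewrite ler_wpM2r // invr_ge0 ltW.
have x0 : 0 <= cabs t / r by rewrite divr_ge0 ?cabs_ge0 // ltW.
case/andP: x1 => x2 x1.
have y1 : 0 <= 1 - cabs t / r by lra.
have y2 : 0 < 1 - s / r by lra.
apply: le_trans (_ : `|M| * (cabs t / r) ^+ N / (1 - cabs t / r) <= _).
  by rewrite ler_wpM2r ?invr_ge0 // ler_wpM2r ?exprn_ge0 // ler_norm.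
apply: ler_pM; rewrite ?invr_ge0 ?mulr_ge0 ?exprn_ge0 //.
  by rewrite ler_wpM2l // lerXn2r ?nnegrE.
by rewrite lef_pV2 ?posrE //; lra.
Qed.
End Papprox.
Arguments papprox {R} p r g.
Arguments has_coef {R} r g c.

(** * Complex derivatives, division by a zero, reciprocals *)

Section Derivative.
Variable R : realType.
Implicit Types (g f : R[i] -> R[i]) (p t : R[i]) (r e M : R).

(** The epsilons are real and the estimate is free of quotients, so it combines directly with the
    estimates for [cabs]; [cderiv_derive] and [cderiv_derive1] pass to the derivatives of the
    statement. *)
Definition cderiv g t (d : R[i]) : Prop :=
  forall e, 0 < e -> exists2 h, 0 < h &
    forall s, cabs s <= h -> cabs (g (t + s) - g t - d * s) <= e * cabs s.

Lemma cderiv_unique g t d d' : cderiv g t d -> cderiv g t d' -> d = d'.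
Proof.
move=> H H'; apply/eqP; rewrite -subr_eq0 -cabs_eq0 eq_le cabs_ge0 andbT.
apply: (le_eps_mul _ _ _ 2) => // e e0; rewrite add0r.
have [h h0 Hh] := H e e0; have [h' h'0 Hh'] := H' e e0.
pose m := Num.min h h'; have m0 : 0 < m by rewrite lt_min h0.
have cm : cabs (m%:C%C : R[i]) = m by rewrite cabs_real gtr0_norm.
have := Hh m%:C%C; rewrite cm ge_min lexx => /(_ isT) H1.
have := Hh' m%:C%C; rewrite cm ge_min lexx orbT => /(_ isT) H2.
rewrite -(ler_pM2r m0) -{1}cm -cabsM.
have -> : (d - d') * m%:C%C = (g (t + m%:C%C) - g t - d' * m%:C%C) -
   (g (t + m%:C%C) - g t - d * m%:C%C) by ring.
by apply: le_trans (cabsB _ _ _) _; lra.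
Qed.

Lemma cderiv_shift g a t d : cderiv g (a + t) d -> cderiv (fun s => g (a + s)) t d.
Proof. by move=> H e /H[h h0 Hh]; exists h => // s /Hh; rewrite addrA. Qed.

Lemma cderiv_unshift g a t d : cderiv (fun s => g (a + s)) t d -> cderiv g (a + t) d.
Proof. by move=> H e /H[h h0 Hh]; exists h => // s /Hh; rewrite addrA. Qed.

Lemma cderiv_ext g f t d r : 0 < r -> (forall s, cabs (s - t) <= r -> g s = f s) ->
  cderiv g t d -> cderiv f t d.
Proof.
move=> r0 E H e /H[h h0 Hh]; exists (Num.min h r); first by rewrite lt_min h0.
move=> s; rewrite le_min => /andP[/Hh + sr].
rewrite (E (t + s)); last by rewrite [t + s]addrC addrK.
by rewrite (E t) // subrr cabs0 ltW.
Qed.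

Lemma cderiv_cst c t : cderiv (fun=> c) t 0.
Proof.
by move=> e e0; exists 1 => // s _; rewrite mul0r subrr subr0 cabs0 mulr_ge0 ?cabs_ge0 // ltW.
Qed.

Lemma cderiv_id t : cderiv id t 1.
Proof.
move=> e e0; exists 1 => // s _.
by rewrite [t + s]addrC addrK mul1r subrr cabs0 mulr_ge0 ?cabs_ge0 // ltW.
Qed.

Lemma cderivD g f t d d' : cderiv g t d -> cderiv f t d' ->
  cderiv (fun s => g s + f s) t (d + d').
Proof.
move=> Hg Hf e e0; have e2 : 0 < e / 2 by rewrite divr_gt0.
have [h h0 Hh] := Hg _ e2; have [h' h'0 Hh'] := Hf _ e2.
exists (Num.min h h'); first by rewrite lt_min h0.
move=> s; rewrite le_min => /andP[/Hh H1 /Hh' H2].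
have -> : g (t + s) + f (t + s) - (g t + f t) - (d + d') * s =
  (g (t + s) - g t - d * s) + (f (t + s) - f t - d' * s) by ring.
by apply: le_trans (cabsD _ _ _) _; lra.
Qed.

Lemma cderivM g f t d d' : cderiv g t d -> cderiv f t d' ->
  cderiv (fun s => g s * f s) t (d * f t + g t * d').
Proof.
move=> Hg Hf e e0; have e3 : 0 < e / 3 by rewrite divr_gt0.
have P (x : R) : 0 <= x -> 0 < x + 1 by move=> x0; rewrite ltr_wpDl.
have F0 := P _ (cabs_ge0 _ (f t)); have G0 := P _ (cabs_ge0 _ (g t)).
have D0 := P _ (cabs_ge0 _ d); have D'0 := P _ (cabs_ge0 _ d').
have m1 (x : R) : 0 < x -> 0 < Num.min 1 x by move=> x0; rewrite lt_min ltr01.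
have [h h0 Hh] := Hg _ (m1 _ (divr_gt0 e3 F0)).
have [h' h'0 Hh'] := Hf _ (m1 _ (divr_gt0 e3 G0)).
exists (Num.min (Num.min h h') (e / 3 / ((cabs d + 1) * (cabs d' + 1)))).
  by rewrite !lt_min h0 h'0 divr_gt0 // mulr_gt0.
move=> s; rewrite !le_min => /andP[/andP[/Hh H1 /Hh' H2] H3].
set x := g (t + s) - g t - d * s in H1; set y := f (t + s) - f t - d' * s in H2.
have -> : g (t + s) * f (t + s) - g t * f t - (d * f t + g t * d') * s =
  x * f t + g t * y + (d * s + x) * (d' * s + y) by rewrite /x /y; ring.
have s0 := cabs_ge0 _ s.
have aux (z w : R[i]) : cabs z <= Num.min 1 (e / 3 / (cabs w + 1)) * cabs s ->
    cabs z * cabs w <= e / 3 * cabs s.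
  have w0 := P _ (cabs_ge0 _ w); move=> Hz.
  have : cabs z <= e / 3 / (cabs w + 1) * cabs s.
    by apply: le_trans Hz _; rewrite ler_wpM2r // ge_min lexx orbT.
  move=> /(ler_wpM2r (cabs_ge0 _ w)) /le_trans; apply.
  rewrite mulrAC ler_wpM2r // -[leLHS]mulrA ger_pMr //.
  by rewrite mulrC ler_pdivrMr // mul1r lerDl.
have aux1 (z w : R[i]) (a : R) : cabs z <= Num.min 1 a * cabs s ->
    cabs (w * s + z) <= (cabs w + 1) * cabs s.
  move=> Hz; apply: le_trans (cabsD _ _ _) _; rewrite cabsM mulrDl lerD2l.
  by apply: le_trans Hz _; rewrite ler_wpM2r // ge_min lexx.
have H4 := aux _ _ H1; have H5 := aux _ _ H2.
have H6 := ler_pM (cabs_ge0 _ _) (cabs_ge0 _ _) (aux1 _ d _ H1) (aux1 _ d' _ H2).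
have H7 : (cabs d + 1) * cabs s * ((cabs d' + 1) * cabs s) <= e / 3 * cabs s.
  have -> : (cabs d + 1) * cabs s * ((cabs d' + 1) * cabs s) =
    (cabs s * ((cabs d + 1) * (cabs d' + 1))) * cabs s by ring.
  by rewrite ler_wpM2r // -ler_pdivlMr // mulr_gt0.
apply: le_trans (cabsD _ _ _) _; rewrite [cabs (_ * _)]cabsM.
have := cabsD _ (x * f t) (g t * y); rewrite !cabsM [cabs (g t) * _]mulrC.
lra.
Qed.

Lemma cderiv_poly (q : {poly R[i]}) t : cderiv (fun s => q.[s]) t q^`().[t].
Proof.
elim/poly_ind: q => [|q c IH].
  rewrite deriv0 horner0; apply: cderiv_ext (cderiv_cst 0 t) => [|s _].
    exact: ltr01.
  by rewrite horner0.
have := cderivD _ _ _ _ _ (cderivM _ _ _ _ _ IH (cderiv_id t)) (cderiv_cst c t).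
rewrite /= => H.
have -> : (q * 'X + c%:P)^`().[t] = q^`().[t] * t + q.[t] * 1 + 0.
  by rewrite derivMXaddC !hornerE; ring.
by apply: cderiv_ext H => [|s _]; [exact: ltr01|rewrite !hornerE].
Qed.

Lemma papprox_cderiv0 r g c : 0 < r -> papprox 0 r g -> has_coef r g c ->
  cderiv g 0 (c 1%N).
Proof.
move=> r0 Hg Hc e e0.
have [M M0 HM] := papprox_bounded _ _ _ _ (ltW r0) Hg.
have HM' t : cabs t <= r -> cabs (g t) <= M by move=> Ht; apply: HM; rewrite subr0.
have K0 : 0 < e * r ^+ 2 / (2 * M) by rewrite divr_gt0 ?mulr_gt0 ?exprn_gt0.
exists (Num.min (r / 2) (e * r ^+ 2 / (2 * M))); first by rewrite lt_min divr_gt0.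
move=> s; rewrite le_min => /andP[s1 s2].
have sr : cabs s < r by lra.
have := has_coef_taylor _ r g c M 2 s r0 Hg Hc HM' sr.
rewrite big_ord_recl big_ord1 /= expr0 mulr1 expr1 -(has_coef0 _ _ _ _ r0 Hg Hc).
rewrite add0r opprD addrA => /le_trans; apply.
have x2 : cabs s / r <= 2^-1 by rewrite ler_pdivrMr // mulrC.
have y0 : 0 < 1 - cabs s / r by lra.
rewrite ler_pdivrMr //.
apply: le_trans (_ : e * cabs s / 2 <= _); last first.
  rewrite ler_wpM2l ?mulr_ge0 ?cabs_ge0 ?(ltW e0) //; lra.
rewrite expr_div_n mulrA ler_pdivrMr ?exprn_gt0 //.
move: s2; rewrite ler_pdivlMr ?mulr_gt0 // => s2.
have := ler_wpM2r (cabs_ge0 _ s) s2.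
have -> : cabs s * (2 * M) * cabs s = 2 * (M * cabs s ^+ 2) by ring.
have -> : e * r ^+ 2 * cabs s = e * cabs s / 2 * r ^+ 2 * 2 by field.
lra.
Qed.

Lemma coef_comp_shift (q : {poly R[i]}) t m :
  (q \Po (t%:P + 'X))`_m = q^`N(m).[t].
Proof.
have D k : (q \Po (t%:P + 'X))^`(k) = q^`(k) \Po (t%:P + 'X).
  elim: k => [|k IH]; rewrite ?derivn0 // !derivnS IH deriv_comp.
  by rewrite derivD derivC derivX add0r mulr1.
have f0 : (m`!%:R : R[i]) != 0 by rewrite pnatr_eq0 -lt0n fact_gt0.
apply: (mulfI f0); rewrite !mulr_natl.
have -> : q^`N(m).[t] *+ m`! = q^`(m).[t] by rewrite nderivn_def hornerMn.
have := congr1 (fun p : {poly R[i]} => p`_0) (D m); rewrite coef_derivn addn0 ffactnn => ->.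
by rewrite -horner_coef0 horner_comp !hornerE.
Qed.

(** Cauchy's estimate for the first coefficient on the largest disc about t inside the given one.
    The second part makes derivatives of approximants converge uniformly away from the boundary. *)
Lemma papprox_cderiv p r g t : cabs (t - p) < r -> papprox p r g ->
  exists2 d, cderiv g t d & forall (q : {poly R[i]}) e,
    (forall s, cabs (s - p) <= r -> cabs (g s - q.[s]) <= e) ->
    cabs (d - q^`().[t]) * (r - cabs (t - p)) <= e.
Proof.
move=> tr Hg; set r' := r - cabs (t - p); have r'0 : 0 < r' by rewrite subr_gt0.
have Hs s : cabs s <= r' -> cabs (t + s - p) <= r.
  move=> sr; have -> : t + s - p = s + (t - p) by ring.
  by apply: le_trans (cabsD _ _ _) _; move: sr; rewrite /r'; lra.
have Hg' : papprox 0 r' (fun s => g (t + s)).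
  apply: papprox_shift; apply: papprox_disc Hg.
  by rewrite addr0 /r'; lra.
have [c Hc] := papprox_coef _ _ _ r'0 Hg'.
exists (c 1%N).
  by rewrite -[t]addr0; apply: cderiv_unshift; exact: (papprox_cderiv0 _ _ _ r'0 Hg' Hc).
move=> q e He; have := Hc (q \Po (t%:P + 'X)) e _ 1%N.
rewrite coef_comp_shift nderivn1 expr1; apply => s sr.
by rewrite horner_comp !hornerE; apply/He/Hs.
Qed.

Lemma papprox_deriv p r s g g' : s < r -> papprox p r g ->
  (forall t, cabs (t - p) <= s -> cderiv g t (g' t)) -> papprox p s g'.
Proof.
move=> sr Hg D e e0; have d0 : 0 < r - s by rewrite subr_gt0.
have [q Hq] := Hg (e * (r - s)) (mulr_gt0 e0 d0); exists q^`() => t Ht.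
have [d Hd /(_ _ _ Hq)] := papprox_cderiv p r g t (le_lt_trans Ht sr) Hg.
rewrite -(cderiv_unique _ _ _ _ (D _ Ht) Hd) => H.
rewrite -(ler_pM2r d0); apply: le_trans H.
by rewrite ler_wpM2l ?cabs_ge0 //; lra.
Qed.

Lemma has_coef_deriv r s g g' c : 0 < s < r -> papprox 0 r g -> has_coef r g c ->
  (forall t, cabs t <= s -> cderiv g t (g' t)) ->
  has_coef s g' (fun k => c k.+1 *+ k.+1).
Proof.
move=> /andP[s0 sr] Hg Hc D q e He m.
have d0 : 0 < r - s by rewrite subr_gt0.
have r0 : 0 < r by apply: lt_trans sr.
apply: (le_eps_mul _ _ _ ((r - s)^-1 + m.+1%:R * s ^+ m / r ^+ m.+1)).
  by rewrite addr_ge0 ?divr_ge0 ?mulr_ge0 ?invr_ge0 ?exprn_ge0 // ltW.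
move=> f f0; have [p Hp] := papprox0 _ _ _ Hg _ f0.
have H1 t : cabs t <= s -> cabs (g' t - p^`().[t]) <= f / (r - s).
  move=> Ht.
  have t0 : cabs (t - 0) < r by rewrite subr0 (le_lt_trans Ht).
  have [d Hd /(_ p f)] := papprox_cderiv 0 r g t t0 Hg.
  rewrite -(cderiv_unique _ _ _ _ (D _ Ht) Hd) => H.
  rewrite ler_pdivlMr //; apply: le_trans (H _); last by move=> u; rewrite subr0 => /Hp.
  by rewrite ler_wpM2l ?cabs_ge0 // subr0; lra.
have H2 : cabs (p^`()`_m - q`_m) * s ^+ m <= e + f / (r - s).
  rewrite -coefB; apply: poly_cauchy (ltW s0) _ => t Ht.
  rewrite hornerD hornerN; apply: le_trans (cabs_tri _ (g' t) _ _) _.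
  have ts : cabs t <= s by rewrite Ht.
  by rewrite addrC lerD ?He // cabs_distC H1.
have H3 : cabs (c m.+1 *+ m.+1 - p^`()`_m) * s ^+ m <= f * (m.+1%:R * s ^+ m / r ^+ m.+1).
  have -> : c m.+1 *+ m.+1 - p^`()`_m = m.+1%:R * (c m.+1 - p`_m.+1).
    by rewrite coef_deriv mulr_natl mulrnBl.
  rewrite cabsM cabs_nat.
  have HX : cabs (c m.+1 - p`_m.+1) <= f / r ^+ m.+1.
    by rewrite ler_pdivlMr ?exprn_gt0 // Hc.
  have ms : 0 <= m.+1%:R * s ^+ m by rewrite mulr_ge0 ?exprn_ge0 // ltW.
  have := ler_wpM2l ms HX; move: (cabs _) (m.+1%:R) (s ^+ m) (r ^+ m.+1)^-1.
  move=> x y z w H; have -> : y * x * z = y * z * x by ring.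
  by apply: le_trans H _; rewrite le_eqVlt; apply/orP; left; apply/eqP; ring.
have sm : 0 <= s ^+ m by rewrite exprn_ge0 // ltW.
have := ler_wpM2r sm (cabs_tri _ p^`()`_m (c m.+1 *+ m.+1) q`_m).
rewrite mulrDl mulrDr; move: H2 H3.
move: (cabs _ * _) (cabs _ * _) (cabs _ * _) (f * _) => x y z w.
lra.
Qed.

(** The divided differences at a of the approximants of g approximate the quotient. Dividing an
    error by t - a is harmless only away from a, so the bound is proved on the circle, where |t - a|
    is at least [K^-1], and carried inside by the maximum principle. *)
Lemma papprox_div r g a : papprox 0 r g -> cabs a < r -> g a = 0 ->
  exists2 u, papprox 0 r u & forall t, cabs t <= r -> g t = (t - a) * u t.
Proof.
move=> Hg ar ga; have a0 : cabs (a - 0) < r by rewrite subr0.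
have r0 : 0 < r by apply: le_lt_trans ar; exact: cabs_ge0.
have d0 : 0 < r - cabs a by rewrite subr_gt0.
have [d Hd Hd'] := papprox_cderiv 0 r g a a0 Hg.
exists (fun t => if t == a then d else g t / (t - a)); last first.
  move=> t _; case: eqVneq => [->|ta]; first by rewrite subrr mul0r.
  by rewrite mulrCA divff ?mulr1 // subr_eq0.
pose K := (r - cabs a)^-1; have K0 : 0 < K by rewrite invr_gt0.
move=> e e0; have e1 : 0 < e / (2 * K) by rewrite divr_gt0 // mulr_gt0.
have [q Hq] := papprox0 _ _ _ Hg _ e1.
have [s Hs] := poly_diff_quot _ q a.
have Q (p w : {poly R[i]}) : p = w * ('X - a%:P) + p.[a]%:P ->
    forall t, p.[t] - p.[a] = (t - a) * w.[t].
  by move=> {1}-> t; rewrite !hornerE addrK mulrC.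
exists s => t; rewrite subr0 => Ht.
(* With t fixed, a finer approximant q' enters: s' - s is at most e up to a multiple of f on the
   whole disc, and s' is close to the quotient at t, with an error f times a factor that may depend
   on t. Then f tends to 0. *)
apply: (le_eps_mul _ _ _ (2 * K + (if t == a then K else 2 / cabs (t - a)))).
  by rewrite addr_ge0 ?mulr_ge0 ?(ltW K0) //; case: ifP => _; rewrite ?divr_ge0 ?cabs_ge0 // ltW.
move=> f f0; have [q' Hq'] := papprox0 _ _ _ Hg _ f0.
have [s' Hs'] := poly_diff_quot _ q' a.
have Hqa : cabs q.[a] <= e / (2 * K) by have := Hq a (ltW ar); rewrite ga sub0r cabsN.
have Hqa' : cabs q'.[a] <= f by have := Hq' a (ltW ar); rewrite ga sub0r cabsN.
have H1 : cabs (s' - s).[t] <= e + f * (2 * K).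
  apply: (poly_max _ _ r) => // u ur.
  have ua : 0 < cabs (u - a).
    by apply: lt_le_trans (cabs_lower _ _ _); rewrite ur.
  have E : (u - a) * (s' - s).[u] = (q'.[u] - g u) - q'.[a] - ((q.[u] - g u) - q.[a]).
    have -> : (q'.[u] - g u) - q'.[a] - ((q.[u] - g u) - q.[a]) =
      (q'.[u] - q'.[a]) - (q.[u] - q.[a]) by ring.
    by rewrite (Q _ _ Hs) (Q _ _ Hs') hornerD hornerN; ring.
  have ur' : cabs u <= r by rewrite ur.
  have H : cabs (u - a) * cabs (s' - s).[u] <= 2 * f + 2 * (e / (2 * K)).
    rewrite -cabsM E; apply: le_trans (cabsB _ _ _) _.
    have := cabsB _ (q'.[u] - g u) q'.[a]; have := cabsB _ (q.[u] - g u) q.[a].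
    have Hu : cabs (q.[u] - g u) <= e / (2 * K) by rewrite cabs_distC Hq.
    have Hu' : cabs (q'.[u] - g u) <= f by rewrite cabs_distC Hq'.
    move: (cabs _) (cabs _) (cabs _) (cabs _) (cabs _) (cabs _) (e / _) Hqa Hqa' Hu Hu'.
    by move=> *; lra.
  have : cabs (s' - s).[u] <= (2 * f + 2 * (e / (2 * K))) * K.
    rewrite -ler_pdivrMr // {1}/K invrK mulrC; apply: le_trans H.
    rewrite ler_wpM2r ?cabs_ge0 //.
    by apply: le_trans (cabs_lower _ _ _); rewrite ur.
  move/le_trans; apply; rewrite le_eqVlt; apply/orP; left; apply/eqP.
  by field; rewrite gt_eqF.
have H2 : cabs ((if t == a then d else g t / (t - a)) - s'.[t]) <=
    f * (if t == a then K else 2 / cabs (t - a)).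
  case: eqVneq => [->|ta].
    have E : q'^`().[a] = s'.[a].
      rewrite {1}Hs' derivD derivC addr0 derivM derivB derivX derivC !hornerE subrr.
      by ring.
    have := Hd' q' f; rewrite E subr0 => H; rewrite /K ler_pdivlMr //; apply: H.
    by move=> u; rewrite subr0 => /Hq'.
  have ta0 : 0 < cabs (t - a) by rewrite cabs_gt0 subr_eq0.
  rewrite mulrA ler_pdivlMr // -cabsM.
  have -> : (g t / (t - a) - s'.[t]) * (t - a) = (g t - q'.[t]) + q'.[a].
    rewrite mulrBl divfK ?subr_eq0 // [s'.[t] * _]mulrC -(Q _ _ Hs').
    by ring.
  by apply: le_trans (cabsD _ _ _) _; have := Hq' t Ht; lra.
apply: le_trans (cabs_tri _ s'.[t] _ _) _.
move: H1; rewrite hornerD hornerN => H1.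
by rewrite mulrDr; lra.
Qed.

Lemma papprox_horner p r g (q : {poly R[i]}) : 0 <= r -> papprox p r g ->
  papprox p r (fun t => q.[g t]).
Proof.
move=> r0 Hg; elim/poly_ind: q => [|q c IH].
  by apply: papprox_ext (papprox_cst _ p r 0) => t _; rewrite horner0.
have := papproxD _ _ _ _ _ (papproxM _ _ _ _ _ r0 IH Hg) (papprox_cst _ p r c).
by apply: papprox_ext => t _; rewrite !hornerE.
Qed.

(** By continuity x = 1 - u / u p satisfies |x| <= 1/2 near p, and 1 / u is (u p)^(-1) times the
    geometric series in x; its truncations are polynomials in u. *)
Lemma papprox_inv_local p r u : 0 < r -> papprox p r u -> u p != 0 ->
  exists2 r', 0 < r' & papprox p r' (fun t => (u t)^-1).
Proof.
move=> r0 Hu up; have u0 : 0 < cabs (u p) by rewrite cabs_gt0.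
have pp : cabs (p - p) <= r by rewrite subrr cabs0 ltW.
have [d d0 Hd] := papprox_cont _ p r u p (cabs (u p) / 2) (ltW r0) Hu pp
  (divr_gt0 u0 (ltr0n _ 2)).
exists (Num.min r d); first by rewrite lt_min r0.
set r' := Num.min r d; have r'0 : 0 <= r' by rewrite le_min !ltW.
have Hx t : cabs (t - p) <= r' -> cabs (1 - u t / u p) <= 2^-1.
  rewrite /r' le_min => /andP[t1 t2]; have := Hd t t1 t2.
  have -> : 1 - u t / u p = (u p - u t) / u p by field.
  by rewrite cabsM cabsV ler_pdivrMr // cabs_distC mulrC.
have Hu' : papprox p r' (fun t => 1 - u t / u p).
  apply: papproxB => //; first exact: papprox_cst.
  apply: papproxM => //; last exact: papprox_cst.
  by apply: papprox_le Hu; rewrite ge_min lexx.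
apply: papprox_unif => e e0.
have h1 : 0 <= (2^-1 : R) < 1 by rewrite invr_ge0 ler0n /= invf_lt1 // ltr1n.
have [N HN] := pow_small1 _ _ (2 / cabs (u p)) _ h1 e0.
exists (fun t => (\poly_(k < N) (u p)^-1).[1 - u t / u p]).
  exact: papprox_horner.
move=> t Ht; have Hxt := Hx t Ht; set x := 1 - u t / u p in Hxt *.
have ut : u t = u p * (1 - x) by rewrite /x; field.
have x1 : 1 - x != 0.
  rewrite -cabs_gt0; have := cabs_lower _ 1 x; rewrite cabs1.
  have : (2^-1 : R) < 1 by case/andP: h1.
  lra.
have E : (u t)^-1 - (\poly_(k < N) (u p)^-1).[x] = (u p)^-1 * (x ^+ N / (1 - x)).
  rewrite horner_poly -mulr_sumr ut invfM -mulrBr; congr (_ * _).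
  apply: (mulIf x1); rewrite mulrBl mulVf // divfK //.
  have := subrX1 x N; set S := \sum_(_ < _) _ => H.
  have -> : S * (1 - x) = - ((x - 1) * S) by ring.
  by rewrite -H; ring.
rewrite E; apply: le_trans HN; rewrite !cabsM !cabsV cabsX [2 / _]mulrC -mulrA.
rewrite ler_wpM2l ?invr_ge0 ?cabs_ge0 // mulrC ler_pM ?invr_ge0 ?exprn_ge0 ?cabs_ge0 //.
  rewrite invf_ple ?posrE ?cabs_gt0 //.
  by have := cabs_lower _ 1 x; rewrite cabs1; lra.
by rewrite lerXn2r ?nnegrE ?cabs_ge0 ?invr_ge0.
Qed.
End Derivative.
Arguments cderiv {R} g t d.

(** * Gluing local polynomial approximations *)

Section Glue.
Variable R : realType.
Implicit Types (g f : R[i] -> R[i]) (p t : R[i]) (r e M : R).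

(** A Lebesgue number argument: the first hypothesis lets a radius that is good at p serve, halved,
    for all nearby centres. Compactness is that of the square of side 2 rho. *)
Lemma disc_uniform (rho : R) (P : R[i] -> R -> Prop) :
  (forall p e p' e', P p e -> 0 < e' -> e' <= e / 2 -> cabs (p' - p) <= e / 2 -> P p' e') ->
  (forall p, cabs p <= rho -> exists2 e, 0 < e & P p e) ->
  exists2 e, 0 < e & forall p, cabs p <= rho -> P p e.
Proof.
move=> Pmono Ploc.
have := compact_setX (@segment_compact R (- rho) rho) (@segment_compact R (- rho) rho).
move=> /compact_near_coveringP /(_ R (0 : R)^'+
  (fun e x => cabs (x.1 +i* x.2)%C <= rho -> P (x.1 +i* x.2)%C e) _) H.
have [|e /= e0 He] := H.
  move=> [x y] _ /=.
  have dist (x' y' d : R) : `|x - x'| < d / 4 -> `|y - y'| < d / 4 ->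
      cabs ((x' +i* y')%C - (x +i* y)%C) < d / 2.
    move=> h1 h2; apply: le_lt_trans (cabs_le_ReIm _ _) _ => /=.
    by rewrite distrC [ `|y' - y|]distrC; lra.
  have near2 (d : R) (Q : R -> R -> R -> Prop) : 0 < d ->
      (forall x' y' e, `|x - x'| < d / 4 -> `|y - y'| < d / 4 -> 0 < e -> e < d / 4 -> Q x' y' e) ->
      \forall x' \near (x, y) & i \near (0 : R)^'+, Q x'.1 x'.2 i.
    move=> d0 HQ; have d4 : 0 < d / 4 by rewrite divr_gt0.
    exists ([set z : R * R | `|x - z.1| < d / 4 /\ `|y - z.2| < d / 4],
            [set e | 0 < e /\ e < d / 4]) => /=; last first.
      by move=> [[x' y'] e] /= [[h1 h2] [h3 h4]]; exact: HQ.
    split.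
      exists (ball x (d / 4), ball y (d / 4)) => /=.
        by split; exact: nbhsx_ballx.
      by move=> [x' y'] /= [].
    near=> e; split; first by near: e; exact: nbhs_right_gt.
    by near: e; apply: nbhs_right_lt.
  have [xr|xr] := leP (cabs (x +i* y)%C) rho.
    have [d d0 Hd] := Ploc _ xr.
    apply: (near2 d (fun a b e => cabs (a +i* b)%C <= rho -> P (a +i* b)%C e) d0).
    move=> x' y' e h1 h2 e0 ed _.
    by apply: Pmono Hd _ _ _ => //; [lra|apply/ltW/dist].
  (* A point of the square outside the disc has a whole neighbourhood outside it, where the claim is
     void. *)
  have d0 : 0 < cabs (x +i* y)%C - rho by rewrite subr_gt0.
  apply: (near2 _ (fun a b e => cabs (a +i* b)%C <= rho -> P (a +i* b)%C e) d0).
  move=> x' y' e h1 h2 e0 _ h3; exfalso.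
  have := dist _ _ _ h1 h2; have := cabs_lower _ (x +i* y)%C (x' +i* y')%C.
  rewrite [cabs (_ - (x' +i* y')%C)]cabs_distC; lra.
have e2 : 0 < e / 2 by rewrite divr_gt0.
exists (e / 2) => // -[x y] pr.
have he : ball (0 : R) e (e / 2).
  by rewrite /ball /= sub0r normrN gtr0_norm //; lra.
have := He _ he e2 (x, y); apply => //=.
have hx : `|x| <= rho by apply: le_trans pr; exact: (abs_Re_le _ (x +i* y)%C).
have hy : `|y| <= rho by apply: le_trans pr; exact: (abs_Im_le _ (x +i* y)%C).
by rewrite !in_itv /= -!ler_norml.
Unshelve. all: by end_near.
Qed.

(** Although q is close to g only on the radius d, its Taylor coefficients at p obey a bound with
    the radius e: q' obeys Cauchy's estimate on the radius e, and q - q' is at most [2 * eta] on the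
    radius d. The correction vanishes with eta. *)
Lemma papprox_same_coef (p : R[i]) d e (M eta : R) g (q q' : {poly R[i]}) m : 0 < d <= e -> 0 <= eta ->
  (forall t, cabs (t - p) <= d -> cabs (g t - q.[t]) <= eta) ->
  (forall t, cabs (t - p) <= e -> cabs (g t - q'.[t]) <= eta) ->
  (forall t, cabs (t - p) <= e -> cabs (g t) <= M) ->
  cabs q^`N(m).[p] * e ^+ m <= M + eta + 2 * eta / d ^+ m * e ^+ m.
Proof.
move=> /andP[d0 de] eta0 Hq Hq' HM; have e0 : 0 < e by apply: lt_le_trans de.
have sh (t : R[i]) : p + t - p = t by rewrite addrC addKr.
have H1 : cabs q'^`N(m).[p] * e ^+ m <= M + eta.
  rewrite -coef_comp_shift; apply: poly_cauchy (ltW e0) _ => t Ht.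
  rewrite horner_comp !hornerE.
  have pt : cabs (p + t - p) <= e by rewrite sh Ht.
  have := HM _ pt; have := Hq' _ pt; have := cabs_lower _ q'.[p + t] (g (p + t)).
  rewrite [cabs (q'.[_] - _)]cabs_distC; lra.
have H2 : cabs (q^`N(m).[p] - q'^`N(m).[p]) <= 2 * eta / d ^+ m.
  rewrite ler_pdivlMr ?exprn_gt0 // -!coef_comp_shift -coefB.
  apply: poly_cauchy (ltW d0) _ => t Ht.
  rewrite hornerD hornerN !horner_comp !hornerE.
  have pt : cabs (p + t - p) <= d by rewrite sh Ht.
  have := Hq' _ (le_trans pt de); have := Hq _ pt.
  have := cabs_tri _ (g (p + t)) q.[p + t] q'.[p + t].
  rewrite [cabs (q.[_] - g _)]cabs_distC; lra.
have em : 0 <= e ^+ m by rewrite exprn_ge0 // ltW.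
have H3 := ler_wpM2r em H2.
have H4 : cabs q^`N(m).[p] <= cabs q'^`N(m).[p] + cabs (q^`N(m).[p] - q'^`N(m).[p]).
  by rewrite addrC; have := cabs_lower _ q^`N(m).[p] q'^`N(m).[p]; lra.
apply: le_trans (ler_wpM2r em H4) _; rewrite mulrDl; exact: lerD.
Qed.

(* If all discs of radius e around the points of the disc of radius s carry g,
   Cauchy's estimates for the m-th derivative give
   |c_n| C(n,m) s^(n-m) e^m <= M; summing over m, |c_n| (s+e)^n <= (n+1) M. *)
Lemma coef_growth s e M g c n : 0 < e <= s -> papprox 0 s g -> has_coef s g c ->
  (forall p, cabs p <= s -> papprox p e g) ->
  (forall p t, cabs p <= s -> cabs (t - p) <= e -> cabs (g t) <= M) ->
  cabs (c n) * (s + 3 * e / 4) ^+ n <= n.+1%:R * M.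
Proof.
move=> /andP[e0 es] Hg Hc Hp HM.
(* Discs of radius d about points with |p| = s1 stay inside |t| <= s, where q approximates g;
   moreover s1 + e = s + 3 e / 4. *)
pose s1 := s - e / 4; pose d := e / 4.
have d0 : 0 < d by rewrite divr_gt0. have de : d <= e by rewrite /d; lra.
have s10 : 0 < s1 by rewrite /s1; lra. have s0 : 0 < s by lra.
have term m : (m <= n)%N -> cabs (c n) * ('C(n, m)%:R * (s1 ^+ (n - m) * e ^+ m)) <= M.
  move=> mn; set K := 'C(n, m)%:R * (s1 ^+ (n - m) * e ^+ m).
  have K0 : 0 <= K by rewrite /K !mulr_ge0 ?exprn_ge0 // ltW.
  apply: (le_eps_mul _ _ _ (1 + 2 / d ^+ m * e ^+ m + K / s ^+ n)).
    by rewrite !addr_ge0 ?mulr_ge0 ?invr_ge0 ?exprn_ge0 // ltW.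
  move=> eta eta0; have [q Hq] := papprox0 _ _ _ Hg _ eta0.
  have H1 : cabs q^`N(m)`_(n - m) * s1 ^+ (n - m) <=
     (M + eta + 2 * eta / d ^+ m * e ^+ m) / e ^+ m.
    apply: poly_cauchy (ltW s10) _ => p ps.
    have ps' : cabs p <= s by rewrite ps /s1; lra.
    have [q' Hq'] := Hp p ps' eta eta0.
    rewrite ler_pdivlMr ?exprn_gt0 //.
    apply: (papprox_same_coef p d e M eta g q q') => //; rewrite ?d0 ?(ltW eta0) //.
      move=> t Ht; apply: Hq; have := cabs_lower _ t p.
      by move: Ht; rewrite ps /s1 /d; lra.
    by move=> t; exact: (HM _ _ ps').
  have H2 := Hc q eta Hq n.
  have sn : 0 < s ^+ n by exact: exprn_gt0.
  have H3 : cabs q`_n * K <= M + eta + 2 * eta / d ^+ m * e ^+ m.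
    move: H1; rewrite ler_pdivlMr ?exprn_gt0 // coef_nderivn subnKC //.
    rewrite -[q`_n *+ _]mulr_natl cabsM cabs_nat.
    by apply: le_trans; rewrite /K le_eqVlt; apply/orP; left; apply/eqP; ring.
  have H4 : cabs (c n) <= cabs q`_n + eta / s ^+ n.
    rewrite -ler_pdivlMr // in H2.
    by apply: le_trans _ (_ : cabs q`_n + cabs (c n - q`_n) <= _);
      [have := cabs_lower _ (c n) q`_n; lra|rewrite lerD2l].
  apply: le_trans (ler_wpM2r K0 H4) _; rewrite mulrDl.
  apply: le_trans (lerD H3 (lexx _)) _; rewrite le_eqVlt; apply/orP; left; apply/eqP.
  by ring.
have -> : s + 3 * e / 4 = s1 + e by rewrite /s1; lra.
rewrite exprDn mulr_sumr.
apply: le_trans (_ : \sum_(m < n.+1) M <= _); last first.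
  by rewrite sumr_const card_ord mulr_natl.
by apply: ler_sum => m _; rewrite -mulr_natl term // -ltnS.
Qed.

(** By [coef_growth] the Taylor series of g converges beyond s to some G. What remains is that g,
    known there only through the small discs, agrees with G. *)
Lemma papprox_step s e M g : 0 < e <= s -> papprox 0 s g ->
  (forall p, cabs p <= s -> papprox p e g) ->
  (forall p t, cabs p <= s -> cabs (t - p) <= e -> cabs (g t) <= M) ->
  papprox 0 (s + e / 2) g.
Proof.
move=> es Hg Hp HM; have /andP[e0 es'] := es.
have s0 : 0 < s by lra.
have [c Hc] := papprox_coef _ _ _ s0 Hg.
have M0 : 0 <= M.
  have := HM 0 0; rewrite subr0 cabs0 => /(_ (ltW s0) (ltW e0)).
  by apply: le_trans; exact: cabs_ge0.
(* [r1] is the radius of [coef_growth], passing to [r2] absorbs the factor m + 1, and G is uniformly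
   approximable up to [r3], which still exceeds s + e / 2. *)
pose r1 := s + 3 * e / 4; pose r2 := s + 5 * e / 8; pose r3 := s + 9 * e / 16.
have r10 : 0 < r1 by rewrite /r1; lra.
have r20 : 0 < r2 by rewrite /r2; lra.
have x0 : 0 <= r2 / r1 by rewrite divr_ge0 // ltW.
have x1 : r2 / r1 < 1 by rewrite ltr_pdivrMr // mul1r /r1 /r2; lra.
have Hb m : cabs (c m) * r2 ^+ m <= M / (1 - r2 / r1).
  have H := coef_growth s e M g c m es Hg Hc Hp HM.
  have Er : r2 = r1 * (r2 / r1) by field; rewrite gt_eqF.
  have -> : cabs (c m) * r2 ^+ m = cabs (c m) * r1 ^+ m * (r2 / r1) ^+ m.
    by rewrite {1}Er exprMn mulrA.
  have Hx : m.+1%:R * (r2 / r1) ^+ m <= (1 - r2 / r1)^-1.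
    apply: le_trans (geo_sum_le _ (r2 / r1) m.+1 _); last by rewrite x0.
    rewrite mulr_natl -[X in _ *+ X](card_ord m.+1) -sumr_const.
    apply: ler_sum => k _; rewrite ler_wiXn2l //; first exact: ltW.
    by rewrite -ltnS.
  apply: le_trans (ler_wpM2r (exprn_ge0 m x0) H) _.
  by rewrite [_ * M]mulrC -mulrA ler_wpM2l.
have [G HG] := power_series _ r2 c _ r20 Hb.
have r32 : 0 <= r3 < r2 by rewrite /r2 /r3; lra.
have HGa := power_series_papprox _ _ _ _ _ _ r20 r32 HG.
have [K K0 HK] := papprox_bounded _ _ _ _ (ltW s0) Hg.
have HK' t : cabs t <= s -> cabs (g t) <= K by move=> Ht; apply: HK; rewrite subr0.
have E1 t : cabs t < s -> g t = G t.
  move=> ts; have tr : cabs t < r2 by apply: lt_trans ts _; rewrite /r2; lra.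
  have y1 : 0 <= cabs t / s < 1.
    by rewrite divr_ge0 ?cabs_ge0 ?(ltW s0) //= ltr_pdivrMr // mul1r.
  have y2 : 0 <= cabs t / r2 < 1.
    by rewrite divr_ge0 ?cabs_ge0 ?(ltW r20) //= ltr_pdivrMr // mul1r.
  apply/eqP; rewrite -subr_eq0 -cabs_eq0 eq_le cabs_ge0 andbT.
  apply: (le_eps_mul _ _ _ 2) => // f f0; rewrite add0r.
  have [N1 H1] := pow_small _ _ (K / (1 - cabs t / s)) _ y1 f0.
  have [N2 H2] := pow_small _ _ (M / (1 - r2 / r1) / (1 - cabs t / r2)) _ y2 f0.
  have {H1}H1 := H1 _ (leq_maxl N1 N2); have {H2}H2 := H2 _ (leq_maxr N1 N2).
  have H3 := has_coef_taylor _ _ _ _ _ (maxn N1 N2) _ s0 Hg Hc HK' ts.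
  have H4 := HG t (maxn N1 N2) tr.
  rewrite mulrAC in H3; rewrite mulrAC in H4.
  apply: le_trans (cabs_tri _ (\sum_(k < maxn N1 N2) c k * t ^+ k) _ _) _.
  rewrite [X in _ + X <= _]cabs_distC mulr_natr mulr2n.
  by apply: lerD; [apply: le_trans H3 H1|apply: le_trans H4 H2].
have E2 t : cabs t <= s + e / 2 -> g t = G t.
  move=> tr; have [|st] := ltP (cabs t) s; first exact: E1.
  have t0 : 0 < cabs t by lra.
  (* The disc of radius [d] below, centred at the point p of modulus s1 on the ray through t,
     contains t in its interior, is part of the disc of radius e about p that carries g, and stays
     within |u| <= r3. Near p both functions agree, so the identity theorem applies. *)
  pose s1 := s - e / 4; pose lam : R := s1 / cabs t.
  have s10 : 0 <= s1 by rewrite /s1; lra.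
  have lam0 : 0 <= lam by rewrite divr_ge0 // ltW.
  have lam1 : lam <= 1 by rewrite ler_pdivrMr // mul1r /s1; lra.
  pose p := t * lam%:C%C.
  have cp : cabs p = s1.
    by rewrite /p cabsM cabs_real ger0_norm // mulrCA divff ?mulr1 // gt_eqF.
  have ctp : cabs (t - p) = cabs t - s1.
    have -> : t - p = t * (1 - lam)%:C%C by rewrite /p rmorphB /=; ring.
    rewrite cabsM cabs_real ger0_norm ?subr_ge0 // mulrBr mulr1.
    by congr (_ - _); rewrite mulrCA divff ?mulr1 // gt_eqF.
  pose d := cabs t - s1 + e / 16.
  have d0 : 0 <= d by rewrite /d /s1; lra.
  have pd : papprox p d (fun u => g u - G u).
    apply: papproxB => //.
      apply: (papprox_le _ p e); first by rewrite /d /s1; lra.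
      by apply: Hp; rewrite cp /s1; lra.
    by apply: papprox_disc HGa; rewrite subr0 cp /r3 /d /s1; lra.
  apply/eqP; rewrite -subr_eq0; apply/eqP.
  have e8 : 0 < e / 8 by lra.
  apply: (papprox_zero_at _ p d (fun u => g u - G u) (e / 8) e8 pd).
    move=> u Hu; rewrite E1 ?subrr //.
    by have := cabs_lower _ u p; rewrite cp /s1; lra.
  by rewrite ctp /d; lra.
apply: papprox_ext (papprox_le _ 0 r3 G _ _ HGa).
  by move=> t; rewrite subr0 => /E2.
by rewrite /r3; lra.
Qed.

Lemma papprox_glue rho g : 0 < rho ->
  (forall p, cabs p <= rho -> exists2 r, 0 < r & papprox p r g) ->
  papprox 0 rho g.
Proof.
move=> rho0 Hloc.
(* A uniform radius and a uniform bound come from a single compactness argument, e being the radius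
   and [e^-1] the bound. *)
have [||e0 e00 He0] := disc_uniform rho (fun p e => papprox p e g /\
    forall t, cabs (t - p) <= e -> cabs (g t) <= e^-1).
- move=> p e p' e' [H1 H2] e'0 ee pp; split.
    by apply: papprox_disc H1; lra.
  move=> t Ht; apply: le_trans (H2 t _) _.
    by apply: le_trans (cabs_tri _ p' _ _) _; lra.
  by rewrite lef_pV2 ?posrE; lra.
- move=> p /Hloc[r r0 Hr].
  have [M M0 HM] := papprox_bounded _ _ _ _ (ltW r0) Hr.
  exists (Num.min r M^-1); first by rewrite lt_min r0 invr_gt0.
  split; first by apply: papprox_le Hr; rewrite ge_min lexx.
  move=> t; rewrite le_min => /andP[/HM + _] => /le_trans; apply.
  rewrite -[leLHS]invrK lef_pV2 ?posrE ?lt_min ?r0 ?invr_gt0 //.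
  by rewrite ge_min lexx orbT.
pose e := Num.min e0 rho.
have ep : 0 < e by rewrite lt_min e00.
have ee : e <= e0 by rewrite ge_min lexx.
have er : e <= rho by rewrite ge_min lexx orbT.
have Ha p : cabs p <= rho -> papprox p e g.
  by move=> /He0[H _]; exact: papprox_le H.
have Hb p t : cabs p <= rho -> cabs (t - p) <= e -> cabs (g t) <= e0^-1.
  by move=> /He0[_ H] Ht; apply: H; apply: le_trans ee.
have step k : papprox 0 (Num.min rho (e + k%:R * (e / 2))) g.
  elim: k => [|k IH].
    apply: papprox_le (Ha 0 _); last by rewrite cabs0 ltW.
    by rewrite mul0r addr0 ge_min lexx orbT.
  set s := Num.min rho _ in IH.
  have sr : s <= rho by rewrite ge_min lexx.
  have es : 0 < e <= s.
    by rewrite ep le_min er lerDl mulr_ge0 // divr_ge0 // ltW.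
  have := papprox_step s e e0^-1 g es IH.
  move=> /(_ (fun p ps => Ha p (le_trans ps sr)) (fun p t ps => Hb p t (le_trans ps sr))).
  apply: papprox_le; rewrite /s -natr1 mulrDl mul1r addrA.
  set y := e + _; rewrite ge_min; case: (leP rho y) => h.
    by rewrite lerDl divr_ge0 // ltW.
  by rewrite lexx orbT.
have := step (Num.truncn (rho / (e / 2))).+1.
apply: papprox_le; rewrite le_min lexx /=.
have e2 : 0 < e / 2 by lra.
have : rho / (e / 2) <= (Num.truncn (rho / (e / 2))).+1%:R.
  by apply/ltW/truncnS_gt.
by rewrite ler_pdivrMr // => H; apply: le_trans H _; rewrite lerDr ltW.
Qed.

Lemma papprox_inv rho r u : 0 < rho < r -> papprox 0 r u ->
  (forall t, cabs t <= rho -> u t != 0) -> papprox 0 rho (fun t => (u t)^-1).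
Proof.
move=> /andP[rho0 rr] Hu u0; apply: papprox_glue => // p pr.
have d0 : 0 < r - rho by lra.
have := papprox_inv_local _ p (r - rho) u d0 _ (u0 p pr); apply.
by apply: papprox_disc Hu; rewrite subr0; lra.
Qed.
End Glue.

(** * The function ln |u| along segments *)

Section LogDerivative.
Variable R : realType.
Implicit Types (u f : R[i] -> R[i]) (a b t : R[i]) (x y e r : R).

Lemma is_derive_eps (phi : R -> R) x d :
  (forall e, 0 < e -> exists2 h, 0 < h & forall y, `|y| <= h ->
     `|phi (x + y) - phi x - d * y| <= e * `|y|) ->
  is_derive x 1 phi d.
Proof.
move=> H.
have C : h^-1 *: ((phi \o shift x) (h *: 1) - phi x) @[h --> 0^'] --> d.
  apply/cvgrPdist_le => e e0; have [h h0 Hh] := H e e0.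
  exists h => //= y; rewrite /ball /= sub0r normrN => yh y0.
  have y1 : 0 < `|y| by rewrite normr_gt0.
  rewrite -(ler_pM2r y1) -normrM /shift /=.
  have -> : (d - y^-1 *: (phi (y *: 1 + x) - phi x)) * y = - (phi (x + y) - phi x - d * y).
    have -> : y *: (1 : R) = y by rewrite /GRing.scale /= mulr1.
    by rewrite /GRing.scale /= [x + y]addrC; field.
  by rewrite normrN Hh // ltW.
split; first by apply/cvg_ex; exists d.
exact: cvg_lim.
Qed.

Lemma is_derive_Re_line u a b x d : cderiv u (a + x%:C%C * b) d ->
  is_derive x 1 (fun y : R => complex.Re (u (a + y%:C%C * b))) (complex.Re (b * d)) /\
  is_derive x 1 (fun y : R => complex.Im (u (a + y%:C%C * b))) (complex.Im (b * d)).
Proof.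
move=> H.
have K e : 0 < e -> exists2 h, 0 < h & forall y, `|y| <= h ->
    cabs (u (a + (x + y)%:C%C * b) - u (a + x%:C%C * b) - b * d * y%:C%C) <= e * `|y|.
  move=> e0; have b1 : 0 < cabs b + 1 by rewrite ltr_wpDl ?cabs_ge0.
  have [h h0 Hh] := H _ (divr_gt0 e0 b1).
  exists (h / (cabs b + 1)); first exact: divr_gt0.
  move=> y; rewrite ler_pdivlMr // => yh.
  have yb : cabs (y%:C%C * b) <= h.
    rewrite cabsM cabs_real; apply: le_trans yh.
    by rewrite ler_wpM2l // lerDl.
  have := Hh _ yb; rewrite cabsM cabs_real.
  have -> : a + x%:C%C * b + y%:C%C * b = a + (x + y)%:C%C * b by rewrite rmorphD /=; ring.
  have -> : d * (y%:C%C * b) = b * d * y%:C%C by ring.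
  move=> /le_trans; apply.
  have -> : e / (cabs b + 1) * (`|y| * cabs b) = e * `|y| * (cabs b / (cabs b + 1)).
    by field; rewrite gt_eqF.
  rewrite ler_piMr ?mulr_ge0 ?(ltW e0) //.
  by rewrite ler_pdivrMr // mul1r lerDl.
split; apply: is_derive_eps => e /K[h h0 Hh]; exists h => // y /Hh; apply: le_trans.
  apply: le_trans (abs_Re_le _ _); rewrite le_eqVlt; apply/orP; left; apply/eqP.
  congr `|_|; case: (u _) => p q; case: (u _) => p' q'; case: (b * d) => v w /=.
  by ring.
apply: le_trans (abs_Im_le _ _); rewrite le_eqVlt; apply/orP; left; apply/eqP.
congr `|_|; case: (u _) => p q; case: (u _) => p' q'; case: (b * d) => v w /=.
by ring.
Qed.

Lemma ln_sqrt x : 0 <= x -> ln (Num.sqrt x) = 2^-1 * ln x.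
Proof.
rewrite le_eqVlt => /orP[/eqP <-|x0]; first by rewrite sqrtr0 ln0 // mulr0.
have E : ln x = 2 * ln (Num.sqrt x).
  by rewrite mulr_natl -lnXn ?sqrtr_gt0 // sqr_sqrtr // ltW.
by rewrite E mulrA mulVf ?mul1r.
Qed.

Lemma Re_div (z w : R[i]) : complex.Re (z / w) =
  (complex.Re z * complex.Re w + complex.Im z * complex.Im w) /
  (complex.Re w ^+ 2 + complex.Im w ^+ 2).
Proof. by case: z w => x y [p q] /=; ring. Qed.

(** ln |u| is half the logarithm of (Re u)^2 + (Im u)^2, which is real differentiable and positive
    where u does not vanish. *)
Lemma is_derive_lnabs u a b x d : cderiv u (a + x%:C%C * b) d ->
  u (a + x%:C%C * b) != 0 ->
  is_derive x 1 (fun y : R => ln (cabs (u (a + y%:C%C * b))))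
    (complex.Re (b * d / u (a + x%:C%C * b))).
Proof.
move=> Hd u0; have [HA HB] := is_derive_Re_line _ _ _ _ _ Hd.
set A := (fun y : R => complex.Re _) in HA; set B := (fun y : R => complex.Im _) in HB.
have HS := is_deriveD (is_deriveM HA HA) (is_deriveM HB HB).
have SE y : (A * A + B * B) y = cabs (u (a + y%:C%C * b)) ^+ 2.
  by rewrite sqr_cabs !expr2.
have S0 : 0 < (A * A + B * B) x by rewrite SE exprn_gt0 // cabs_gt0.
have := is_deriveZ (2^-1 : R) (is_derive1_comp (is_derive1_ln S0) HS).
have -> : 2^-1 \*: (@ln R \o (A * A + B * B)) = (fun y : R => ln (cabs (u (a + y%:C%C * b)))).
  apply/funext => y; rewrite [LHS]/(2^-1 * ln ((A * A + B * B) y)) SE.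
  set c := cabs _; have E : 2^-1 * ln (c ^+ 2) = ln c.
    by rewrite -ln_sqrt ?sqr_ge0 // sqrtr_sqr ger0_norm ?cabs_ge0.
  exact: E.
move=> H; apply: is_derive_eq; rewrite SE sqr_cabs Re_div.
rewrite -[A x]/(complex.Re (u (a + x%:C%C * b))) -[B x]/(complex.Im (u (a + x%:C%C * b))).
move: u0; rewrite -cabs_gt0 => /(exprn_gt0 2); rewrite sqr_cabs => u0.
rewrite /GRing.scale /=; field; by rewrite gt_eqF.
Qed.

(** This replaces the integral of u'/u over a segment. Subtracting psi allows ln |u| to be compared
    with the real part of a polynomial whose derivative is close to u'/u. *)
Lemma lnabs_mvt u u' a b (psi dpsi : R -> R) : (forall x, 0 <= x <= 1 -> cderiv u (a + x%:C%C * b) (u' (a + x%:C%C * b))) ->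
  (forall x, 0 <= x <= 1 -> u (a + x%:C%C * b) != 0) ->
  (forall x, 0 <= x <= 1 -> is_derive x 1 psi (dpsi x)) ->
  exists2 x, 0 <= x <= 1 & ln (cabs (u (a + b))) - ln (cabs (u a)) - (psi 1 - psi 0) =
    complex.Re (b * u' (a + x%:C%C * b) / u (a + x%:C%C * b)) - dpsi x.
Proof.
move=> Hd u0 Hpsi.
pose phi (y : R) := ln (cabs (u (a + y%:C%C * b))).
have H x : 0 <= x <= 1 -> is_derive x 1 (phi - psi)
    (complex.Re (b * u' (a + x%:C%C * b) / u (a + x%:C%C * b)) - dpsi x).
  move=> x01; apply: is_deriveB (Hpsi _ x01).
  exact: is_derive_lnabs (Hd _ x01) (u0 _ x01).
have Hin x : x \in `]0, 1[ -> is_derive x 1 (phi - psi)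
    (complex.Re (b * u' (a + x%:C%C * b) / u (a + x%:C%C * b)) - dpsi x).
  by rewrite in_itv /= => /andP[h1 h2]; apply: H; rewrite !ltW.
have [|x x01 E] := MVT_segment ler01 Hin.
  apply: derivable_within_continuous => y; rewrite in_itv /= => y01.
  exact: (@ex_derive _ _ _ _ _ _ _ (H y y01)).
exists x; first by move: x01; rewrite in_itv.
move: E; rewrite subr0 mulr1 => <-.
rewrite /phi -[(_ - psi) 1]/(phi 1 - psi 1) -[(_ - psi) 0]/(phi 0 - psi 0) /phi.
by rewrite !rmorph1 rmorph0 mul1r mul0r addr0; ring.
Qed.
End LogDerivative.

(** * Growth and logarithmic derivative of zero-free functions *)

Section ZeroFree.
Variable R : realType.
Implicit Types (u g f : R[i] -> R[i]) (a b t w : R[i]) (x y e r rho K M B : R).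

Lemma segment_disc a b p x rho : cabs (a - p) <= rho -> cabs (b - p) <= rho ->
  0 <= x <= 1 -> cabs (a + x%:C%C * (b - a) - p) <= rho.
Proof.
move=> ar br /andP[x0 x1].
have -> : a + x%:C%C * (b - a) - p = (1 - x)%:C%C * (a - p) + x%:C%C * (b - p).
  by rewrite rmorphB rmorph1 /=; ring.
apply: le_trans (cabsD _ _ _) _; rewrite !cabsM !cabs_real !ger0_norm ?subr_ge0 //.
have x1' : 0 <= 1 - x by rewrite subr_ge0.
have := ler_wpM2l x1' ar; have := ler_wpM2l x0 br; lra.
Qed.

Lemma log_ratio u u' rho K a b : 
  (forall t, cabs t <= rho -> cderiv u t (u' t)) ->
  (forall t, cabs t <= rho -> u t != 0) ->
  (forall t, cabs t <= rho -> cabs (u' t / u t) <= K) ->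
  cabs a <= rho -> cabs b <= rho ->
  cabs (u b) <= expR (K * cabs (b - a)) * cabs (u a).
Proof.
move=> Hd u0 HK ar br.
have seg x : 0 <= x <= 1 -> cabs (a + x%:C%C * (b - a)) <= rho.
  by move=> x01; have := segment_disc a b 0 x rho; rewrite !subr0; apply.
have [||x x01] := lnabs_mvt _ u u' a (b - a) (fun=> 0) (fun=> 0).
- by move=> x /seg; exact: Hd.
- by move=> x /seg; exact: u0.
rewrite [a + (b - a)]addrC subrK subrr !subr0 => E.
have ua : 0 < cabs (u a) by rewrite cabs_gt0 u0.
have ub : 0 < cabs (u b) by rewrite cabs_gt0 u0.
have H : ln (cabs (u b)) <= K * cabs (b - a) + ln (cabs (u a)).
  rewrite -lerBlDr E; apply: le_trans (ler_norm _) _; apply: le_trans (abs_Re_le _ _) _.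
  by rewrite -mulrA cabsM mulrC ler_wpM2r ?cabs_ge0 // HK // seg.
by rewrite -(@lnK R (cabs (u b))) ?posrE // -(@lnK R (cabs (u a))) ?posrE // -expRD ler_expR.
Qed.

Lemma poly_primitive (s : {poly R[i]}) :
  exists2 v : {poly R[i]}, v^`() = s & v.[0] = 0.
Proof.
exists (\poly_(k < (size s).+1) (s`_k.-1 / k%:R)).
  apply/polyP => k; rewrite coef_deriv coef_poly ltnS.
  case: ltnP => [_|/(nth_default 0) ->]; last by rewrite mul0rn.
  by rewrite -[_ *+ _]mulr_natr divfK // pnatr_eq0.
by rewrite horner_coef0 coef_poly /= invr0 mulr0.
Qed.

(* Borel-Caratheodory for log u, whose derivative u'/u is approximated by a
   polynomial s with primitive v. *)
Lemma grad_est u u' rho B : 0 < rho ->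
  papprox 0 rho (fun t => u' t / u t) ->
  (forall t, cabs t <= rho -> cderiv u t (u' t)) ->
  (forall t, cabs t <= rho -> u t != 0) ->
  (forall t, cabs t <= rho -> cabs (u t) <= B) ->
  cabs (u' 0 / u 0) * rho <= 2 * (ln B - ln (cabs (u 0))).
Proof.
move=> rho0 Hf Hd u0 HB.
apply: (le_eps_mul _ _ _ (3 * rho)) => [|e e0]; first by rewrite mulr_ge0 // ltW.
have c0 : cabs (0 : R[i]) <= rho by rewrite cabs0 ltW.
have [s Hs] := papprox0 _ _ _ Hf _ e0.
have [v Hv v0] := poly_primitive s.
have B0 : 0 < B by apply: lt_le_trans (HB 0 c0); rewrite cabs_gt0 u0.
pose al := ln B - ln (cabs (u 0)) + e * rho.
have Hre t : cabs t = rho -> complex.Re v.[t] <= al.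
  move=> tr.
  have seg x : 0 <= x <= 1 -> cabs (0 + x%:C%C * t) <= rho.
    move=> x01; have := segment_disc 0 t 0 x rho; rewrite !subr0; apply => //.
    by rewrite tr.
  have [||x|x x01] := lnabs_mvt _ u u' 0 t
     (fun y : R => complex.Re v.[0 + y%:C%C * t]) (fun y => complex.Re (t * s.[0 + y%:C%C * t])).
  - by move=> x /seg; exact: Hd.
  - by move=> x /seg; exact: u0.
  - move=> _; have := cderiv_poly _ v (0 + x%:C%C * t); rewrite Hv.
    by move=> /(is_derive_Re_line _ (fun z => v.[z]))[].
  rewrite rmorph1 rmorph0 mul1r mul0r addr0 !add0r v0 subr0 => E.
  have H : `|complex.Re (t * u' (x%:C%C * t) / u (x%:C%C * t)) - complex.Re (t * s.[x%:C%C * t])| <= e * rho.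
    have -> : complex.Re (t * u' (x%:C%C * t) / u (x%:C%C * t)) - complex.Re (t * s.[x%:C%C * t]) =
       complex.Re (t * (u' (x%:C%C * t) / u (x%:C%C * t) - s.[x%:C%C * t])).
      by rewrite mulrBr mulrA; case: (_ / _) (t * s.[_]) => ? ? [].
    apply: le_trans (abs_Re_le _ _) _; rewrite cabsM tr mulrC ler_wpM2r ?(ltW rho0) //.
    by apply: Hs; have := seg x x01; rewrite add0r.
  have tl : cabs t <= rho by rewrite tr.
  have L : ln (cabs (u t)) <= ln B.
    by rewrite ler_ln ?posrE ?cabs_gt0 ?u0 ?HB.
  have := ler_norm (- (complex.Re (t * u' (x%:C%C * t) / u (x%:C%C * t)) - complex.Re (t * s.[x%:C%C * t]))).
  rewrite normrN -E /al /=; move: H; rewrite -E /=; lra.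
have := poly_borel_caratheodory _ v rho al (ltW rho0) v0 Hre.
have -> : v`_1 = s.[0] by rewrite -Hv horner_coef0 coef_deriv.
have := Hs 0 c0; have := cabs_lower _ (u' 0 / u 0) s.[0].
move=> H1 H2; have : cabs (u' 0 / u 0) <= cabs s.[0] + e by lra.
move=> /(ler_wpM2r (ltW rho0)); rewrite /al; lra.
Qed.

(* With U = ln (2 B) - ln |u| > 0, the gradient estimate reads
   |grad U| <= (2 / rho) U, so that ln U varies by at most 2 sg / rho. *)
Lemma log_deriv_bound u u' r rho sg B c w : 0 < rho -> 0 <= sg -> rho + sg < r ->
  papprox 0 r u ->
  (forall t, cabs t <= rho + sg -> cderiv u t (u' t)) ->
  (forall t, cabs t <= rho + sg -> u t != 0) ->
  (forall t, cabs t <= rho + sg -> cabs (u t) <= B) ->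
  0 < c -> cabs w <= sg -> c * B <= cabs (u w) ->
  cabs (u' 0 / u 0) <= 2 / rho * (expR (2 * sg / rho) * ln (2 / c)).
Proof.
move=> rho0 sg0 rr Hu Hd u0 HB c0 wsg Hw.
have rs0 : 0 < rho + sg by lra.
have c00 : cabs (0 : R[i]) <= rho + sg by rewrite cabs0 ltW.
have B0 : 0 < B by apply: lt_le_trans (HB 0 c00); rewrite cabs_gt0 u0.
have Hf : papprox 0 (rho + sg) (fun t => u' t / u t).
  apply: papproxM; first exact: ltW.
    apply: papprox_deriv rr Hu _ => t; rewrite subr0; exact: Hd.
  by apply: (papprox_inv _ _ r); rewrite ?rs0.
pose U t := ln (2 * B) - ln (cabs (u t)).
have U0 t : cabs t <= rho + sg -> 0 < U t.
  move=> Ht; rewrite /U subr_gt0 ltr_ln ?posrE ?mulr_gt0 ?cabs_gt0 ?u0 //.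
  by apply: le_lt_trans (HB t Ht) _; lra.
have G p : cabs p <= sg -> cabs (u' p / u p) <= 2 / rho * U p.
  move=> ps.
  have Hp t : cabs t <= rho -> cabs (p + t) <= rho + sg.
    by move=> ?; apply: le_trans (cabsD _ _ _) _; lra.
  have := grad_est (fun t => u (p + t)) (fun t => u' (p + t)) rho (2 * B) rho0.
  rewrite addr0 => H; rewrite mulrAC ler_pdivlMr //; apply: H.
  - apply: (papprox_shift _ 0 rho (fun t => u' t / u t) p); apply: papprox_disc Hf.
    by rewrite addr0 subr0; lra.
  - by move=> t /Hp /Hd; exact: cderiv_shift.
  - by move=> t /Hp; exact: u0.
  - by move=> t /Hp /HB /le_trans; apply; lra.
have seg x : 0 <= x <= 1 -> cabs (w + x%:C%C * (0 - w)) <= sg.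
  move=> x01; have := segment_disc w 0 0 x sg; rewrite !subr0; apply => //.
  by rewrite cabs0.
have seg' x : 0 <= x <= 1 -> cabs (w + x%:C%C * (0 - w)) <= rho + sg.
  by move=> /seg; lra.
pose gam (x : R) := w + x%:C%C * (0 - w).
pose dl (x : R) := complex.Re ((0 - w) * u' (gam x) / u (gam x)).
have D x : 0 <= x <= 1 -> is_derive x 1 (fun y : R => ln (U (gam y))) ((U (gam x))^-1 * - dl x).
  move=> x01.
  have H1 : is_derive x 1 (fun y : R => U (gam y)) (- dl x).
    rewrite -[- dl x]add0r; apply: (@is_deriveB _ _ _ (cst (ln (2 * B)))).
    exact: is_derive_lnabs (Hd _ (seg' x x01)) (u0 _ (seg' x x01)).
  exact: (@is_derive1_comp R (@ln R) (fun y : R => U (gam y)) x _ _ (is_derive1_ln (U0 _ (seg' x x01))) H1).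
have Hin x : x \in `]0, 1[ -> is_derive x 1 (fun y : R => ln (U (gam y))) ((U (gam x))^-1 * - dl x).
  by rewrite in_itv /= => /andP[h1 h2]; apply: D; rewrite !ltW.
have [|x] := MVT_segment ler01 Hin.
  apply: derivable_within_continuous => y; rewrite in_itv /= => y01.
  exact: (@ex_derive _ _ _ _ _ _ _ (D y y01)).
rewrite in_itv /= => x01; rewrite subr0 mulr1.
have -> : gam 1 = 0 by rewrite /gam rmorph1 mul1r addrC subrK.
have -> : gam 0 = w by rewrite /gam rmorph0 mul0r addr0.
move=> E.
have gx : cabs (gam x) <= sg by exact: seg.
have Ux := U0 _ (seg' x x01); rewrite -/(gam x) in Ux.
have H : (U (gam x))^-1 * - dl x <= 2 * sg / rho.
  rewrite mulrC ler_pdivrMr //; apply: le_trans (ler_norm _) _; rewrite normrN.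
  apply: le_trans (abs_Re_le _ _) _; rewrite -mulrA cabsM sub0r cabsN.
  apply: le_trans (ler_pM (cabs_ge0 _ _) (cabs_ge0 _ _) wsg (G _ gx)) _.
  by rewrite le_eqVlt; apply/orP; left; apply/eqP; ring.
have w0 : cabs w <= rho + sg by lra.
have HU : U 0 <= expR (2 * sg / rho) * U w.
  rewrite -(@lnK R (U 0)) ?posrE ?U0 // -(@lnK R (U w)) ?posrE ?U0 //.
  by rewrite -expRD ler_expR; lra.
have HUw : U w <= ln (2 / c).
  rewrite /U -ln_div ?posrE ?mulr_gt0 ?cabs_gt0 ?u0 //.
  rewrite ler_ln ?posrE ?divr_gt0 ?mulr_gt0 ?cabs_gt0 ?u0 //.
  rewrite ler_pdivrMr ?cabs_gt0 ?u0 // mulrAC ler_pdivlMr //.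
  by rewrite -mulrA ler_wpM2l // mulrC.
apply: le_trans (G 0 _) _; first by rewrite cabs0.
rewrite ler_wpM2l ?divr_ge0 ?(ltW rho0) //.
by apply: le_trans HU _; rewrite ler_wpM2l // expR_ge0.
Qed.
End ZeroFree.

(** * Dividing out zeros *)

Section Factorization.
Variable R : realType.
Implicit Types (u g f : R[i] -> R[i]) (a b t w : R[i]) (x y e r rho K M B : R) (s : seq R[i]).

Definition root_poly s : {poly R[i]} := \prod_(a <- s) ('X - a%:P).

Lemma root_polyE s t : (root_poly s).[t] = \prod_(a <- s) (t - a).
Proof.
by rewrite /root_poly horner_prod; apply: eq_bigr => a _; rewrite !hornerE.
Qed.

Lemma root_poly_cons a s t : (root_poly (a :: s)).[t] = (t - a) * (root_poly s).[t].
Proof. by rewrite !root_polyE big_cons. Qed.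

(** Multiplicities are repetitions in s. The cofactor u may still vanish; that s exhausts the zeros
    is always stated separately. *)
Definition factors r g s u : Prop :=
  papprox 0 r u /\ forall t, cabs t <= r -> g t = (root_poly s).[t] * u t.

Lemma root_poly_le s rho tau t N : all (fun a => cabs a <= rho) s -> cabs t <= tau ->
  1 <= rho + tau -> (size s <= N)%N -> cabs (root_poly s).[t] <= (rho + tau) ^+ N.
Proof.
move=> sr tt r1 sN; apply: le_trans (ler_weXn2l r1 sN).
rewrite root_polyE cabs_prod; elim: s sr {sN} => [_|a s IH /= /andP[ar sr]].
  by rewrite big_nil.
rewrite big_cons exprS ler_pM ?cabs_ge0 ?IH //.
  by apply: prodr_ge0 => i _; exact: cabs_ge0.
by apply: le_trans (cabsB _ _ _) _; lra.
Qed.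

Lemma root_poly_ge s d t N : (forall a, a \in s -> d <= cabs (t - a)) ->
  0 <= d <= 1 -> (size s <= N)%N -> d ^+ N <= cabs (root_poly s).[t].
Proof.
move=> sd /andP[d0 d1] sN; apply: le_trans (ler_wiXn2l d0 d1 sN) _.
rewrite root_polyE cabs_prod; elim: s sd {sN} => [_|a s IH sd].
  by rewrite big_nil.
rewrite big_cons exprS ler_pM ?exprn_ge0 // ?sd ?mem_head ?IH // => b bs.
by rewrite sd // in_cons bs orbT.
Qed.

Lemma root_poly_logderiv s d t N : (forall a, a \in s -> d <= cabs (t - a)) ->
  0 < d -> (size s <= N)%N ->
  cabs ((root_poly s)^`().[t] / (root_poly s).[t]) <= N%:R / d.
Proof.
move=> sd d0 sN; apply: (@le_trans _ _ ((size s)%:R / d)); last first.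
  by rewrite ler_wpM2r ?invr_ge0 ?(ltW d0) // ler_nat.
elim: s sd {sN} => [_|a s IH sd].
  by rewrite /root_poly big_nil derivC horner0 !mul0r cabs0.
have sd' b : b \in s -> d <= cabs (t - b) by move=> bs; rewrite sd // in_cons bs orbT.
have ta : t - a != 0.
  by rewrite -cabs_gt0; apply: lt_le_trans (sd a (mem_head _ _)).
have P0 : (root_poly s).[t] != 0.
  rewrite root_polyE prodf_seq_neq0; apply/allP => b bs /=.
  by rewrite -cabs_gt0; apply: lt_le_trans (sd' b bs).
have -> : (root_poly (a :: s))^`().[t] / (root_poly (a :: s)).[t] =
  (t - a)^-1 + (root_poly s)^`().[t] / (root_poly s).[t].
  rewrite root_poly_cons {1}/root_poly big_cons -/(root_poly s) derivM derivXsubC.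
  by rewrite !hornerE; field; rewrite ta P0.
apply: le_trans (cabsD _ _ _) _; rewrite /= -natr1 mulrDl addrC lerD ?IH //.
by rewrite cabsV mul1r lef_pV2 ?posrE // ?cabs_gt0 // sd // mem_head.
Qed.

(** Zeros of the cofactor are divided out one at a time, and the bound N on the length of such lists
    makes this stop. That bound comes from Jensen's inequality in one direction of the theorem and
    from the counting condition in the other. *)
Lemma max_factor rho r g N : rho < r -> papprox 0 r g ->
  (forall s u, all (fun a => cabs a <= rho) s -> factors r g s u -> (size s <= N)%N) ->
  exists s u, [/\ all (fun a => cabs a <= rho) s, factors r g s u &
    forall t, cabs t <= rho -> u t != 0].
Proof.
move=> rr Hg HN.
suff H k : forall s u, all (fun a => cabs a <= rho) s -> factors r g s u ->
    (N - size s <= k)%N ->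
    exists s u, [/\ all (fun a => cabs a <= rho) s, factors r g s u &
      forall t, cabs t <= rho -> u t != 0].
  apply: (H N [::] g) => //; last by rewrite leq_subr.
  by split=> // t _; rewrite root_polyE big_nil mul1r.
elim: k => [|k IH] s u Hs Hu Hk.
(* Both cases of the induction lengthen s by a zero a of u; for k = 0 the longer list contradicts
   [HN]. *)
all: have [[a [ar ua]]|Hu0] := pselect (exists a, cabs a <= rho /\ u a = 0);
  last by exists s, u; split=> // t tr; apply/eqP => ut; apply: Hu0; exists t.
all: have [Hup Hue] := Hu; have [v Hv Huv] := papprox_div _ r u a Hup (le_lt_trans ar rr) ua.
all: have Hs' : all (fun a => cabs a <= rho) (a :: s) by rewrite /= ar.
all: have Hv' : factors r g (a :: s) v by
  split=> // t tr; rewrite Hue // Huv // root_poly_cons; ring.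
all: have HN' := HN _ _ Hs' Hv'.
  by move: HN' Hk => /=; lia.
by apply: (IH _ _ Hs' Hv'); move: HN' Hk => /=; lia.
Qed.

Lemma has_coef_unique r g c c' : 0 < r -> papprox 0 r g ->
  has_coef r g c -> has_coef r g c' -> c =1 c'.
Proof.
move=> r0 Hg H H' m; apply/eqP; rewrite -subr_eq0 -cabs_eq0 eq_le cabs_ge0 andbT.
have rm : 0 < r ^+ m by exact: exprn_gt0.
rewrite -(pmulr_lle0 _ rm) mulrC; apply: (le_eps_mul _ _ _ 2) => // e e0.
have [q Hq] := papprox0 _ _ _ Hg _ e0.
have := H q e Hq m; have := H' q e Hq m; rewrite [cabs (c' m - _)]cabs_distC.
have := ler_wpM2r (ltW rm) (cabs_tri _ q`_m (c m) (c' m)); rewrite mulrDl.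
lra.
Qed.

Lemma has_coef_Xn r k g v d : 0 < r -> papprox 0 r v -> has_coef r v d ->
  (forall t, cabs t <= r -> g t = t ^+ k * v t) ->
  has_coef r g (fun j => if (j < k)%N then 0 else d (j - k)%N).
Proof.
move=> r0 Hv Hd Hg q e He m; apply: (le_eps_mul _ _ _ (r ^+ k + r ^+ k)).
  by rewrite addr_ge0 // exprn_ge0 // ltW.
move=> h h0; have [p Hp] := papprox0 _ _ _ Hv _ h0.
have H1 : cabs (('X^k * p)`_m - q`_m) * r ^+ m <= e + h * r ^+ k.
  rewrite -coefB; apply: poly_cauchy (ltW r0) _ => t tr.
  have tr' : cabs t <= r by rewrite tr.
  rewrite !hornerE; apply: le_trans (cabs_tri _ (g t) _ _) _.
  rewrite addrC lerD ?He // Hg // -mulrBr cabsM cabsX tr mulrC ler_wpM2r ?exprn_ge0 ?(ltW r0) //.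
  by rewrite cabs_distC Hp.
have H2 : cabs ((if (m < k)%N then 0 else d (m - k)%N) - ('X^k * p)`_m) * r ^+ m <= h * r ^+ k.
  rewrite coefXnM; case: ltnP => mk.
    by rewrite subrr cabs0 mul0r mulr_ge0 ?exprn_ge0 // ltW.
  have -> : r ^+ m = r ^+ (m - k) * r ^+ k by rewrite -exprD subnK.
  rewrite mulrA ler_wpM2r ?exprn_ge0 ?(ltW r0) //.
  exact: Hd.
have rm : 0 <= r ^+ m by rewrite exprn_ge0 // ltW.
have := ler_wpM2r rm (cabs_tri _ ('X^k * p)`_m (if (m < k)%N then 0 else d (m - k)%N) q`_m).
rewrite mulrDl mulrDr; move: H1 H2; lra.
Qed.

(** Links occurrences of a in s to the order of vanishing at a: g (a + t) = t^k v t, where v gathers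
    the other zeros and u. In general the order is at least k; it is k when u does not vanish at
    a. *)
Lemma coef_factor r g s u a c : cabs a < r -> papprox 0 r g -> factors r g s u ->
  has_coef (r - cabs a) (fun t => g (a + t)) c ->
  (forall j, (j < count_mem a s)%N -> c j = 0) /\
  (u a != 0 -> c (count_mem a s) != 0).
Proof.
move=> ar Hg [Hu Hgu] Hc; set k := count_mem a s; set r' := r - cabs a.
have r'0 : 0 < r' by rewrite subr_gt0.
pose s' := [seq b <- s | b != a].
pose v t := (root_poly s').[a + t] * u (a + t).
have sh f : papprox 0 r f -> papprox 0 r' (fun t => f (a + t)).
  move=> Hf; apply: papprox_shift; apply: papprox_disc Hf.
  by rewrite addr0 subr0 /r'; lra.
have Hv : papprox 0 r' v.
  apply: papproxM; [exact: ltW| |exact: sh].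
  by apply: (sh (fun t => (root_poly s').[t])); exact: papprox_poly.
have E t : (root_poly s).[a + t] = t ^+ k * (root_poly s').[a + t].
  rewrite !root_polyE /s' /k; elim: (s) => [|b s1 IH /=]; first by rewrite !big_nil mul1r.
  rewrite big_cons IH; case: eqVneq => [->|ba] /=.
    by rewrite addrC addKr add1n exprS mulrA.
  by rewrite big_cons add0n; ring.
have [d Hd] := papprox_coef _ _ _ r'0 Hv.
have Hvg t : cabs t <= r' -> g (a + t) = t ^+ k * v t.
  move=> tr; rewrite Hgu ?E ?mulrA //.
  by apply: le_trans (cabsD _ _ _) _; move: tr; rewrite /r'; lra.
have EC := has_coef_unique _ _ _ _ r'0 (sh _ Hg) Hc (has_coef_Xn _ _ _ _ _ r'0 Hv Hd Hvg).
split=> [j jk|ua]; first by rewrite EC jk.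
rewrite EC ltnn subnn -(has_coef0 _ _ _ _ r'0 Hv Hd) /v addr0 mulf_neq0 //.
rewrite root_polyE prodf_seq_neq0; apply/allP => b; rewrite mem_filter => /andP[ba _].
by rewrite /= subr_eq0 eq_sym.
Qed.
End Factorization.
Arguments root_poly {R} s.
Arguments factors {R} r g s u.

(** * Bounding the number of zeros *)

Section Counting.
Variable R : realType.
Implicit Types (u g f : R[i] -> R[i]) (a b t w : R[i]) (x y e r rho K M B : R) (s : seq R[i]).

(** Blaschke factors of the disc of radius rr have modulus below 1 inside, uniformly in a and w; the
    quantitative form is the identity [id]. *)
Lemma blaschke_ratio rr beta : 2^-1 < beta -> beta < rr ->
  exists2 q : R, 0 <= q < 1 & forall a w, cabs a <= beta -> cabs w <= 2^-1 ->
    rr * cabs (w - a) <= q * cabs (rr%:C%C ^+ 2 - a^* * w).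
Proof.
move=> b2 br; have r0 : 0 < rr by lra.
(* A lower bound for 1 minus the squared modulus of the Blaschke factor: the numerator bounds the
   right side of [id] from below, and the denominator bounds [X ^+ 2] from above. *)
pose kap := (rr ^+ 2 - beta ^+ 2) * (rr ^+ 2 - 4^-1) / (4 * rr ^+ 4).
have k1 : 0 < rr ^+ 2 - beta ^+ 2 by nra.
have k2 : 0 < rr ^+ 2 - 4^-1 by nra.
have r4 : 0 < 4 * rr ^+ 4 by rewrite mulr_gt0 // exprn_gt0.
have kap0 : 0 < kap by rewrite /kap divr_gt0 // mulr_gt0.
have kap1 : kap <= 1.
  rewrite /kap ler_pdivrMr // mul1r.
  have -> : 4 * rr ^+ 4 = 4 * (rr ^+ 2 * rr ^+ 2) by ring.
  have : 0 <= beta ^+ 2 by exact: sqr_ge0.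
  have : 0 <= rr ^+ 2 by exact: sqr_ge0.
  by move: k1 k2; move: (rr ^+ 2) (beta ^+ 2) => X Y; nra.
exists (Num.sqrt (1 - kap)).
  rewrite sqrtr_ge0 /= -[ltRHS]sqrtr1 ltr_sqrt; lra.
move=> a w ab w2.
have id : cabs (rr%:C%C ^+ 2 - a^* * w) ^+ 2 - rr ^+ 2 * cabs (w - a) ^+ 2 =
    (rr ^+ 2 - cabs a ^+ 2) * (rr ^+ 2 - cabs w ^+ 2).
  rewrite !sqr_cabs; case: a {ab} => a1 a2; case: w {w2} => w1 w2 /=.
  by rewrite !expr2 /=; ring.
set X := cabs (_ - _ * w) in id *.
have X0 : 0 <= X by exact: cabs_ge0.
have X2 : X ^+ 2 <= 4 * rr ^+ 4.
  have : X <= 2 * rr ^+ 2.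
    apply: le_trans (cabsB _ _ _) _; rewrite cabsX cabs_real (ger0_norm (ltW r0)) cabsM.
    have -> : cabs a^* = cabs a by case: a {ab id X X0} => ? ?; rewrite /= sqrrN.
    have := cabs_ge0 _ a; have := cabs_ge0 _ w; nra.
  move=> h; have -> : 4 * rr ^+ 4 = (2 * rr ^+ 2) ^+ 2 by ring.
  by rewrite lerXn2r ?nnegrE // mulr_ge0 // sqr_ge0.
have Y : (rr * cabs (w - a)) ^+ 2 <= (1 - kap) * X ^+ 2.
  have e1 : cabs a ^+ 2 <= beta ^+ 2 by rewrite lerXn2r ?nnegrE ?cabs_ge0 //; lra.
  have e2 : cabs w ^+ 2 <= 4^-1.
    have -> : 4^-1 = 2^-1 ^+ 2 :> R by field.
    by rewrite lerXn2r ?nnegrE ?cabs_ge0.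
  have e3 : kap * X ^+ 2 <= (rr ^+ 2 - cabs a ^+ 2) * (rr ^+ 2 - cabs w ^+ 2).
    apply: le_trans (ler_wpM2l (ltW kap0) X2) _.
    rewrite /kap divfK ?gt_eqF //; apply: ler_pM; lra.
  by rewrite exprMn; lra.
have q0 := sqrtr_ge0 (1 - kap).
rewrite -(@ler_pXn2r _ 2) ?nnegrE ?mulr_ge0 ?cabs_ge0 ?(ltW r0) //.
by rewrite [leRHS]exprMn sqr_sqrtr //; lra.
Qed.

Lemma cabs_reflect rr a w : cabs w = rr -> cabs (rr%:C%C ^+ 2 - a^* * w) = rr * cabs (w - a).
Proof.
move=> wr; have r0 : 0 <= rr by rewrite -wr cabs_ge0.
apply/eqP; rewrite -(@eqrXn2 _ 2) ?mulr_ge0 ?cabs_ge0 //; apply/eqP.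
have h : rr ^+ 2 = complex.Re w ^+ 2 + complex.Im w ^+ 2 by rewrite -wr sqr_cabs.
have -> : (rr%:C%C ^+ 2 : R[i]) = (complex.Re w ^+ 2 + complex.Im w ^+ 2)%:C%C.
  by rewrite -h rmorphXn.
rewrite exprMn !sqr_cabs h; case: (a) => a1 a2; case: (w) => w1 w2 /=.
by ring.
Qed.

(* Multiply u = g / prod (w - a) by prod (rr^2 - conj(a) w) / rr: this leaves
   |g| unchanged on the circle |w| = rr. *)
Lemma jensen_bound rr beta : 2^-1 < beta -> beta < rr ->
  exists2 q : R, 0 <= q < 1 & forall g s u B,
    all (fun a => cabs a <= beta) s -> factors rr g s u ->
    (forall t, cabs t <= rr -> cabs (g t) <= B) ->
    forall w, cabs w <= 2^-1 -> cabs (g w) <= B * q ^+ size s.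
Proof.
move=> b2 br; have [q q01 Hq] := blaschke_ratio rr beta b2 br.
have r0 : 0 < rr by lra.
have h2 : (2^-1 : R) < 1 by lra.
exists q => // g s u B Hs [Hu Hg] HB w w2.
have wr : cabs w <= rr by lra.
pose refl : {poly R[i]} := \prod_(a <- s) ((rr%:C%C ^+ 2)%:P - (a^* )%:P * 'X).
have reflE t : refl.[t] = \prod_(a <- s) (rr%:C%C ^+ 2 - a^* * t).
  by rewrite /refl horner_prod; apply: eq_bigr => a _; rewrite !hornerE.
pose v t := refl.[t] * u t.
have Hv : papprox 0 rr v.
  by apply: papproxM => //; [exact: ltW|exact: papprox_poly].
have rs : 0 < rr ^+ size s by exact: exprn_gt0.
have prodr (f : R[i] -> R[i]) : rr ^+ size s * \prod_(a <- s) cabs (f a) =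
    \prod_(a <- s) (rr * cabs (f a)).
  elim: s {Hs Hg refl reflE v Hv rs} => [|a s IH]; first by rewrite !big_nil mulr1.
  by rewrite !big_cons -IH exprS; ring.
have Hvc t : cabs t <= rr -> cabs (v t) <= B * rr ^+ size s.
  apply: (papprox_max _ rr v) => // {}t tr.
  have E : cabs (v t) = cabs (g t) * rr ^+ size s.
    have Ep : \prod_(a <- s) cabs (rr%:C%C ^+ 2 - a^* * t) =
        rr ^+ size s * \prod_(a <- s) cabs (t - a).
      by rewrite prodr; apply: eq_bigr => a _; exact: cabs_reflect.
    by rewrite /v Hg ?tr // !cabsM reflE root_polyE !cabs_prod Ep -mulrA mulrC.
  by rewrite E ler_wpM2r ?(ltW rs) // HB // tr.
have := Hvc w wr; rewrite -(ler_pM2l rs) => H.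
rewrite -(ler_pM2l rs) Hg // root_polyE !cabsM cabs_prod mulrA prodr.
have Hpr : \prod_(a <- s) (rr * cabs (w - a)) <= q ^+ size s * cabs refl.[w].
  rewrite reflE cabs_prod; elim: s Hs {Hg refl reflE v Hv rs prodr Hvc H} => [_|a s IH /= /andP[ab Hs]].
    by rewrite !big_nil mulr1.
  rewrite !big_cons exprS mulrACA ler_pM ?IH ?Hq ?mulr_ge0 ?cabs_ge0 ?(ltW r0) //.
  by apply: prodr_ge0 => i _; rewrite mulr_ge0 ?cabs_ge0 ?(ltW r0).
apply: le_trans (ler_wpM2r (cabs_ge0 _ (u w)) Hpr) _.
rewrite -mulrA -cabsM -/(v w).
have q0 : 0 <= q ^+ size s by rewrite exprn_ge0 //; case/andP: q01.
apply: le_trans (ler_wpM2l q0 (Hvc w wr)) _; rewrite le_eqVlt; apply/orP; left; apply/eqP.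
by move: (q ^+ _) (rr ^+ _) => x y; ring.
Qed.

(** A coefficient of modulus at least A and order at most N prevents |g| from staying below A 2^(-N)
    on |w| <= 1/2, where [jensen_bound] gives at most C A q^(size s). As A cancels, size s is
    bounded in terms of C and N. *)
Lemma zero_bound rr beta C N : 2^-1 < beta -> beta < rr ->
  exists N', forall g c s u A k, papprox 0 rr g -> has_coef rr g c ->
    all (fun a => cabs a <= beta) s -> factors rr g s u ->
    0 < A -> (k <= N)%N -> A <= cabs (c k) ->
    (forall t, cabs t <= rr -> cabs (g t) <= C * A) -> (size s <= N')%N.
Proof.
move=> b2 br; have [q q01 Hq] := jensen_bound rr beta b2 br.
have h0 : (0 : R) < 2^-1 by rewrite invr_gt0.
have e0 : (0 : R) < 2^-1 ^+ N / 2 by rewrite divr_gt0 ?exprn_gt0.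
have [N' HN'] := pow_small _ _ C _ q01 e0.
exists N' => g c s u A k Hg Hc Hs Hf A0 kN Ak HB.
rewrite leqNgt; apply/negP => /ltnW /HN' HqC.
have hr : 0 < (2^-1 : R) <= rr by lra.
have := has_coef_bound _ _ _ _ _ (Hq g s u _ Hs Hf HB) (has_coef_restr _ _ _ _ _ hr Hg Hc) k.
apply/negP; rewrite -ltNge mulrAC.
apply: (@lt_le_trans _ _ (A * 2^-1 ^+ N)).
  apply: le_lt_trans (ler_wpM2r (ltW A0) HqC) _.
  rewrite mulrC ltr_pM2l //; have : (0 : R) < 2^-1 ^+ N by rewrite exprn_gt0.
  by lra.
apply: ler_pM; rewrite ?(ltW A0) ?exprn_ge0 ?(ltW h0) //.
by apply: ler_wiXn2l => //; lra.
Qed.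
End Counting.

(** * The one-variable estimates behind both implications *)

Section Core.
Variable R : realType.
Implicit Types (u g f : R[i] -> R[i]) (a b t w : R[i]) (x y e r rho K M B : R) (s : seq R[i]).

Lemma factor_logderiv r g s u t d d' : factors r g s u -> cabs t < r ->
  cderiv g t d -> cderiv u t d' -> (root_poly s).[t] != 0 -> u t != 0 ->
  d / g t = (root_poly s)^`().[t] / (root_poly s).[t] + d' / u t.
Proof.
move=> [_ Hg] tr Hd Hd' P0 u0.
have H := cderivM _ _ _ _ _ _ (cderiv_poly _ (root_poly s) t) Hd'.
have e0 : 0 < r - cabs t by rewrite subr_gt0.
have H2 : cderiv g t ((root_poly s)^`().[t] * u t + (root_poly s).[t] * d').
  apply: (cderiv_ext _ _ _ _ _ _ e0) H => w Hw; rewrite Hg //.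
  by have := cabs_lower _ w t; lra.
rewrite (cderiv_unique _ _ _ _ _ Hd H2) Hg ?(ltW tr) //.
by field; rewrite P0 u0.
Qed.

Lemma papprox_derivative r u : papprox 0 r u ->
  exists u', forall t, cabs t < r -> cderiv u t (u' t).
Proof.
move=> Hu; have /choice[u' Hu'] t : exists d, cabs t < r -> cderiv u t d.
  have [tr|] := ltP (cabs t) r; last by exists 0.
  have tr' : cabs (t - 0) < r by rewrite subr0.
  by have [d Hd _] := papprox_cderiv _ _ _ _ _ tr' Hu; exists d.
by exists u'.
Qed.

(** Cauchy's estimate for the leading coefficient, which is 1. It holds wherever the zeros lie, even
    on the unit circle. *)
Lemma root_poly_circle_lower s c : (forall t, cabs t = 1 -> cabs (root_poly s).[t] <= c) -> 1 <= c.
Proof.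
move=> H; have := poly_cauchy _ _ 1 c (size s) ler01 H.
have /monicP := monic_prod_XsubC s predT id; rewrite /lead_coef.
have -> : (size (\prod_(a <- s) ('X - a%:P))).-1 = size s by rewrite size_prod_XsubC.
by rewrite -/(root_poly s) => ->; rewrite cabs1 expr1n mulr1.
Qed.

Lemma growth_from_circle r beta rho (N : nat) d Q g g' s u M : 1 < beta < r -> 1 <= rho <= beta ->
  0 < d -> all (fun a => cabs a <= beta) s -> (size s <= N)%N -> factors r g s u ->
  (forall t, cabs t <= beta -> u t != 0) ->
  (forall t, cabs t = rho -> cderiv g t (g' t)) ->
  (forall a, a \in s -> d <= `|rho - cabs a|) ->
  (forall t, cabs t = rho -> cabs (g' t / g t) <= Q) ->
  (forall t, cabs t <= 1 -> cabs (g t) <= M) ->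
  forall t, cabs t <= rho ->
    cabs (g t) <= (2 * beta) ^+ N * expR ((Q + N%:R / d) * (2 * beta)) * M.
Proof.
move=> /andP[b1 br] /andP[r1 rb] d0 Hs sN Hf u0 Hg' Hd HQ HM t tr.
have [Hu Hg] := Hf; have rho0 : 0 < rho by lra.
have [u' Hu'] := papprox_derivative _ _ Hu.
(* A bound for u'/u on |w| = rho: Q bounds g'/g, and the logarithmic derivative of the root
   polynomial has at most N terms, each at most 1 / d. *)
pose K := Q + N%:R / d.
have circ w : cabs w = rho -> forall a, a \in s -> d <= cabs (w - a).
  move=> wr a /Hd /le_trans; apply; rewrite -wr ler_norml.
  by have := cabs_lower _ w a; have := cabs_lower _ a w; rewrite [cabs (a - w)]cabs_distC; lra.
have HK : forall w, cabs w <= rho -> cabs (u' w / u w) <= K.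
  apply: (papprox_max _ rho (fun w => u' w / u w)) => //.
    apply: papproxM; first exact: ltW.
      apply: (papprox_deriv _ _ r _ u); rewrite ?(le_lt_trans rb) // => w; rewrite subr0 => wr.
      by apply: Hu'; lra.
    apply: (papprox_inv _ _ r) => //; first lra.
    by move=> w wr; apply: u0; lra.
  move=> w wr.
  have wbr : cabs w < r by lra.
  have wb : cabs w <= beta by lra.
  have P0 : (root_poly s).[w] != 0.
    rewrite root_polyE prodf_seq_neq0; apply/allP => a /= /(circ w wr) h.
    by rewrite -cabs_gt0; apply: lt_le_trans h.
  have E := factor_logderiv _ _ _ _ _ _ _ Hf wbr (Hg' w wr) (Hu' w wbr) P0 (u0 w wb).
  have -> : u' w / u w = g' w / g w - (root_poly s)^`().[w] / (root_poly s).[w].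
    by rewrite E addrC addKr.
  apply: le_trans (cabsB _ _ _) _; rewrite lerD ?HQ //.
  exact: root_poly_logderiv (circ w wr) d0 sN.
have b0 : 0 < 2 * beta by lra.
have K0 : 0 <= K by apply: le_trans (HK 0 _); rewrite ?cabs_ge0 ?cabs0 // ltW.
set E := expR _; have E0 : 0 < E by exact: expR_gt0.
have ratio w : cabs w <= rho -> cabs (u t) <= E * cabs (u w).
  move=> wr.
  have := log_ratio _ u u' rho K w t _ _ HK wr tr.
  move=> H; apply: le_trans (H _ _) _.
  - by move=> v vr; apply: Hu'; lra.
  - by move=> v vr; apply: u0; lra.
  - rewrite ler_wpM2r ?cabs_ge0 // ler_expR ler_wpM2l //.
    by apply: le_trans (cabsB _ _ _) _; lra.
have t0 : 0 < cabs (u t) by rewrite cabs_gt0 u0 //; lra.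
(* On the unit circle the root polynomial times |u t| is at most E |g w| <= E M, since |u t| <= E |u
   w|. A monic polynomial cannot be smaller than 1 throughout this circle, whence |u t| <= E M. *)
have L : 1 <= E * M / cabs (u t).
  apply: (root_poly_circle_lower s) => w w1.
  have wr : cabs w <= rho by rewrite w1.
  rewrite ler_pdivlMr //; apply: le_trans (ler_wpM2l (cabs_ge0 _ _) (ratio w wr)) _.
  rewrite mulrCA ler_wpM2l ?(ltW E0) // -cabsM -Hg.
    by apply: HM; rewrite w1.
  by lra.
move: L; rewrite ler_pdivlMr // mul1r => L.
rewrite Hg; last by lra.
rewrite cabsM -mulrA ler_pM ?cabs_ge0 //.
rewrite -[2 * beta]/(2 * beta); have -> : 2 * beta = beta + beta by ring.
by apply: root_poly_le => //; lra.
Qed.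

(** If |g| <= M on |t| <= 1, then |g| <= C M on |t| <= rho, so the Taylor tail from order N on is at
    most M / 2 on |t| <= 1. Thus M improves to N A + M / 2, and by iteration to 2 N A. Cauchy's
    estimates on |t| <= rho then bound c m by 2 C N A rho^(-m), which is at most A from [m1] on. *)
Lemma index_from_growth rho C : 1 < rho -> 0 < C -> exists m0, forall r g c A,
  rho < r -> papprox 0 r g -> has_coef r g c ->
  (forall M, (forall t, cabs t <= 1 -> cabs (g t) <= M) ->
     forall t, cabs t <= rho -> cabs (g t) <= C * M) ->
  (forall k, (k <= m0)%N -> cabs (c k) <= A) -> forall m, cabs (c m) <= A.
Proof.
move=> rho1 C0; have rho0 : 0 < rho by lra.
pose x := rho^-1; have x01 : 0 <= x < 1 by rewrite invr_ge0 ltW //= invf_lt1.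
have /andP[x0 x1] := x01.
have h0 : (0 : R) < 2^-1 by rewrite invr_gt0.
have [N HN] := pow_small1 _ _ (C / (1 - x)) _ x01 h0.
have [m1 Hm1] := pow_small _ _ (C * (2 * N%:R)) _ x01 ltr01.
exists (maxn N m1) => r g c A rr Hg Hc Hdbl HA.
have A0 : 0 <= A by apply: le_trans (HA 0%N _); rewrite ?cabs_ge0.
have r0 : 0 < r by lra.
have Hg1 := papprox_le _ _ _ _ _ (ltW rr) Hg.
have Hc1 : has_coef rho g c by apply: has_coef_restr Hg Hc; rewrite rho0 ltW.
have Half M : 0 <= M -> (forall t, cabs t <= 1 -> cabs (g t) <= M) ->
    forall t, cabs t <= 1 -> cabs (g t) <= N%:R * A + M / 2.
  move=> M0 HM t t1.
  have tr : cabs t < rho by lra.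
  have tx : cabs t / rho <= x by rewrite ler_pdivrMr // /x mulVf ?gt_eqF.
  have tx0 : 0 <= cabs t / rho by rewrite divr_ge0 ?cabs_ge0 // ltW.
  have := has_coef_taylor _ _ _ _ _ N _ rho0 Hg1 Hc1 (Hdbl M HM) tr.
  have H1 : C * M * (cabs t / rho) ^+ N / (1 - cabs t / rho) <= M / 2.
    apply: (@le_trans _ _ (M * (C / (1 - x) * x ^+ N))); last by rewrite ler_wpM2l.
    have -> : M * (C / (1 - x) * x ^+ N) = C * M * x ^+ N / (1 - x).
      by move: (x ^+ N) (1 - x)^-1 => y z; ring.
    apply: ler_pM; rewrite ?mulr_ge0 ?invr_ge0 ?exprn_ge0 ?(ltW C0) //; first by lra.
      by rewrite ler_wpM2l ?mulr_ge0 ?(ltW C0) // lerXn2r ?nnegrE.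
    by rewrite lef_pV2 ?posrE; lra.
  have H2 : cabs (\sum_(k < N) c k * t ^+ k) <= N%:R * A.
    apply: le_trans (cabs_sum _ _ _ _ _) _.
    have -> : N%:R * A = \sum_(k < N) A by rewrite sumr_const card_ord mulr_natl.
    apply: ler_sum => k _; rewrite cabsM cabsX -[leRHS]mulr1 ler_pM ?cabs_ge0 ?exprn_ge0 ?cabs_ge0 //.
      by apply: HA; rewrite leq_max (ltnW (ltn_ord k)).
    by rewrite exprn_ile1 ?cabs_ge0.
  have := cabs_lower _ (g t) (\sum_(k < N) c k * t ^+ k); lra.
have [M M0 HM] := papprox_bounded _ _ _ _ (ltW rho0) Hg1.
have NA : 0 <= N%:R * A by rewrite mulr_ge0.
have HMj j : forall t, cabs t <= 1 -> cabs (g t) <= 2 * (N%:R * A) + M * 2^-1 ^+ j.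
  elim: j => [|j IH] t t1.
    rewrite expr0 mulr1; apply: le_trans (HM t _) _; last by lra.
    by rewrite subr0; lra.
  have hj : 0 <= M * 2^-1 ^+ j by rewrite mulr_ge0 ?exprn_ge0 ?(ltW M0) // ltW.
  apply: le_trans (Half _ _ IH t t1) _; first by lra.
  by rewrite exprS; lra.
have HM' t : cabs t <= 1 -> cabs (g t) <= 2 * (N%:R * A).
  move=> t1; apply/ler_addgt0Pr => e e0.
  have h1 : 0 <= (2^-1 : R) < 1 by lra.
  have [j Hj] := pow_small1 _ _ M _ h1 e0.
  by apply: le_trans (HMj j t t1) _; rewrite lerD2l.
move=> m; have [mm|mm] := leqP m (maxn N m1); first exact: HA.
have := has_coef_bound _ _ _ _ _ (Hdbl _ HM') Hc1 m.
have rm : 0 < rho ^+ m by exact: exprn_gt0.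
rewrite -ler_pdivlMr // => /le_trans; apply.
have := Hm1 m (leq_trans (leq_maxr _ _) (ltnW mm)).
move=> /(ler_wpM2r A0); rewrite mul1r; apply: le_trans.
rewrite /x exprVn; move: (_^-1) => z; rewrite le_eqVlt; apply/orP; left; apply/eqP; ring.
Qed.

(** The root polynomial contributes at most N' / d to g'/g at 0. For u'/u, [log_deriv_bound] asks
    for an upper bound B of |u| and one point w where |u| is not much smaller than B. *)
Lemma log_deriv_core (rr beta C d : R) (N N' : nat) : 1 < beta -> beta < rr -> 0 < C -> 0 < d ->
  exists P, forall g (g' : R[i]) (c : nat -> R[i]) s u (A : R) k, papprox 0 rr g -> has_coef rr g c ->
    cderiv g 0 g' ->
    all (fun a => cabs a <= beta) s -> (size s <= N')%N -> factors rr g s u ->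
    (forall t, cabs t <= beta -> u t != 0) ->
    (forall a, a \in s -> d <= cabs a) ->
    0 < A -> (k <= N)%N -> A <= cabs (c k) ->
    (forall t, cabs t <= rr -> cabs (g t) <= C * A) ->
    cabs (g' / g 0) <= P.
Proof.
move=> b1 br C0 d0.
(* On |t| = rr every zero is at distance at least rr - beta; with e <= 1 the power e^N' bounds the
   root polynomial from below even if there are fewer than N' zeros. *)
pose e := Num.min 1 (rr - beta).
have e0 : 0 < e by rewrite lt_min ltr01 subr_gt0.
have e1 : e <= 1 by rewrite ge_min lexx.
have b20 : 0 < 2 * beta by lra.
(* The quotient of the lower bound for |u w| and the upper bound [B]; A cancels. *)
pose c1 := (2^-1 ^+ N / 2 / (2 * beta) ^+ N') / (C / e ^+ N').
have c10 : 0 < c1.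
  by rewrite /c1 !(divr_gt0, invr_gt0, exprn_gt0).
(* [log_deriv_bound] is applied with sg = 1/2, the radius of the disc containing w, and rho + sg =
   beta is the radius on which u has no zeros. *)
pose rho := beta - 2^-1.
exists (N'%:R / d + 2 / rho * (expR (2 * 2^-1 / rho) * ln (2 / c1))).
move=> g g' c s u A k Hg Hc Hg' Hs sN Hf u0 Hd A0 kN Ak HB.
have [Hu Hgu] := Hf; have rr0 : 0 < rr by lra.
have [u' Hu'] := papprox_derivative _ _ Hu.
pose B := C * A / e ^+ N'.
have HuB t : cabs t <= rr -> cabs (u t) <= B.
  apply: (papprox_max _ rr u) => // {}t tr.
  have trr : cabs t <= rr by rewrite tr.
  have := HB t trr; rewrite Hgu // cabsM => H.
  have Pl : e ^+ N' <= cabs (root_poly s).[t].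
    apply: root_poly_ge => //; last by rewrite (ltW e0).
    move=> a /(allP Hs) /= ab; apply: (@le_trans _ _ (rr - beta)).
      by rewrite ge_min lexx orbT.
    by have := cabs_lower _ t a; lra.
  rewrite /B ler_pdivlMr ?exprn_gt0 //; apply: le_trans H.
  by rewrite mulrC ler_wpM2r ?cabs_ge0.
have h0 : (0 : R) < 2^-1 by rewrite invr_gt0.
(* Otherwise Cauchy's estimate on |t| <= 1/2 would contradict A <= |c k| with k <= N. *)
have [w [w2 Hw]] : exists w, cabs w <= 2^-1 /\ A * (2^-1 ^+ N / 2) <= cabs (g w).
  apply: contrapT => Hn.
  have Hall t : cabs t <= 2^-1 -> cabs (g t) <= A * (2^-1 ^+ N / 2).
    move=> t2; rewrite leNgt; apply/negP => /ltW h; apply: Hn; by exists t.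
  have hr : 0 < (2^-1 : R) <= rr by lra.
  have := has_coef_bound _ _ _ _ _ Hall (has_coef_restr _ _ _ _ _ hr Hg Hc) k.
  apply/negP; rewrite -ltNge.
  have hN : (0 : R) < 2^-1 ^+ N by rewrite exprn_gt0.
  apply: (@lt_le_trans _ _ (A * 2^-1 ^+ N)).
    by rewrite ltr_pM2l //; lra.
  apply: ler_pM; rewrite ?(ltW A0) ?(ltW hN) //.
  by apply: ler_wiXn2l => //; lra.
have b0 : cabs (0 : R[i]) <= beta by rewrite cabs0; lra.
have wb : cabs w <= beta by lra.
have Huw : c1 * B <= cabs (u w).
  have -> : c1 * B = A * (2^-1 ^+ N / 2) / (2 * beta) ^+ N'.
    have eN : e ^+ N' != 0 by rewrite gt_eqF // exprn_gt0.
    have bN : (2 * beta) ^+ N' != 0 by rewrite gt_eqF // exprn_gt0.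
    rewrite /c1 /B; move: (e ^+ N') ((2 * beta) ^+ N') (2^-1 ^+ N) eN bN => x y z x0 y0.
    by field; rewrite x0 y0 gt_eqF.
  rewrite ler_pdivrMr ?exprn_gt0 //; apply: le_trans Hw _.
  rewrite Hgu; last by lra.
  rewrite cabsM mulrC ler_wpM2l ?cabs_ge0 //.
  have -> : 2 * beta = beta + beta by ring.
  by apply: root_poly_le => //; lra.
have P0 : (root_poly s).[0] != 0.
  rewrite root_polyE prodf_seq_neq0; apply/allP => a /= /Hd h.
  by rewrite sub0r oppr_eq0 -cabs_gt0; apply: lt_le_trans h.
have z0 : cabs (0 : R[i]) < rr by rewrite cabs0.
rewrite (factor_logderiv _ _ _ _ _ _ _ Hf z0 Hg' (Hu' 0 z0) P0 (u0 0 b0)).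
apply: le_trans (cabsD _ _ _) _; apply: lerD.
  by apply: root_poly_logderiv => // a /Hd; rewrite sub0r cabsN.
apply: (log_deriv_bound _ u u' rr rho 2^-1 B c1 w) => //; rewrite /rho; try lra.
- by move=> t tb; apply: Hu'; lra.
- by move=> t tb; apply: u0; lra.
- by move=> t tb; apply: HuB; lra.
Qed.
End Core.

(** * Local polynomial approximation in several variables *)

Section SeveralVariables.
Variables (R : realType) (n : nat).
Local Notation V := ('rV[R[i]]_n).
Implicit Types (F G p : V -> R[i]) (z w v b : V) (t : R[i]) (d e r : R).

(** Only two facts about polynomials in several variables are used, both by induction: they restrict
    to polynomials on lines, and their gradients are of the same kind. *)
Inductive polyfun : (V -> R[i]) -> Prop :=
| polyfun_cst c : polyfun (fun=> c)
| polyfun_coord j : polyfun (fun z => z 0 j)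
| polyfunD p q : polyfun p -> polyfun q -> polyfun (fun z => p z + q z)
| polyfunM p q : polyfun p -> polyfun q -> polyfun (fun z => p z * q z).

Lemma polyfun_sum (I : Type) (s : seq I) (P : pred I) (f : I -> V -> R[i]) :
  (forall i, polyfun (f i)) -> polyfun (fun z => \sum_(i <- s | P i) f i z).
Proof.
move=> Hf; elim: s => [|i s IH].
  rewrite (_ : (fun _ => _) = fun=> 0); first exact: polyfun_cst.
  by apply/funext => z; rewrite big_nil.
rewrite (_ : (fun _ => _) = fun z => (if P i then f i z else 0) + \sum_(j <- s | P j) f j z).
  apply: polyfunD => //; case: (P i) => //; exact: polyfun_cst.
by apply/funext => z; rewrite big_cons; case: (P i); rewrite ?add0r.
Qed.

Lemma polyfun_prod (I : Type) (s : seq I) (f : I -> V -> R[i]) :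
  (forall i, polyfun (f i)) -> polyfun (fun z => \prod_(i <- s) f i z).
Proof.
move=> Hf; elim: s => [|i s IH].
  rewrite (_ : (fun _ => _) = fun=> 1); first exact: polyfun_cst.
  by apply/funext => z; rewrite big_nil.
rewrite (_ : (fun _ => _) = fun z => f i z * \prod_(j <- s) f j z).
  exact: polyfunM.
by apply/funext => z; rewrite big_cons.
Qed.

Lemma polyfunX p k : polyfun p -> polyfun (fun z => p z ^+ k).
Proof.
move=> Hp; elim: k => [|k IH].
  exact: (polyfun_cst 1).
by rewrite (_ : (fun _ => _) = fun z => p z * p z ^+ k); first exact: polyfunM;
   apply/funext => z; rewrite exprS.
Qed.

(** One family [dp] serves all points and directions. This linearity in v is what uniform limits
    inherit in [locally_poly_dir_deriv]. *)
Lemma polyfun_grad p : polyfun p -> exists dp : 'I_n -> V -> R[i],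
  (forall j, polyfun (dp j)) /\
  forall z v, exists q : {poly R[i]}, (forall t, p (z + t *: v) = q.[t]) /\
    q^`().[0] = \sum_(j < n) v 0 j * dp j z.
Proof.
elim=> {p} [c|j|p q Hp [dp [Hdp Ep]] Hq [dq [Hdq Eq]]|p q Hp [dp [Hdp Ep]] Hq [dq [Hdq Eq]]].
- exists (fun _ _ => 0); split=> [j|z v]; first exact: polyfun_cst.
  exists c%:P; split=> [t|]; first by rewrite hornerC.
  by rewrite derivC horner0 big1 // => j _; rewrite mulr0.
- exists (fun i _ => (i == j)%:R); split=> [i|z v]; first exact: polyfun_cst.
  exists ((z 0 j)%:P + v 0 j *: 'X); split=> [t|].
    by rewrite !mxE !hornerE mulrC.
  rewrite derivD derivC derivZ derivX !hornerE (bigD1 j) //= eqxx mulr1 big1 ?addr0 //.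
  by move=> i /negPf ->; rewrite mulr0.
- exists (fun j z => dp j z + dq j z); split=> [j|z v]; first exact: polyfunD.
  have [P [HP DP]] := Ep z v; have [Q [HQ DQ]] := Eq z v.
  exists (P + Q); split=> [t|]; first by rewrite hornerD HP HQ.
  rewrite derivD hornerD DP DQ -big_split /=.
  by apply: eq_bigr => j _; rewrite mulrDr.
- exists (fun j z => dp j z * q z + p z * dq j z); split=> [j|z v].
    by apply: polyfunD; apply: polyfunM.
  have [P [HP DP]] := Ep z v; have [Q [HQ DQ]] := Eq z v.
  exists (P * Q); split=> [t|]; first by rewrite hornerM HP HQ.
  have := HP 0; have := HQ 0; rewrite scale0r addr0 => q0 p0.
  rewrite derivM hornerD !hornerM DP DQ -q0 -p0 mulr_suml mulr_sumr -big_split /=.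
  by apply: eq_bigr => j _; ring.
Qed.

Definition polydisc z0 d : set V := [set z | forall j, cabs (z 0 j - z0 0 j) <= d].

(* Unlike power series, local uniform limits of polynomials pass to
   derivatives and to lines without any reindexing. *)
Definition poly_approx_near F z0 d : Prop := 0 < d /\
  forall e, 0 < e -> exists2 p, polyfun p &
    forall z, polydisc z0 d z -> cabs (F z - p z) <= e.

Definition locally_poly F z0 : Prop := exists d, poly_approx_near F z0 d.

Lemma poly_approx_near_sub F z0 d z : poly_approx_near F z0 d ->
  polydisc z0 (d / 2) z -> poly_approx_near F z (d / 2).
Proof.
move=> [d0 HF] Hz; split; first by rewrite divr_gt0.
move=> e /HF[p Hp Hpe]; exists p => // w Hw; apply: Hpe => j.
by apply: le_trans (cabs_tri _ (z 0 j) _ _) _; have := Hz j; have := Hw j; lra.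
Qed.

(** The sum dominates every coordinate of v, and the added 1 keeps the radius meaningful for v =
    0. *)
Definition line_radius v d : R := d / (1 + \sum_(j < n) cabs (v 0 j)).

Lemma line_radius_gt0 v d : 0 < d -> 0 < line_radius v d.
Proof. by move=> d0; rewrite divr_gt0 // ltr_pwDl // sumr_ge0 // => j _; exact: cabs_ge0. Qed.

Lemma line_polydisc v d z t : 0 < d -> cabs t <= line_radius v d -> polydisc z d (z + t *: v).
Proof.
move=> d0; have s0 : 0 < 1 + \sum_(j < n) cabs (v 0 j).
  by rewrite ltr_pwDl // sumr_ge0 // => j _; exact: cabs_ge0.
rewrite /line_radius ler_pdivlMr // => H j; rewrite !mxE.
have -> : z 0 j + t * v 0 j - z 0 j = t * v 0 j by ring.
rewrite cabsM.
apply: le_trans H; rewrite ler_wpM2l ?cabs_ge0 // (bigD1 j) //= addrA [1 + _]addrC -addrA lerDl.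
by rewrite addr_ge0 // sumr_ge0 // => k _; exact: cabs_ge0.
Qed.

Lemma line_papprox F z d v : poly_approx_near F z d ->
  papprox 0 (line_radius v d) (fun t => F (z + t *: v)).
Proof.
move=> [d0 HF] e /HF[p Hp Hpe]; have [dp [_ Hdp]] := polyfun_grad p Hp.
have [q [Hq _]] := Hdp z v; exists q => t; rewrite subr0 => /(line_polydisc _ _ z _ d0) Ht.
by rewrite -Hq Hpe.
Qed.

Lemma cderiv_derive F z v c : cderiv (fun t => F (z + t *: v)) 0 c -> 'D_v F z = c.
Proof.
move=> H; apply: cvg_lim => //; apply/cvgrPdist_le => -[e e'] /= e0.
have : 0 < (e +i* e')%C := e0; rewrite ltcE /= => /andP[/eqP e'0 {}e0].
have [h h0 Hh] := H e e0; exists h%:C%C => /=; first by rewrite ltcR.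
move=> t; rewrite /ball /= sub0r normrN normr_cabs ltcR => th t0.
have := Hh t (ltW th); rewrite add0r scale0r addr0 => Ht.
rewrite normr_cabs /shift /= e'0 lecR.
have t1 : 0 < cabs t by rewrite cabs_gt0.
rewrite -(ler_pM2r t1) -cabsM; apply: le_trans Ht.
rewrite le_eqVlt; apply/orP; left; apply/eqP; rewrite cabs_distC [t *: v + z]addrC.
by congr cabs; rewrite -[_ *: (F _ - _)]/(t^-1 * (F _ - _)); field.
Qed.

Lemma cderiv_approx F z d v p dp c e : poly_approx_near F z d ->
  (forall w, polydisc z d w -> cabs (F w - p w) <= e) ->
  (forall z v, exists q : {poly R[i]}, (forall t, p (z + t *: v) = q.[t]) /\
    q^`().[0] = \sum_(j < n) v 0 j * dp j z) ->
  cderiv (fun t => F (z + t *: v)) 0 c ->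
  cabs (c - \sum_(j < n) v 0 j * dp j z) * line_radius v d <= e.
Proof.
move=> HF Hp Hdp Hc; have [d0 _] := HF; have [q [Hq <-]] := Hdp z v.
have r0 := line_radius_gt0 v d d0.
have z0 : cabs (0 - 0 : R[i]) < line_radius v d by rewrite subr0 cabs0.
have [c' Hc' /(_ q e)] := papprox_cderiv _ _ _ _ _ z0 (line_papprox F z d v HF).
rewrite (cderiv_unique _ _ _ _ _ Hc Hc') subr0 cabs0 subr0; apply.
move=> t; rewrite subr0 => /(line_polydisc _ _ z _ d0) Ht; by rewrite -Hq Hp.
Qed.

Lemma locally_poly_derive F z v : locally_poly F z ->
  cderiv (fun t => F (z + t *: v)) 0 ('D_v F z).
Proof.
move=> [d HF]; have [d0 _] := HF; have r0 := line_radius_gt0 v d d0.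
have z0 : cabs (0 - 0 : R[i]) < line_radius v d by rewrite subr0 cabs0.
have [c Hc _] := papprox_cderiv _ _ _ _ _ z0 (line_papprox F z d v HF).
by rewrite (cderiv_derive _ _ _ _ Hc).
Qed.

(** Each derivative of F at z, along b or along a coordinate, is within a multiple of e of that of
    an approximating polynomial, for which the derivative is linear in the direction. *)
Lemma locally_poly_dir_deriv F z b : locally_poly F z ->
  'D_b F z = dir_deriv b F z.
Proof.
move=> HF; have [d HFd] := HF; have [d0 Happ] := HFd.
apply/eqP; rewrite -subr_eq0 -cabs_eq0 eq_le cabs_ge0 andbT.
pose ej (j : 'I_n) : V := delta_mx 0 j.
pose B := (line_radius b d)^-1 + \sum_(j < n) (line_radius (ej j) d)^-1 * cabs (b 0 j).
have rinv v : 0 <= (line_radius v d)^-1 by rewrite invr_ge0 ltW // line_radius_gt0.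
apply: (le_eps_mul _ _ _ B).
  by rewrite addr_ge0 // sumr_ge0 // => j _; rewrite mulr_ge0 ?cabs_ge0.
move=> e e0; rewrite add0r; have [p Hp Hpe] := Happ e e0.
have [dp [_ Hdp]] := polyfun_grad p Hp.
have K v : cabs ('D_v F z - \sum_(j < n) v 0 j * dp j z) <= e * (line_radius v d)^-1.
  rewrite ler_pdivlMr ?line_radius_gt0 //.
  exact: cderiv_approx HFd Hpe Hdp (locally_poly_derive F z v HF).
have Kj j : cabs ('D_(ej j) F z - dp j z) <= e * (line_radius (ej j) d)^-1.
  have := K (ej j); rewrite (bigD1 j) //= big1 ?addr0.
    by rewrite /ej mxE !eqxx mul1r.
  by move=> i ij; rewrite /ej mxE eqxx (negPf ij) mul0r.
apply: le_trans (cabs_tri _ (\sum_(j < n) b 0 j * dp j z) _ _) _.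
rewrite mulrDr lerD ?K // cabs_distC /dir_deriv -sumrB mulr_sumr.
apply: le_trans (cabs_sum _ _ _ _ _) _; apply: ler_sum => j _.
by rewrite [b 0 j * _]mulrC -mulrBl cabsM mulrA ler_wpM2r ?cabs_ge0 ?Kj.
Qed.

Lemma locally_poly_dir_derivE F z b : locally_poly F z ->
  cderiv (fun t => F (z + t *: b)) 0 (dir_deriv b F z).
Proof.
by move=> HF; rewrite -locally_poly_dir_deriv //; exact: locally_poly_derive.
Qed.

(** Cauchy's estimate on lines through the points of half the polydisc shows that derivatives of the
    approximants approximate the derivative there. *)
Lemma locally_poly_dir F z0 b : locally_poly F z0 -> locally_poly (dir_deriv b F) z0.
Proof.
move=> [d HF]; have [d0 Happ] := HF; exists (d / 2); split; first by rewrite divr_gt0.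
have d2 : 0 < d / 2 by rewrite divr_gt0.
have r0 := line_radius_gt0 b _ d2.
move=> e e0; have [p Hp Hpe] := Happ _ (mulr_gt0 e0 r0).
have [dp [Hdp Edp]] := polyfun_grad p Hp.
exists (fun z => \sum_(j < n) b 0 j * dp j z).
  by apply: polyfun_sum => j; apply: polyfunM => //; exact: polyfun_cst.
move=> z Hz; have HFz := poly_approx_near_sub F z0 d z HF Hz.
have L : locally_poly F z by exists (d / 2).
rewrite -(ler_pM2r r0).
apply: (cderiv_approx F z (d / 2) b p dp _ _ HFz _ Edp (locally_poly_dir_derivE F z b L)).
move=> w Hw; apply: Hpe => j.
by apply: le_trans (cabs_tri _ (z 0 j) _ _) _; have := Hz j; have := Hw j; lra.
Qed.

Lemma locally_poly_dirn F z b k : locally_poly F z -> locally_poly (dir_derivn b k F) z.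
Proof. by move=> HF; elim: k => [//|k IH]; rewrite /dir_derivn iterS; exact: locally_poly_dir. Qed.

End SeveralVariables.

(** * From unconditional power series to polynomial approximation *)

Section PowerSeries.
Variables (R : realType) (n : nat).
Local Notation V := ('rV[R[i]]_n).
Local Notation K := {ffun 'I_n -> nat}.
Implicit Types (F : V -> R[i]) (z w : V) (S T : {fset K}) (d e : R).

Lemma near_polydisc z0 (P : V -> Prop) : (\forall z \near z0, P z) ->
  exists2 d : R, 0 < d & forall z, polydisc R n z0 d z -> P z.
Proof.
move=> /nbhs_ballP[[e e'] /= e0 He].
(* Positivity in R[i] includes a zero imaginary part, so the radius is the real number e. *)
have := e0 : 0 < (e +i* e')%C; rewrite ltcE /= => /andP[/eqP e'0 e1].
exists (e / 2); first by rewrite divr_gt0.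
move=> z Hz; apply: He; split=> // i j; rewrite ord1 /ball /= normr_cabs e'0 ltcR.
by rewrite cabs_distC; apply: le_lt_trans (Hz j) _; rewrite ltr_pdivrMr // ltr_pMr // ltr1n.
Qed.

Lemma summability_cvg (f : K -> R[i]) l :
  summability.partial_sum f @ summability.totally --> l ->
  forall e, 0 < e -> exists S, forall T, (S `<=` T)%fset ->
    cabs (\sum_(k <- T) f k - l) <= e.
Proof.
move=> Hc e e0; have FF := @summability.totally_filter K.
have H := iffLR (@cvgrPdist_le _ _ _ _ FF (summability.partial_sum f) l) Hc.
have /H[S _ HS] : 0 < e%:C%C by rewrite ltcR.
exists S => T ST; have := HS T ST; rewrite /= normr_cabs lecR cabs_distC.
by rewrite /summability.partial_sum -(big_seq_fsetE _ T xpredT f).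
Qed.

Lemma sum_fsubset (W : nmodType) (f : K -> W) T S : (T `<=` S)%fset ->
  \sum_(k <- S) f k = \sum_(k <- T) f k + \sum_(k <- S | k \notin T) f k.
Proof.
move=> TS; rewrite (bigID (fun k => k \in T)) /=; congr (_ + _).
rewrite -big_filter; apply: perm_big; apply: uniq_perm.
- by rewrite filter_uniq ?fset_uniq.
- exact: fset_uniq.
- move=> k; rewrite mem_filter; case: (boolP (k \in T)) => //= kT.
  by move/fsubsetP: TS => /(_ k kT) ->.
Qed.

Definition box_seq N : seq K :=
  [seq [ffun j => nat_of_ord (f j)] | f : {ffun 'I_n -> 'I_N}].

(** Boxes are cofinal among finite sets of multi-indices ([box_exhaust]), and over a box the
    dominating series factors into one-variable geometric sums ([sum_box]). *)
Definition box N : {fset K} := [fset k in box_seq N]%fset.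

Lemma mem_box N k : (k \in box N) = [forall j, (k j < N)%N].
Proof.
rewrite inE /=; apply/mapP/forallP => [[f _ ->] j|H]; first by rewrite ffunE.
exists [ffun j => Ordinal (H j)]; first by rewrite mem_enum.
by apply/ffunP => j; rewrite !ffunE.
Qed.

Lemma box_subset N N' : (N <= N')%N -> (box N `<=` box N')%fset.
Proof.
move=> NN; apply/fsubsetP => k; rewrite !mem_box => /forallP H.
by apply/forallP => j; exact: leq_trans NN.
Qed.

Lemma box_exhaust S : exists N, (S `<=` box N)%fset.
Proof.
exists (\max_(k <- S) \max_j k j)%N.+1; apply/fsubsetP => k kS.
rewrite mem_box; apply/forallP => j; rewrite ltnS.
apply: leq_trans (leq_bigmax_seq (F := fun k : K => (\max_j k j)%N) k kS isT).
exact: (leq_bigmax (F := fun j => k j)).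
Qed.

Definition geo N : R := \sum_(i < N) 2^-1 ^+ i.

Lemma sum_box N : \sum_(k <- box N) \prod_(j < n) (2^-1 : R) ^+ k j = geo N ^+ n.
Proof.
have -> : \sum_(k <- box N) \prod_(j < n) (2^-1 : R) ^+ k j =
    \sum_(k <- box_seq N) \prod_(j < n) (2^-1 : R) ^+ k j.
  apply: perm_big; apply: uniq_perm; first exact: fset_uniq.
    rewrite map_inj_uniq ?enum_uniq // => f g /ffunP E; apply/ffunP => j; apply/val_inj.
    by have := E j; rewrite !ffunE.
  by move=> k; rewrite inE.
rewrite /box_seq big_map big_enum /=.
transitivity (\sum_(f : {ffun 'I_n -> 'I_N}) \prod_j (2^-1 : R) ^+ f j).
  by apply: eq_bigr => f _; apply: eq_bigr => j _; rewrite ffunE.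
rewrite -(bigA_distr_bigA (fun (_ : 'I_n) (i : 'I_N) => (2^-1 : R) ^+ i)) /=.
by rewrite prodr_const card_ord.
Qed.

Lemma geoE N : geo N = 2 - 2 * 2^-1 ^+ N.
Proof. by have := subrX1 (2^-1 : R) N; rewrite -/(geo N); lra. Qed.

Lemma pow_diff_le (x y : R) m : 0 <= y <= x -> x <= 2 ->
  x ^+ m - y ^+ m <= m%:R * 2 ^+ m * (x - y).
Proof.
move=> /andP[y0 yx] x2; elim: m => [|m IH]; first by rewrite !expr0 subrr !mul0r.
rewrite !exprS.
have -> : x * x ^+ m - y * y ^+ m = x * (x ^+ m - y ^+ m) + y ^+ m * (x - y) by ring.
have xy : 0 <= x - y by lra.
have ym : y ^+ m <= 2 ^+ m by rewrite lerXn2r ?nnegrE //; lra.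
have d0 : 0 <= x ^+ m - y ^+ m by rewrite subr_ge0 lerXn2r ?nnegrE //; lra.
have H1 : x * (x ^+ m - y ^+ m) <= 2 * (m%:R * 2 ^+ m * (x - y)).
  by apply: ler_pM => //; lra.
have H2 : y ^+ m * (x - y) <= 2 ^+ m * (x - y) by rewrite ler_wpM2r.
have H3 : 0 <= 2 ^+ m * (x - y) by rewrite mulr_ge0 ?exprn_ge0.
rewrite -natr1; have -> : (m%:R + 1) * (2 * 2 ^+ m) * (x - y) =
  2 * (m%:R * 2 ^+ m * (x - y)) + 2 * (2 ^+ m * (x - y)) by ring.
lra.
Qed.

Lemma geo_pow_cauchy M e : 0 <= M -> 0 < e -> exists N, forall N', (N <= N')%N ->
  M * (geo N' ^+ n - geo N ^+ n) <= e.
Proof.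
move=> M0 e0; have h1 : 0 <= (2^-1 : R) < 1 by lra.
have [N HN] := pow_small1 _ _ (M * (n%:R * 2 ^+ n * 2)) _ h1 e0.
exists N => N' NN.
have p0 k : 0 <= (2^-1 : R) ^+ k by rewrite exprn_ge0; lra.
have p1 : (2^-1 : R) ^+ N <= 1 by rewrite exprn_ile1 //; lra.
have p2 : (2^-1 : R) ^+ N' <= 2^-1 ^+ N by rewrite ler_wiXn2l //; lra.
have := @pow_diff_le (geo N') (geo N) n; rewrite !geoE => H.
apply: le_trans HN; rewrite -[leRHS]mulrA ler_wpM2l //.
apply: le_trans (H _ _) _; [| |].
- by have := p0 N'; lra.
- by have := p0 N'; lra.
- rewrite -[leRHS]mulrA ler_wpM2l ?mulr_ge0 ?exprn_ge0 //.
  by have := p0 N'; lra.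
Qed.

(* A convergent series has bounded terms: evaluated at the corner of a
   polydisc this bounds |a_k| d^|k|. *)
Lemma analytic_locally_poly F z0 : analytic_in_ball F -> unit_ball R n z0 ->
  locally_poly R n F z0.
Proof.
move=> HF Hz0; have [a Ha] := HF z0 Hz0.
have [d d0 Hd] := near_polydisc _ _ Ha.
pose corner : V := \row_j (z0 0 j + d%:C%C).
have Hcorner : polydisc R n z0 d corner.
  by move=> j; rewrite mxE addrC addKr cabs_real gtr0_norm.
have cm k : cabs (monomial k (corner - z0)) = \prod_(j < n) d ^+ k j.
  rewrite /monomial cabs_prod; apply: eq_bigr => j _.
  by rewrite !mxE [z0 0 j + _]addrC addrK cabsX cabs_real gtr0_norm.
have [M M0 HM] : exists2 M, 0 <= M & forall k, cabs (a k) * \prod_(j < n) d ^+ k j <= M.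
  (* Adding one index k outside S changes the partial sum by [f k], so |f k| <= 1/2 + 1/2; the
     finitely many k in S are covered by the sum. *)
  have [S HS] := summability_cvg _ _ (Hd _ Hcorner) 2^-1 (ltac:(rewrite invr_gt0; lra)).
  pose f k := a k * monomial k (corner - z0).
  exists (1 + \sum_(k <- S) cabs (f k)).
    by rewrite addr_ge0 // sumr_ge0 // => k _; exact: cabs_ge0.
  move=> k; rewrite -cm -cabsM -/(f k).
  have s0 : 0 <= \sum_(k <- S) cabs (f k) by rewrite sumr_ge0 // => i _; exact: cabs_ge0.
  have [kS|kS] := boolP (k \in S).
    rewrite (big_rem k) //= addrCA lerDl addr_ge0 // sumr_ge0 // => i _; exact: cabs_ge0.
  have := HS S (fsubset_refl S); have := HS (k |` S)%fset (fsubsetU1 k S).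
  rewrite big_fsetU1 //= -/(f k).
  set s := \sum_(i <- S) f i;
  move=> h1 h2; have -> : f k = (f k + s - F corner) - (s - F corner) by ring.
  by apply: le_trans (cabsB _ _ _) _; lra.
exists (d / 2); split; first by rewrite divr_gt0.
move=> e e0; have e2 : 0 < e / 2 by rewrite divr_gt0.
have [N HN] := geo_pow_cauchy _ _ M0 e2.
exists (fun z => \sum_(k <- box N) a k * \prod_(j < n) (z 0 j + - z0 0 j) ^+ k j).
  apply: polyfun_sum => k; apply: polyfunM; first exact: polyfun_cst.
  apply: polyfun_prod => j; apply: (polyfunX R n (fun z => z 0 j + - z0 0 j)); apply: polyfunD.
    exact: polyfun_coord.
  exact: polyfun_cst.
move=> z Hz; have Hzd : polydisc R n z0 d z.
  by move=> j; apply: le_trans (Hz j) _; lra.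
have [S HS] := summability_cvg _ _ (Hd _ Hzd) _ e2.
pose f k := a k * monomial k (z - z0).
have -> : \sum_(k <- box N) a k * \prod_(j < n) (z 0 j + - z0 0 j) ^+ k j = \sum_(k <- box N) f k.
  apply: eq_bigr => k _; congr (_ * _); rewrite /monomial; apply: eq_bigr => j _.
  by rewrite !mxE.
have Hf k : cabs (f k) <= M * \prod_(j < n) 2^-1 ^+ k j.
  rewrite /f cabsM /monomial cabs_prod.
  apply: (@le_trans _ _ (cabs (a k) * \prod_(j < n) (d / 2) ^+ k j)).
    rewrite ler_wpM2l ?cabs_ge0 //; apply: ler_prod => j _.
    rewrite cabs_ge0 /= cabsX lerXn2r ?nnegrE ?cabs_ge0 //; first lra.
    by rewrite !mxE; exact: Hz.
  under eq_bigr => j _ do rewrite exprMn.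
  rewrite big_split /= mulrA ler_wpM2r //.
  by apply: prodr_ge0 => j _; rewrite exprn_ge0 // invr_ge0.
set T := (S `|` box N)%fset.
have HT := HS T (fsubsetUl _ _).
rewrite (splitr e) cabs_distC.
apply: le_trans (cabs_tri _ (\sum_(k <- T) f k) _ _) _; apply: lerD; last exact: HT.
rewrite cabs_distC (sum_fsubset _ _ _ _ (fsubsetUr S (box N))) addrC addKr.
apply: le_trans (cabs_sum _ _ _ _ _) _.
(* The terms of T outside [box N] are dominated by the n-fold geometric series between [box N] and a
   larger box containing T. *)
have [N' HN'] := box_exhaust (T `|` box N)%fset.
have NN' : (box N `<=` box N')%fset by apply: fsubset_trans HN'; exact: fsubsetUr.
have TN' : (T `<=` box N')%fset by apply: fsubset_trans HN'; exact: fsubsetUl.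
pose N2 := maxn N N'.
have NN2 := box_subset _ _ (leq_maxl N N').
have TN2 : (T `<=` box N2)%fset by apply: fsubset_trans TN' _; exact: box_subset (leq_maxr _ _).
apply: le_trans (HN N2 (leq_maxl _ _)).
rewrite -!sum_box (sum_fsubset _ _ _ _ NN2) [X in X - _]addrC addrK mulr_sumr.
pose h k := M * \prod_(j < n) (2^-1 : R) ^+ k j.
have h0 k : 0 <= h k.
  by rewrite mulr_ge0 // prodr_ge0 // => j _; rewrite exprn_ge0 // invr_ge0.
apply: (@le_trans _ _ (\sum_(k <- T | k \notin box N) h k)).
  by apply: ler_sum => k _; exact: Hf.
rewrite big_mkcond [leRHS]big_mkcond /= (sum_fsubset _ (fun k => if k \notin box N then h k else 0) _ _ TN2).
by rewrite lerDl; apply: sumr_ge0 => k _; case: ifP.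
Qed.
End PowerSeries.

(** * The Euclidean norm and convexity of its balls *)

Section EuclideanNorm.
Variables (R : realType) (n : nat).
Local Notation V := ('rV[R[i]]_n).
Implicit Types (z w b : V) (t : R[i]).

Lemma cauchy_schwarz (a b : 'I_n -> R) :
  (\sum_j a j * b j) ^+ 2 <= (\sum_j a j ^+ 2) * (\sum_j b j ^+ 2).
Proof.
set A := \sum_j a j ^+ 2; set B := \sum_j b j ^+ 2; set C := \sum_j _.
have B0 : 0 <= B by apply: sumr_ge0 => j _; exact: sqr_ge0.
have : 0 <= \sum_j (B * a j - C * b j) ^+ 2 by apply: sumr_ge0 => j _; exact: sqr_ge0.
have -> : \sum_j (B * a j - C * b j) ^+ 2 = B * (A * B - C ^+ 2).
  have E (x y : R) : \sum_j (y * a j - x * b j) ^+ 2 = y ^+ 2 * A - 2 * y * x * C + x ^+ 2 * B.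
    by rewrite /A /B /C !mulr_sumr -sumrB -big_split /=; apply: eq_bigr => j _; ring.
  by rewrite E; ring.
move: B0; rewrite le_eqVlt => /orP[/eqP B0 _|B0].
  have b0 j : b j = 0.
    apply/eqP; rewrite -sqrf_eq0; have /eqP := esym B0.
    rewrite psumr_eq0 => [/allP/(_ j)|i _]; last exact: sqr_ge0.
    by rewrite mem_index_enum => /(_ isT).
  have -> : C = 0 by rewrite /C big1 // => j _; rewrite b0 mulr0.
  by rewrite -B0 mulr0 expr0n.
by rewrite pmulr_rge0 // subr_ge0.
Qed.

Lemma enorm_ge0 z : 0 <= enorm z.
Proof. exact: sqrtr_ge0. Qed.

Lemma enormZ t z : enorm (t *: z) = cabs t * enorm z.
Proof.
rewrite /enorm -[cabs t]ger0_norm ?cabs_ge0 // -sqrtr_sqr -sqrtrM ?sqr_ge0 //.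
congr Num.sqrt; rewrite mulr_sumr; apply: eq_bigr => j _.
by rewrite mxE cabsM exprMn.
Qed.

Lemma enormD z w : enorm (z + w) <= enorm z + enorm w.
Proof.
have s0 (x : V) : 0 <= \sum_(j < n) cabs (x 0 j) ^+ 2.
  by apply: sumr_ge0 => j _; exact: sqr_ge0.
rewrite -(@ler_pXn2r _ 2) ?nnegrE ?addr_ge0 ?enorm_ge0 // sqrrD /enorm !sqr_sqrtr //.
have CS := cauchy_schwarz (fun j => cabs (z 0 j)) (fun j => cabs (w 0 j)).
have H : \sum_(j < n) cabs (z 0 j) * cabs (w 0 j) <=
    Num.sqrt (\sum_(j < n) cabs (z 0 j) ^+ 2) * Num.sqrt (\sum_(j < n) cabs (w 0 j) ^+ 2).
  rewrite -(@ler_pXn2r _ 2) ?nnegrE ?mulr_ge0 ?sqrtr_ge0 //.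
    by rewrite exprMn !sqr_sqrtr.
  by apply: sumr_ge0 => j _; rewrite mulr_ge0 ?cabs_ge0.
apply: (@le_trans _ _ (\sum_(j < n) (cabs (z 0 j) + cabs (w 0 j)) ^+ 2)).
  apply: ler_sum => j _; rewrite mxE lerXn2r ?nnegrE ?cabs_ge0 ?addr_ge0 ?cabs_ge0 //.
  exact: cabsD.
under eq_bigr => j _ do rewrite sqrrD.
rewrite !big_split /= lerD2r lerD2l mulr2n.
by rewrite lerD.
Qed.

Lemma enorm_line b z t : enorm (z + t *: b) <= enorm z + cabs t * enorm b.
Proof. by rewrite -enormZ; exact: enormD. Qed.

Lemma enorm_convex z w (x : R) : 0 <= x <= 1 ->
  enorm (z + x%:C%C *: (w - z)) <= Num.max (enorm z) (enorm w).
Proof.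
move=> /andP[x0 x1].
have -> : z + x%:C%C *: (w - z) = (1 - x)%:C%C *: z + x%:C%C *: w.
  by apply/matrixP => i j; rewrite !mxE rmorphB rmorph1 /=; ring.
apply: le_trans (enormD _ _) _; rewrite !enormZ !cabs_real !ger0_norm ?subr_ge0 //.
set M := Num.max _ _.
have h1 : enorm z <= M by rewrite le_max lexx.
have h2 : enorm w <= M by rewrite le_max lexx orbT.
have x1' : 0 <= 1 - x by lra.
have := ler_wpM2l x1' h1; have := ler_wpM2l x0 h2; lra.
Qed.

End EuclideanNorm.

(** * Restrictions of F to complex lines *)

Section Slices.
Variables (R : realType) (n : nat) (b : 'rV[R[i]]_n) (F : 'rV[R[i]]_n -> R[i]).
Local Notation V := ('rV[R[i]]_n).
Local Notation ball := (unit_ball R n).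
Hypothesis Fpoly : forall z, ball z -> locally_poly R n F z.
Implicit Types (z y : V) (t w : R[i]) (r l : R) (k m : nat).
Local Notation Fk k := (dir_derivn b k F).

Lemma ball_line z r t : enorm z + r * enorm b < 1 -> cabs t <= r -> ball (z + t *: b).
Proof.
move=> h tr; apply: le_lt_trans h; apply: le_trans (enorm_line _ _ _ _ _) _.
by rewrite lerD2l ler_wpM2r ?enorm_ge0.
Qed.

Definition disc_in z r : Prop := forall t, cabs t <= r -> ball (z + t *: b).

Lemma disc_in_norm z r : enorm z + r * enorm b < 1 -> disc_in z r.
Proof. by move=> h t; exact: ball_line. Qed.

Lemma slice_papprox k z r : 0 < r -> disc_in z r ->
  papprox 0 r (fun t => Fk k (z + t *: b)).
Proof.
move=> r0 zr; apply: papprox_glue => // p pr.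
have [d Hd] := locally_poly_dirn _ _ _ _ b k (Fpoly _ (zr _ pr)).
have [d0 _] := Hd; exists (line_radius R n b d); first exact: line_radius_gt0.
have H := line_papprox _ _ _ _ _ b Hd.
have := papprox_unshift _ 0 _ (fun t => Fk k (z + t *: b)) p; rewrite addr0; apply.
by apply: papprox_ext H => t _; rewrite -addrA -scalerDl.
Qed.

Lemma slice_cderiv k z t : ball (z + t *: b) ->
  cderiv (fun t => Fk k (z + t *: b)) t (Fk k.+1 (z + t *: b)).
Proof.
move=> Hy; rewrite -[t in cderiv _ t]addr0; apply: cderiv_unshift.
have H := locally_poly_dir_derivE _ _ _ _ b (locally_poly_dirn _ _ _ _ b k (Fpoly _ Hy)).
apply: cderiv_ext H => [|s _]; first exact: ltr01.
by rewrite -addrA -scalerDl.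
Qed.

(** A whole sequence of successive derivatives is carried along, so that the induction on m can
    shift it and shrink the radius. *)
Lemma coef_chain (g : nat -> R[i] -> R[i]) r c m : 0 < r ->
  (forall k, papprox 0 r (g k)) ->
  (forall k t, cabs t < r -> cderiv (g k) t (g k.+1 t)) ->
  has_coef r (g 0%N) c -> c m *+ m`! = g m 0.
Proof.
elim: m g r c => [|m IH] g r c r0 Hg Hd Hc.
  by rewrite fact0 mulr1n (has_coef0 _ _ _ _ r0 (Hg 0%N) Hc).
have s0 : 0 < r / 2 < r by lra. have /andP[s1 s2] := s0.
have := IH (fun k => g k.+1) (r / 2) (fun k => c k.+1 *+ k.+1) s1.
rewrite -mulrnA -factS; apply.
- by move=> k; exact: papprox_le (ltW s2) (Hg k.+1).
- by move=> k t tr; apply: Hd; lra.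
- apply: has_coef_deriv s0 (Hg 0%N) Hc _ => t tr; apply: Hd; lra.
Qed.

(* The variable is rescaled so that the discs |t| <= r / L z become |w| <= r. *)
Definition nslice k z l w : R[i] := Fk k (z + (w / l%:C%C) *: b) / l%:C%C ^+ k.

Lemma cabs_div_real w l : 0 < l -> cabs (w / l%:C%C) = cabs w / l.
Proof. by move=> l0; rewrite cabsM cabsV cabs_real gtr0_norm. Qed.

Lemma nslice_papprox k z l r : 0 < l -> 0 < r -> disc_in z (r / l) ->
  papprox 0 r (nslice k z l).
Proof.
move=> l0 r0 h; have rl : 0 < r / l by exact: divr_gt0.
apply: papproxM; [exact: ltW| |exact: papprox_cst].
have := papprox_affine _ 0 (r / l) (fun t => Fk k (z + t *: b)) 0 (l%:C%C)^-1 0 r.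
move=> /(_ _ (slice_papprox k z _ rl h)) H.
apply: papprox_ext (H _) => t; first by rewrite add0r mulrC.
rewrite !subr0 add0r mulrC cabs_div_real // => tr.
by rewrite ler_wpM2r // invr_ge0 ltW.
Qed.

Lemma nslice_cderiv k z l w : 0 < l -> ball (z + (w / l%:C%C) *: b) ->
  cderiv (nslice k z l) w (nslice k.+1 z l w).
Proof.
move=> l0 Hy; have H := slice_cderiv k z _ Hy.
have lC : l%:C%C != 0 :> R[i] by rewrite -cabs_gt0 cabs_real gtr0_norm.
have lk : 0 < cabs (l%:C%C ^+ k.+1 : R[i]) by rewrite cabs_gt0 expf_neq0.
move=> e e0; have [h h0 Hh] := H (e * cabs (l%:C%C ^+ k.+1)) (mulr_gt0 e0 lk).
exists (h * l); first exact: mulr_gt0.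
move=> s; rewrite -ler_pdivrMr // -cabs_div_real // => /Hh.
rewrite -mulrDl /nslice => K.
have -> : Fk k (z + ((w + s) / l%:C%C) *: b) / l%:C%C ^+ k - Fk k (z + (w / l%:C%C) *: b) / l%:C%C ^+ k
   - Fk k.+1 (z + (w / l%:C%C) *: b) / l%:C%C ^+ k.+1 * s =
  (Fk k (z + ((w + s) / l%:C%C) *: b) - Fk k (z + (w / l%:C%C) *: b)
   - Fk k.+1 (z + (w / l%:C%C) *: b) * (s / l%:C%C)) / l%:C%C ^+ k.
  rewrite exprS invfM; move: (_ ^+ k)^-1 => y; ring.
rewrite cabsM cabsV ler_pdivrMr ?cabs_gt0 ?expf_neq0 //; apply: le_trans K _.
rewrite exprS cabsM cabs_div_real // cabs_real gtr0_norm //.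
rewrite le_eqVlt; apply/orP; left; apply/eqP; move: (cabs (_ ^+ k)) => y.
by field; rewrite gt_eqF.
Qed.

Lemma nslice_coef z l r c m : 0 < l -> 0 < r -> disc_in z (r / l) ->
  has_coef r (nslice 0 z l) c ->
  c m = Fk m z / (m`!%:R * l%:C%C ^+ m).
Proof.
move=> l0 r0 h Hc.
have E := coef_chain (fun k => nslice k z l) r c m r0 (fun k => nslice_papprox k z l r l0 r0 h).
have f0 : (m`!%:R : R[i]) != 0 by rewrite pnatr_eq0 -lt0n fact_gt0.
have lC : l%:C%C != 0 :> R[i] by rewrite -cabs_gt0 cabs_real gtr0_norm.
have {}E : c m *+ m`! = nslice m z l 0.
  apply: E => // k t tr; apply: nslice_cderiv => //; apply: h.
  by rewrite cabs_div_real // ler_wpM2r ?ltW // invr_gt0.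
apply: (mulfI f0); rewrite [LHS]mulr_natl E /nslice mul0r scale0r addr0.
have := expf_neq0 m lC; move: (l%:C%C ^+ m) (m`!%:R : R[i]) f0 => x y y0 x0.
by field; rewrite x0 y0.
Qed.

Lemma cderiv_derive1 (g : R[i] -> R[i]) t d : cderiv g t d -> derive1 g t = d.
Proof.
move=> H; apply: cvg_lim => //; apply/cvgrPdist_le => -[e e'] /= e0.
have := e0 : 0 < (e +i* e')%C; rewrite ltcE /= => /andP[/eqP e'0 e1].
have [h h0 Hh] := H e e1; exists h%:C%C => /=; first by rewrite ltcR.
move=> s; rewrite /= sub0r normrN normr_cabs ltcR => sh s0.
have := Hh s (ltW sh) => Hs.
rewrite normr_cabs e'0 lecR.
have s1 : 0 < cabs s by rewrite cabs_gt0.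
rewrite -(ler_pM2r s1) -cabsM; apply: le_trans Hs.
rewrite le_eqVlt; apply/orP; left; apply/eqP; rewrite cabs_distC [s + t]addrC.
by congr cabs; rewrite -[_ *: (g _ - _)]/(s^-1 * (g _ - _)); field.
Qed.

Lemma slice_dom_open z t : slice_dom b z t ->
  exists2 d : R, 0 < d & forall s, cabs (s - t) <= d -> slice_dom b z s.
Proof.
rewrite /slice_dom /= => ht; have b1 : 0 < enorm b + 1 by rewrite ltr_wpDl ?enorm_ge0.
have h0 : 0 < 1 - enorm (z + t *: b) by rewrite subr_gt0.
pose d := (1 - enorm (z + t *: b)) / (2 * (enorm b + 1)).
have d0 : 0 < d by rewrite divr_gt0 ?mulr_gt0.
exists d => // s hs.
have -> : z + s *: b = (z + t *: b) + (s - t) *: b by rewrite -addrA -scalerDl [t + _]addrC subrK.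
apply: (ball_line _ d) => //.
have : d * (enorm b + 1) = (1 - enorm (z + t *: b)) / 2 by rewrite /d; field; rewrite gt_eqF.
lra.
Qed.

Lemma slice_derive1n k z t : slice_dom b z t ->
  (slice_fun b F z)^`(k)%classic t = Fk k (z + t *: b).
Proof.
elim: k t => [//|k IH] t Ht; rewrite derive1nS.
apply: cderiv_derive1; have [d d0 Hd] := slice_dom_open _ _ Ht.
by apply: cderiv_ext d0 _ (slice_cderiv k z t Ht) => s /Hd /IH.
Qed.

Lemma zero_multP z t m : slice_dom b z t -> Fk m (z + t *: b) <> 0 ->
  (forall k, (k < m)%N -> Fk k (z + t *: b) = 0) -> zero_mult (slice_fun b F z) t = m.
Proof.
move=> Ht Hm Hlt; rewrite /zero_mult; case: xgetP => [m' _ [H1 H2]|/(_ m)].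
  rewrite slice_derive1n // in H1.
  have H3 k : (k < m')%N -> Fk k (z + t *: b) = 0.
    by move=> /H2; rewrite slice_derive1n.
  case: (ltngtP m m') => // h; first by case: Hm; exact: H3.
  by case: H1; exact: Hlt.
case; split; first by rewrite slice_derive1n.
by move=> k /Hlt; rewrite slice_derive1n.
Qed.

Lemma slice_vanishes_near y r : 0 < r -> disc_in y r ->
  (forall k, Fk k y = 0) -> forall t, cabs t < r -> F (y + t *: b) = 0.
Proof.
move=> r0 h H0 t tr; have Hp := slice_papprox 0 y r r0 h.
have [c Hc] := papprox_coef _ _ _ r0 Hp.
have c0 m : c m = 0.
  have := coef_chain (fun k t => Fk k (y + t *: b)) r c m r0
    (fun k => slice_papprox k y r r0 h) _ Hc.
  rewrite scale0r addr0 H0 => E; apply/eqP.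
  have /eqP := E (fun k t tr => slice_cderiv k y t (h _ (ltW tr))).
  by rewrite mulrn_eq0 (gtn_eqF (fact_gt0 m)).
have [M M0 HM] := papprox_bounded _ _ _ _ (ltW r0) Hp.
have HM' u : cabs u <= r -> cabs (F (y + u *: b)) <= M by move=> Hu; apply: HM; rewrite subr0.
apply/eqP; rewrite -cabs_eq0 eq_le cabs_ge0 andbT; apply/ler_addgt0Pr => e e0.
rewrite add0r.
have x1 : 0 <= cabs t / r < 1.
  by rewrite divr_ge0 ?cabs_ge0 ?(ltW r0) //= ltr_pdivrMr // mul1r.
have [N HN] := pow_small1 _ _ (M / (1 - cabs t / r)) _ x1 e0.
have := has_coef_taylor _ r _ c M N t r0 Hp Hc HM' tr.
rewrite big1 ?subr0 => [H|k _]; last by rewrite c0 mul0r.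
by apply: le_trans H _; rewrite mulrAC.
Qed.

(** Vanishing is propagated along the segment from t to t'. By [enorm_convex] its points have norm
    at most [nu], so discs of one radius d about all of them fit into the ball. *)
Lemma slice_identity z t : slice_dom b z t -> (forall k, Fk k (z + t *: b) = 0) ->
  slice_vanishes b F z.
Proof.
move=> Ht H0 t' Ht'; rewrite /slice_fun.
pose y := z + t *: b; pose tau := t' - t.
have Ey : z + t' *: b = y + tau *: b.
  by rewrite /y /tau -addrA -scalerDl [t + _]addrC subrK.
rewrite Ey; have Hy1 : ball (y + tau *: b) by rewrite -Ey.
have Hy0 : ball y by []; have {}H0 : forall k, Fk k y = 0 by [].
clear Ey; clearbody y tau.
pose nu := Num.max (enorm y) (enorm (y + tau *: b)).
have nu1 : nu < 1 by rewrite gt_max; apply/andP.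
have b1 : 0 < enorm b + 1 by rewrite ltr_wpDl ?enorm_ge0.
pose d := (1 - nu) / (2 * (enorm b + 1)).
have d0 : 0 < d by rewrite divr_gt0 ?mulr_gt0 // subr_gt0.
have dnu : nu + d * enorm b < 1.
  have : d * (enorm b + 1) = (1 - nu) / 2 by rewrite /d; field; rewrite gt_eqF.
  lra.
pose N := (Num.truncn (cabs tau / (d / 2))).+1.
have N0 : 0 < N%:R :> R by rewrite ltr0n.
have NR : (N%:R : R[i]) = (N%:R)%:C%C by rewrite rmorph_nat.
have tN : cabs (tau / N%:R) <= d / 2.
  have d2 : 0 < d / 2 by exact: divr_gt0.
  rewrite cabsM cabsV cabs_nat ler_pdivrMr // mulrC -ler_pdivrMr; last exact: d2.
  by apply/ltW/truncnS_gt.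
have step i : (i <= N)%N -> forall s, cabs s < d -> F (y + (i%:R * (tau / N%:R) + s) *: b) = 0.
  elim: i => [|i IH] iN s sd.
    rewrite mul0r add0r; apply: slice_vanishes_near d0 _ H0 _ sd; apply: disc_in_norm.
    by apply: le_lt_trans dnu; rewrite lerD2r le_max lexx.
  pose yi := y + (i.+1%:R * (tau / N%:R)) *: b.
  have Hyi : enorm yi + d * enorm b < 1.
    apply: le_lt_trans dnu; rewrite lerD2r.
    have := enorm_convex _ _ y (y + tau *: b) (i.+1%:R / N%:R).
    have -> : y + (i.+1%:R / N%:R)%:C%C *: (y + tau *: b - y) = yi.
      rewrite /yi [y + _ - y]addrC addKr scalerA; congr (y + _ *: b).
      by rewrite rmorphM fmorphV !rmorph_nat mulrAC mulrA.
    apply; apply/andP; split; first exact: divr_ge0.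
    rewrite ler_pdivrMr; last exact: N0.
    rewrite mul1r ler_nat; exact: iN.
  have -> : y + (i.+1%:R * (tau / N%:R) + s) *: b = yi + s *: b.
    by rewrite /yi -addrA -scalerDl.
  (* Consecutive centres are at most d / 2 apart, so the disc of radius d / 4 about the new centre
     lies in the previous disc, where F already vanishes. *)
  have d4 : 0 < d / 4 by rewrite divr_gt0.
  apply: (papprox_zero _ d (fun t => F (yi + t *: b)) _ d4 (slice_papprox 0 yi d d0 (disc_in_norm _ _ Hyi))) => // u ud.
  have -> : yi + u *: b = y + (i%:R * (tau / N%:R) + (tau / N%:R + u)) *: b.
    rewrite /yi -addrA -scalerDl; congr (y + _ *: b); rewrite -natr1; ring.
  apply: IH; first exact: ltnW.
  apply: le_lt_trans (cabsD _ _ _) _; apply: le_lt_trans (lerD tN ud) _; lra.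
have := step N (leqnn N) 0; rewrite cabs0 addr0 => /(_ d0).
by rewrite mulrCA divff ?mulr1 // NR -cabs_gt0 cabs_real gtr0_norm.
Qed.
End Slices.

(** * Comparability of L on discs, and a counting identity *)

Section ClassQ.
Variables (R : realType) (n : nat) (beta : R) (b : 'rV[R[i]]_n).
Variables (F : 'rV[R[i]]_n -> R[i]) (L : 'rV[R[i]]_n -> R).
Local Notation V := ('rV[R[i]]_n).
Local Notation ball := (unit_ball R n).
Implicit Types (z y : V) (t w : R[i]).

Lemma classQ_ratio : 0 <= beta -> classQ b beta L -> exists l1 l2 : R,
  [/\ 0 < l1, l1 <= 1, 1 <= l2 & forall z t, ball z -> cabs t <= beta / L z ->
     l1 * L z <= L (z + t *: b) <= l2 * L z].
Proof.
move=> b0 [_ L0 _ HQ]; have bb : 0 <= beta <= beta by rewrite b0 lexx.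
have [h1 h2 h3] := HQ beta bb.
have H z t : ball z -> cabs t <= beta / L z ->
    (lambda1 b L beta <= (L (z + t *: b) / L z)%:E <= lambda2 b L beta)%E.
  move=> Hz Ht; have M : L_ratios b L beta (L (z + t *: b) / L z)%:E.
    exists z, 0, t; rewrite /slice_dom /= scale0r addr0 subr0; by split.
  by apply/andP; split; [exact: ereal_inf_lbound|exact: ereal_sup_ubound].
have f1 : (lambda1 b L beta < +oo)%E by exact: le_lt_trans h2 h3.
have f2 : (0 < lambda2 b L beta)%E by exact: lt_le_trans h1 h2.
move: h1 h3 f1 f2 H; case: (lambda1 _ _ _) => [l1| |] // ; case: (lambda2 _ _ _) => [l2| |] //.
rewrite !lte_fin => h1 _ _ h4 H.
(* Cutting at 1 gives l1 <= 1 <= l2; in particular powers of 4 / l1 are increasing. *)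
exists (Num.min l1 1), (Num.max l2 1); split.
- by rewrite lt_min h1 ltr01.
- by rewrite ge_min lexx orbT.
- by rewrite le_max lexx orbT.
move=> z t Hz Ht; have Lz := L0 z Hz.
have := H z t Hz Ht; rewrite !lee_fin ler_pdivlMr // ler_pdivrMr // => /andP[H1 H2].
apply/andP; split.
  by apply: le_trans H1; rewrite ler_wpM2r ?(ltW Lz) // ge_min lexx.
by apply: le_trans H2 _; rewrite ler_wpM2r ?(ltW Lz) // le_max lexx.
Qed.

Lemma sum_count_uniq (T : eqType) (r s : seq T) : uniq r ->
  (\sum_(a <- r) count_mem a s = count (mem r) s)%N.
Proof.
move=> ur; elim: s => [|x s IH]; first by rewrite big1.
rewrite /= big_split /= IH; congr (_ + _)%N.
transitivity (count_mem x r); last by rewrite count_uniq_mem.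
rewrite -sum1_count [RHS]big_mkcond /=.
by apply: eq_bigr => a _; rewrite eq_sym; case: eqP.
Qed.
End ClassQ.

(** * Rescaled slices, zero counting and the sufficiency of the two conditions *)

Section Main.
Variables (R : realType) (n : nat) (beta : R) (b : 'rV[R[i]]_n).
Variables (F : 'rV[R[i]]_n -> R[i]) (L : 'rV[R[i]]_n -> R) (l1 l2 : R).
Local Notation V := ('rV[R[i]]_n).
Local Notation ball := (unit_ball R n).
Hypothesis beta1 : 1 < beta.
Hypothesis Fpoly : forall z, ball z -> locally_poly R n F z.
Hypothesis L0 : forall z, ball z -> 0 < L z.
Hypothesis Lball : forall z, ball z -> beta * enorm b / (1 - enorm z) < L z.
Hypothesis l10 : 0 < l1.
Hypothesis l11 : l1 <= 1.
Hypothesis l21 : 1 <= l2.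
Hypothesis Lratio : forall z t, ball z -> cabs t <= beta / L z ->
     l1 * L z <= L (z + t *: b) <= l2 * L z.
Implicit Types (z y : V) (t w a : R[i]) (s : seq R[i]) (u : R[i] -> R[i]).
Local Notation Fk k := (dir_derivn b k F).
Local Notation h z := (nslice R n b F 0 z (L z)).

Let l20 : 0 < l2. Proof. exact: lt_le_trans l21. Qed.
Let beta0 : 0 < beta. Proof. exact: lt_trans beta1. Qed.

Lemma disc_beta z : ball z -> disc_in R n b z (beta / L z).
Proof.
move=> Hz; apply: disc_in_norm; have Lz := L0 z Hz.
have z1 : 0 < 1 - enorm z by rewrite subr_gt0.
have := Lball z Hz; rewrite ltr_pdivrMr // => H.
by rewrite mulrAC -ltrBrDl ltr_pdivrMr // [ltRHS]mulrC.
Qed.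

(* A radius larger than beta on which slices are still defined, uniformly in
   the center. *)
Definition outer_radius : R := beta + (2 * l2)^-1.

Let rr_beta : beta < outer_radius. Proof. by rewrite /outer_radius ltrDl invr_gt0 mulr_gt0. Qed.
Let rr0 : 0 < outer_radius. Proof. exact: lt_trans rr_beta. Qed.

(** The excess of [outer_radius / L z] over [beta / L z] is 1 / (2 l2 L z), at most 1 / (2 L y) at
    the intermediate point y because L y <= l2 L z. Since 1/2 < beta, the second step is again
    inside a disc on which everything is known. *)
Lemma outer_radius_split z t : ball z -> cabs t <= outer_radius / L z ->
  exists t0, cabs t0 <= beta / L z /\ cabs (t - t0) <= (2 * L (z + t0 *: b))^-1.
Proof.
move=> Hz Ht; have Lz := L0 z Hz.
have bL : 0 < beta / L z by exact: divr_gt0.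
have [tb|tb] := leP (cabs t) (beta / L z).
  exists t; split=> //; rewrite subrr cabs0 invr_ge0 mulr_ge0 //.
  by apply/ltW/L0/disc_beta.
have t0 : 0 < cabs t by exact: lt_trans tb.
pose x := beta / L z / cabs t.
have x0 : 0 <= x by rewrite divr_ge0 ?cabs_ge0 // ltW.
have x1 : x <= 1 by rewrite ler_pdivrMr // mul1r ltW.
have ctx : cabs (x%:C%C * t) = beta / L z.
  by rewrite cabsM cabs_real ger0_norm // /x divfK // gt_eqF.
exists (x%:C%C * t); split; first by rewrite ctx.
have -> : t - x%:C%C * t = (1 - x)%:C%C * t by rewrite rmorphB rmorph1 /=; ring.
rewrite cabsM cabs_real ger0_norm ?subr_ge0 // mulrBl mul1r.
have -> : x * cabs t = beta / L z by rewrite /x divfK // gt_eqF.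
have ctx' : cabs (x%:C%C * t) <= beta / L z by rewrite ctx.
have /andP[_ H2] := Lratio _ _ Hz ctx'.
have Ly : 0 < L (z + (x%:C%C * t) *: b) by exact/L0/disc_beta.
apply: (@le_trans _ _ ((2 * (l2 * L z))^-1)).
  rewrite lerBlDl; apply: le_trans Ht _.
  rewrite /outer_radius mulrDl lerD2l !invfM le_eqVlt; apply/orP; left; apply/eqP.
  by rewrite mulrA.
by rewrite lef_pV2 ?posrE ?mulr_gt0 // ler_wpM2l.
Qed.

Lemma half_disc y t : ball y -> cabs t <= (2 * L y)^-1 -> cabs t <= beta / L y.
Proof.
move=> Hy Ht; have Ly := L0 y Hy; apply: le_trans Ht _.
rewrite invfM ler_wpM2r ?invr_ge0 ?(ltW Ly) //.
by apply: (@le_trans _ _ 1); [rewrite invf_le1 // ler1n|exact: ltW].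
Qed.

Lemma disc_outer_radius z : ball z -> disc_in R n b z (outer_radius / L z).
Proof.
move=> Hz t Ht; have [t0 [h1 h2]] := outer_radius_split z t Hz Ht.
have Hy := disc_beta z Hz t0 h1.
have := disc_beta _ Hy _ (half_disc _ _ Hy h2).
by rewrite -addrA -scalerDl [t0 + _]addrC subrK.
Qed.

Lemma nslice_outer_papprox k z : ball z -> papprox 0 outer_radius (nslice R n b F k z (L z)).
Proof.
by move=> Hz; apply: nslice_papprox => //; [exact: L0|exact: disc_outer_radius].
Qed.

Lemma nslice_outer_coef z : ball z -> exists2 c, has_coef outer_radius (h z) c &
  forall m, c m = Fk m z / (m`!%:R * (L z)%:C%C ^+ m).
Proof.
move=> Hz; have [c Hc] := papprox_coef _ _ _ rr0 (nslice_outer_papprox 0 z Hz); exists c => // m.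
by apply: (nslice_coef R n b F Fpoly z (L z) outer_radius); rewrite ?L0 //; exact: disc_outer_radius.
Qed.

Lemma cabs_coef z m : ball z ->
  cabs (Fk m z / (m`!%:R * (L z)%:C%C ^+ m)) = cabs (Fk m z) / (m`!%:R * L z ^+ m).
Proof.
by move=> Hz; rewrite !(cabsM, cabsV) cabs_nat cabsX cabs_real gtr0_norm ?L0.
Qed.

Definition maxcoef (N : nat) z : R :=
  \big[Num.max/0]_(k < N.+1) (cabs (Fk k z) / (k`!%:R * L z ^+ k)).

Lemma maxcoef_ge N z k : (k <= N)%N -> cabs (Fk k z) / (k`!%:R * L z ^+ k) <= maxcoef N z.
Proof.
move=> kN; have kN' : (k < N.+1)%N by [].
exact: (@le_bigmax _ _ _ _ (fun k : 'I_N.+1 => cabs (Fk k z) / (k`!%:R * L z ^+ k)) (Ordinal kN')).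
Qed.

Lemma maxcoef_attained N z : ball z -> exists2 k, (k <= N)%N &
  maxcoef N z = cabs (Fk k z) / (k`!%:R * L z ^+ k).
Proof.
move=> Hz; rewrite /maxcoef (@bigmax_eq_arg _ _ _ _ ord0) //.
  by set k := [arg max_(_ > _ | _) _]%O; exists k => //; rewrite -ltnS ltn_ord.
by move=> k _; rewrite divr_ge0 ?cabs_ge0 // mulr_ge0 // exprn_ge0 // ltW // L0.
Qed.

Lemma maxcoef_le N z A : 0 <= A ->
  (forall k, (k <= N)%N -> cabs (Fk k z) / (k`!%:R * L z ^+ k) <= A) -> maxcoef N z <= A.
Proof. by move=> A0 H; apply: bigmax_le => // k _; apply: H; rewrite -ltnS ltn_ord. Qed.

Lemma nonvanishing_deriv z0 t : slice_dom b z0 t -> ~ slice_vanishes b F z0 ->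
  exists m, Fk m (z0 + t *: b) <> 0.
Proof.
move=> Ht Hv; apply: contrapT => Hn; apply: Hv.
apply: (slice_identity R n b F Fpoly z0 t Ht) => k.
by apply: contrapT => hk; apply: Hn; exists k.
Qed.

Lemma vanishing_deriv z : ball z -> slice_vanishes b F z -> forall m, Fk m z = 0.
Proof.
move=> Hz Hv m; have [c Hc Ec] := nslice_outer_coef z Hz.
have h0 t : cabs t <= outer_radius -> h z t = 0.
  move=> tr; rewrite /nslice expr0 divr1; apply: Hv; apply: disc_outer_radius => //.
  by rewrite cabs_div_real ?L0 // ler_wpM2r // invr_ge0 ltW // L0.
have := has_coef_bound _ outer_radius (h z) c 0 _ Hc m.
rewrite pmulr_lle0 ?exprn_gt0 // => H.
have /eqP : cabs (c m) == 0.
  by rewrite eq_le cabs_ge0 andbT H // => t /h0 ->; rewrite cabs0.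
rewrite Ec cabs_coef // => /eqP; rewrite mulf_eq0 invr_eq0 mulf_eq0 expf_eq0.
rewrite (gt_eqF (L0 z Hz)) andbF orbF pnatr_eq0 (gtn_eqF (fact_gt0 m)) orbF cabs_eq0.
by move/eqP.
Qed.

Lemma shift_vanishes z0 t : slice_vanishes b F z0 -> slice_vanishes b F (z0 + t *: b).
Proof.
move=> Hv s; rewrite /slice_dom /slice_fun /= -addrA -scalerDl => Hs; exact: Hv.
Qed.

(** The inequality is for lists from which zeros may still be missing and bounds their length; the
    equality is for complete lists and bounds [zero_count]. *)
Lemma mult_count z0 t0 s u a : slice_dom b z0 t0 ->
  let z := z0 + t0 *: b in
  slice_dom b z0 a -> ~ slice_vanishes b F z0 -> factors outer_radius (h z) s u ->
  cabs (a - t0) <= beta / L z ->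
  let w := (a - t0) * (L z)%:C%C in
  (count_mem w s <= zero_mult (slice_fun b F z0) a)%N /\
  (u w != 0 -> zero_mult (slice_fun b F z0) a = count_mem w s).
Proof.
move=> Ht0 z Ha Hv Hf Hat w; have Hz : ball z by [].
have Lz := L0 z Hz.
have LC : (L z)%:C%C != 0 :> R[i] by rewrite -cabs_gt0 cabs_real gtr0_norm.
have wl : w / (L z)%:C%C = a - t0 by rewrite /w mulfK.
have wb : cabs w <= beta.
  by rewrite cabsM cabs_real gtr0_norm // -ler_pdivlMr.
have wr : cabs w < outer_radius by exact: le_lt_trans wb rr_beta.
have r'0 : 0 < outer_radius - cabs w by rewrite subr_gt0.
pose y := z0 + a *: b.
have Ey : z + (w / (L z)%:C%C) *: b = y.
  by rewrite wl /z /y -addrA -scalerDl [t0 + _]addrC subrK.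
have Ehy t : h z (w + t) = nslice R n b F 0 y (L z) t.
  by rewrite /nslice -Ey mulrDl scalerDl addrA.
have Hp : papprox 0 (outer_radius - cabs w) (fun t => h z (w + t)).
  apply: papprox_shift; apply: papprox_disc (nslice_outer_papprox 0 z Hz).
  by rewrite addr0 subr0; lra.
have [c Hc] := papprox_coef _ _ _ r'0 Hp.
have [Hlow Hcount] := coef_factor _ _ _ _ _ _ _ wr (nslice_outer_papprox 0 z Hz) Hf Hc.
have Hc' : has_coef (outer_radius - cabs w) (nslice R n b F 0 y (L z)) c.
  by move=> q e He; apply: Hc => t /He; rewrite -Ehy.
have Ec m : c m = Fk m y / (m`!%:R * (L z)%:C%C ^+ m).
  apply: (nslice_coef R n b F Fpoly y (L z) (outer_radius - cabs w)) => // t Ht.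
  have := disc_outer_radius z Hz (w / (L z)%:C%C + t); rewrite scalerDl addrA Ey; apply.
  apply: le_trans (cabsD _ _ _) _; rewrite cabs_div_real //.
  move: Ht; rewrite mulrBl; lra.
have c0 m : (c m == 0) = (Fk m y == 0).
  rewrite Ec mulf_eq0 invr_eq0 mulf_eq0 expf_eq0 (negPf LC) andbF orbF.
  by rewrite pnatr_eq0 (gtn_eqF (fact_gt0 m)) orbF.
have [m Hm] : exists m, Fk m y != 0.
  by have [m /eqP Hm] := nonvanishing_deriv z0 a Ha Hv; exists m.
have Hex : exists m, Fk m y != 0 by exists m.
have [m0 Hm0 Hmin] := ex_minnP Hex.
have Emult : zero_mult (slice_fun b F z0) a = m0.
  apply: (zero_multP R n b F Fpoly) => //; first exact/eqP.
  move=> k km; apply/eqP/negPn/negP => /Hmin; by rewrite leqNgt km.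
rewrite Emult; have le : (count_mem w s <= m0)%N.
  rewrite leqNgt; apply/negP => /Hlow /eqP; rewrite c0; exact/negP.
split=> // /Hcount; rewrite c0 => /Hmin ge.
by apply/eqP; rewrite eqn_leq ge.
Qed.

(** The distinct entries of s, rescaled, are zeros in the counted disc, and each is counted at least
    as often as it occurs in s. *)
Lemma factor_size z s u (N : nat) : ball z -> ~ slice_vanishes b F z ->
  all (fun a => cabs a <= beta) s -> factors outer_radius (h z) s u ->
  (zero_count b F (beta / L (z + 0 *: b))%R z 0%R <= N%:R%:E)%E -> (size s <= N)%N.
Proof.
move=> Hz Hv Hs Hf; have Lz := L0 z Hz.
have E0 : z + 0 *: b = z by rewrite scale0r addr0.
have Hz0 : slice_dom b z 0 by rewrite /slice_dom /= E0.
have LC : (L z)%:C%C != 0 :> R[i] by rewrite -cabs_gt0 cabs_real gtr0_norm.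
pose r := [seq a / (L z)%:C%C | a <- undup s].
have ur : uniq r.
  by rewrite map_inj_uniq ?undup_uniq // => x y; apply: mulIf; rewrite invr_eq0.
have Hr a : a \in r -> cabs (a - 0) <= beta / L z /\ a * (L z)%:C%C \in s.
  move=> /mapP[w]; rewrite mem_undup => ws ->; rewrite subr0 cabs_div_real // divfK //.
  by split=> //; rewrite ler_wpM2r ?invr_ge0 ?(ltW Lz) // (allP Hs _ ws).
have Hin a : a \in r -> slice_zeros b F z a /\ cabs (a - 0) <= beta / L (z + 0 *: b).
  move=> ar; have [h1 h2] := Hr a ar; rewrite E0; split=> //; split.
    by rewrite subr0 in h1; exact: disc_beta.
  have sr : cabs (a * (L z)%:C%C) <= outer_radius.
    by apply: (le_trans (allP Hs _ h2)); exact: ltW.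
  have := Hf.2 _ sr.
  by rewrite root_polyE (big_rem _ h2) /= subrr !mul0r /nslice mulfK // expr0 divr1.
move=> HN; rewrite -(ler_nat R) -lee_fin; apply: le_trans HN.
apply: esum_ge; exists [set` r].
  split; first exact: finite_seq.
  by move=> a /Hin.
rewrite -fsbig_seq //.
rewrite (eq_bigr (fun a => ((zero_mult (slice_fun b F z) a)%:R : R)%:E)) // sumEFin lee_fin.
rewrite -natr_sum ler_nat.
apply: (@leq_trans (\sum_(a <- r) count_mem (a * (L z)%:C%C)%R s)%N).
  rewrite big_map (eq_bigr (fun a => count_mem a s)).
    rewrite sum_count_uniq ?undup_uniq //.
    have : all (mem (undup s)) s by apply/allP => a; rewrite /= mem_undup.
    by rewrite all_count => /eqP ->.
  by move=> a _; rewrite divfK.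
rewrite big_seq [leqRHS]big_seq; apply: leq_sum => a ar.
have [h1 h2] := Hr a ar; have [[h3 _] _] := Hin a ar.
have := mult_count z 0 s u a Hz0; rewrite E0 => /(_ h3 Hv Hf h1) [+ _].
by rewrite subr0.
Qed.

(** [esum] is a supremum over finite sets of zeros; on each of them the multiplicities are numbers
    of occurrences in s and add up to at most its length. *)
Lemma zero_count_le z0 t0 s u (rho : R) : slice_dom b z0 t0 -> ~ slice_vanishes b F z0 ->
  let z := z0 + t0 *: b in
  factors outer_radius (h z) s u ->
  (forall w, cabs w <= beta -> u w != 0) -> rho <= beta / L z ->
  (zero_count b F rho z0 t0 <= (size s)%:R%:E)%E.
Proof.
move=> Ht0 Hv z Hf u0 rb; have Hz : ball z by []; have Lz := L0 z Hz.
have LC : (L z)%:C%C != 0 :> R[i] by rewrite -cabs_gt0 cabs_real gtr0_norm.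
apply: ge_ereal_sup => _ [A [finA HA] <-].
rewrite fsbig_finite //=.
rewrite (eq_bigr (fun a => ((zero_mult (slice_fun b F z0) a)%:R : R)%:E)) // sumEFin lee_fin.
rewrite -natr_sum ler_nat.
have Em a : a \in fset_set A ->
    zero_mult (slice_fun b F z0) a = count_mem ((a - t0) * (L z)%:C%C) s.
  rewrite in_fset_set // inE => /HA[[h1 _] h2].
  have h3 : cabs (a - t0) <= beta / L z by exact: le_trans rb.
  have [_ ->] := mult_count z0 t0 s u a Ht0 h1 Hv Hf h3; first by [].
  apply: u0; rewrite cabsM cabs_real gtr0_norm //.
  by rewrite -ler_pdivlMr.
rewrite big_seq (eq_bigr _ Em) -big_seq.
rewrite -(big_map (fun a => (a - t0) * (L z)%:C%C) xpredT (fun w => count_mem w s)).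
rewrite sum_count_uniq ?count_size // map_inj_uniq ?fset_uniq //.
by move=> x y /(mulIf LC) /addIr.
Qed.

Lemma zero_in_Gset (r : R) z t : 0 <= r -> ball z -> ball (z + t *: b) ->
  F (z + t *: b) = 0 -> ~ slice_vanishes b F z ->
  forall t', cabs (t' - t) <= r / L (z + t *: b) -> Gset b L F r (z + t' *: b).
Proof.
move=> r0 Hz Ht Ft Hv t' Htt; exists z => //; rewrite /Gset_at.
have Hzero : slice_zeros b F z t by split.
case: asboolP => [E|_]; first by move: Hzero; rewrite E.
case: asboolP => // _; exists t => //; by exists t'.
Qed.

(** The base point z0 behind membership may differ from z, but both parametrize the same line, and a
    translation of the parameter moves the zero to the slice of z. *)
Lemma Gset_zero (r : R) z t : ball z -> ball (z + t *: b) -> ~ slice_vanishes b F z ->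
  Gset b L F r (z + t *: b) -> exists a, [/\ ball (z + a *: b), F (z + a *: b) = 0 &
    cabs (t - a) <= r / L (z + a *: b)].
Proof.
move=> Hz Hzt Hv [z0 Hz0]; rewrite /Gset_at; case: asboolP => // _.
case: asboolP => [Hv0 [t' _ E]|_ [a0 [Ha0 Fa0] [t' Ht' E]]].
  case: Hv => s Hs; have Es : z + s *: b = z0 + (t' + (s - t)) *: b.
    by rewrite scalerDl addrA E -addrA -scalerDl [t + _]addrC subrK.
  rewrite /slice_fun Es; apply: Hv0; rewrite /slice_dom /= -Es; exact: Hs.
have Ea : z0 + a0 *: b = z + (t + (a0 - t')) *: b.
  by rewrite scalerDl addrA -E -addrA -scalerDl [t' + _]addrC subrK.
exists (t + (a0 - t')); rewrite -Ea; split=> //.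
by rewrite opprD addrA subrr sub0r opprB.
Qed.

(** The two centres are compared through the point z + t b, which is close to both, each in its own
    scale. *)
Lemma Lratio_inv z t a (r : R) : ball z -> r <= beta -> cabs t <= beta / L z ->
  ball (z + a *: b) -> cabs (t - a) <= r / L (z + a *: b) ->
  l1 * L z <= l2 * L (z + a *: b).
Proof.
move=> Hz rb Ht Ha Hta; have /andP[H1 _] := Lratio z t Hz Ht; apply: le_trans H1 _.
have La := L0 _ Ha.
have hta : cabs (t - a) <= beta / L (z + a *: b).
  by apply: le_trans Hta _; rewrite ler_wpM2r // invr_ge0 ltW.
have /andP[_] := Lratio (z + a *: b) (t - a) Ha hta.
by rewrite -addrA -scalerDl [a + _]addrC subrK.
Qed.

(** Pigeonhole: the N + 1 candidates are 3 d apart, so an element of s is within d of at most one of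
    them. *)
Lemma good_radius (N : nat) (d : R) (s : seq R) : 0 < d -> (size s <= N)%N ->
  exists i, (i <= N)%N /\ forall x, x \in s -> d <= `|1 + i.+1%:R * (3 * d) - x|.
Proof.
move=> d0 sN; apply: contrapT => Hn.
have H (i : 'I_N.+1) : exists j : 'I_(size s), `|1 + i.+1%:R * (3 * d) - nth 0 s j| < d.
  apply: contrapT => Hi; apply: Hn; exists i; split; first by rewrite -ltnS.
  move=> x xs; rewrite leNgt; apply/negP => hx; apply: Hi.
  have hi : (index x s < size s)%N by rewrite index_mem.
  by exists (Ordinal hi); rewrite /= nth_index.
have [f Hf] := choice H.
have finj : injective f.
  move=> i j fij; have h1 := Hf i; have h2 := Hf j; rewrite -fij in h2.
  move: h1 h2; set x := nth _ _ _; rewrite !ltr_norml => /andP[a1 a2] /andP[a3 a4].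
  apply: val_inj => /=; case: (ltngtP i j) => // hij; exfalso.
    have : (i.+1%:R + 1 : R) <= j.+1%:R by rewrite natr1 ler_nat ltnS.
    nra.
  have : (j.+1%:R + 1 : R) <= i.+1%:R by rewrite natr1 ler_nat ltnS.
  nra.
have := leq_card f finj; rewrite !card_ord; lia.
Qed.

Lemma nslice0_at0 z : h z 0 = F z.
Proof. by rewrite /nslice mul0r scale0r addr0 expr0 divr1. Qed.

Lemma bounded_index_of_conditions :
  (forall r : R, 0 < r <= beta ->
     exists P : R, 0 < P /\
       forall z, (unit_ball R n `\` Gset b L F r) z ->
         cabs ((F z)^-1 * dir_deriv b F z) <= P * L z) ->
  (forall r : R, 0 < r <= beta ->
     exists nt : nat,
       forall z0, unit_ball R n z0 -> ~ slice_vanishes b F z0 ->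
       forall t0, slice_dom b z0 t0 ->
         (zero_count b F (r / L (z0 + t0 *: b))%R z0 t0 <= nt%:R%:E)%E) ->
  bounded_L_index b L F.
Proof.
move=> C1 C2.
have [|N HN] := C2 beta; first by rewrite beta0 lexx.
(* Small enough for all N + 1 candidate radii of [good_radius], increased by d, to stay below
   beta. *)
pose d := (beta - 1) / (6 * N.+2%:R).
have d0 : 0 < d by rewrite divr_gt0 ?subr_gt0 ?mulr_gt0.
have dN : d * (6 * N.+2%:R) = beta - 1 by rewrite /d divfK // gt_eqF ?mulr_gt0.
have d2 : 0 < d / 2 by exact: divr_gt0.
(* In the rescaled variable, [Gset b L F r] surrounds each relevant zero by a disc of radius at most
   r l2 / l1 <= d / 2. *)
pose r := Num.min beta (d / 2 * l1 / l2).
have r0 : 0 < r <= beta.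
  by rewrite lt_min beta0 (divr_gt0 (mulr_gt0 d2 l10) l20) ge_min lexx.
have [P [P0 HP]] := C1 r r0.
pose C := (2 * beta) ^+ N * expR ((P * l2 + N%:R / d) * (2 * beta)).
have C0 : 0 < C by rewrite mulr_gt0 ?exprn_gt0 ?expR_gt0 ?mulr_gt0.
have rho1 : 1 < 1 + 3 * d by rewrite ltrDl mulr_gt0.
have [m0 Hm0] := index_from_growth _ _ C rho1 C0.
exists m0 => m z Hz; have Lz := L0 z Hz.
rewrite -/(maxcoef m0 z).
have [Hv|Hv] := pselect (slice_vanishes b F z).
  rewrite (vanishing_deriv z Hz Hv) cabs0 mul0r.
  apply: le_trans (maxcoef_ge m0 z 0 (leq0n _)).
  by rewrite expr0 fact0 mulr1 divr1 cabs_ge0.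
have E0 : z + 0 *: b = z by rewrite scale0r addr0.
have Hz0 : slice_dom b z 0 by rewrite /slice_dom /= E0.
have HNz := HN z Hz Hv 0 Hz0.
have [s [u [Hs Hf u0]]] := max_factor _ _ _ (h z) N rr_beta (nslice_outer_papprox 0 z Hz)
  (fun s u Hs Hf => factor_size z s u N Hz Hv Hs Hf HNz).
have sN := factor_size z s u N Hz Hv Hs Hf HNz.
have sN' : (size (map (@Normc.normc R) s) <= N)%N by rewrite size_map.
have [i [iN Hi]] := good_radius N d _ d0 sN'.
set rho := 1 + _ in Hi.
have iN' : (i.+1%:R : R) <= N.+1%:R by rewrite ler_nat ltnS.
have i1 : 1 <= (i.+1%:R : R) by rewrite ler1n.
have rho_lo : 1 + 3 * d <= rho by rewrite /rho; nra.
have N2 : (N.+2%:R : R) = N.+1%:R + 1 by rewrite natr1.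
have rho_hi : rho + d <= beta.
  by rewrite /rho; move: dN; rewrite N2; nra.
have [c Hc Ec] := nslice_outer_coef z Hz.
have key : forall M, (forall t, cabs t <= 1 -> cabs (h z t) <= M) ->
    forall t, cabs t <= 1 + 3 * d -> cabs (h z t) <= C * M.
  move=> M HM t Ht.
  apply: (growth_from_circle _ outer_radius beta rho N d (P * l2) (h z) (nslice R n b F 1 z (L z)) s u M) => //.
  - by rewrite beta1 rr_beta.
  - by apply/andP; split; lra.
  - move=> w wr; apply: nslice_cderiv => //; apply: disc_outer_radius => //.
    rewrite cabs_div_real // ler_wpM2r ?invr_ge0 ?(ltW Lz) // wr.
    by apply: le_trans (ltW rr_beta); lra.
  - by move=> a sa; apply: Hi; exact: map_f.
  - move=> w wr; have wl : cabs (w / (L z)%:C%C) <= beta / L z.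
      by rewrite cabs_div_real // ler_wpM2r ?invr_ge0 ?(ltW Lz) // wr; lra.
    have Hy := disc_beta z Hz _ wl; set y := z + _ in Hy.
    (* A point of the set would have a zero within d / 2, and this zero has modulus at most rho + d
       / 2 <= beta, so it is in s. But the circle keeps distance d from s. *)
    have yG : ~ Gset b L F r y.
      move=> /(Gset_zero r z _ Hz Hy Hv) [a [Ha Fa Hta]].
      have /andP[_ rb] := r0; have La := L0 _ Ha.
      have HLL := Lratio_inv z _ a r Hz rb wl Ha Hta.
      pose wa := a * (L z)%:C%C.
      have cwa : cabs (w - wa) <= d / 2.
        have -> : w - wa = (w / (L z)%:C%C - a) * (L z)%:C%C.
          by rewrite mulrBl divfK // -cabs_gt0 cabs_real gtr0_norm.
        rewrite cabsM cabs_real gtr0_norm //.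
        apply: le_trans (ler_wpM2r (ltW Lz) Hta) _.
        rewrite mulrAC ler_pdivrMr //.
        have rd : r <= d / 2 * l1 / l2 by rewrite ge_min lexx orbT.
        apply: le_trans (ler_wpM2r (ltW Lz) rd) _.
        rewrite mulrAC ler_pdivrMr // -[d / 2 * l1 * _]mulrA -[d / 2 * _ * l2]mulrA.
        by rewrite ler_wpM2l ?(ltW d2) // [L _ * l2]mulrC.
      have wab : cabs wa <= beta.
        by have := cabs_lower _ wa w; rewrite cabs_distC wr; lra.
      have was : wa \in s.
        have hwa : h z wa = 0.
          rewrite /nslice /wa mulfK ?expr0 ?divr1 //.
          by rewrite -cabs_gt0 cabs_real gtr0_norm.
        have wrr : cabs wa <= outer_radius by apply: le_trans wab (ltW rr_beta).
        have := Hf.2 wa wrr; rewrite hwa => /esym/eqP; rewrite mulf_eq0 (negPf (u0 _ wab)) orbF.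
        rewrite root_polyE prodf_seq_eq0 => /hasP[a' a's]; rewrite /= subr_eq0.
        by move=> /eqP ->.
      have wap : cabs wa \in map (@Normc.normc R) s by exact: map_f.
      have := Hi _ wap; rewrite leNgt => /negP; apply.
      rewrite -wr ltr_norml; have := cabs_lower _ w wa; have := cabs_lower _ wa w.
      by rewrite [cabs (wa - w)]cabs_distC; lra.
    have Fy : F y != 0.
      apply/eqP => Fy0; apply: yG; apply: (zero_in_Gset r z (w / (L z)%:C%C)) => //.
        by case/andP: r0 => /ltW.
      by rewrite subrr cabs0 divr_ge0 ?(ltW (L0 _ Hy)) //; case/andP: r0 => /ltW.
    have := HP y (conj Hy yG).
    have -> : nslice R n b F 1 z (L z) w / h z w = (F y)^-1 * dir_deriv b F y / (L z)%:C%C.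
      by rewrite /nslice expr1 expr0 divr1 -/y mulrAC; congr (_ / _); exact: mulrC.
    move=> H; rewrite cabs_div_real // ler_pdivrMr //; apply: le_trans H _.
    rewrite -mulrA ler_wpM2l ?(ltW P0) //.
    by have /andP[_] := Lratio z _ Hz wl.
  - by lra.
have h1 : 1 + 3 * d < outer_radius by apply: le_lt_trans rr_beta; lra.
have H := Hm0 outer_radius (h z) c (maxcoef m0 z) h1 (nslice_outer_papprox 0 z Hz) Hc key.
rewrite -cabs_coef // -Ec; apply: H => k km.
by rewrite Ec cabs_coef // maxcoef_ge.
Qed.

(** * Necessity: growth, zeros and logarithmic derivative under bounded index *)

Section Growth.
Variable N : nat.
Hypothesis Hindex : forall m z, ball z -> cabs (Fk m z) / (m`!%:R * L z ^+ m) <= maxcoef N z.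

Lemma maxcoef_ge0 z : ball z -> 0 <= maxcoef N z.
Proof.
move=> Hz; apply: le_trans (Hindex 0 z Hz).
by rewrite expr0 fact0 mulr1 divr1 cabs_ge0.
Qed.

(** Bounded index makes [maxcoef N z] a bound for all Taylor coefficients of h, and the geometric
    series of ratio 1/2 sums to 2. *)
Lemma growth_half z t : ball z -> cabs t <= (2 * L z)^-1 ->
  cabs (F (z + t *: b)) <= 2 * maxcoef N z.
Proof.
move=> Hz Ht; have Lz := L0 z Hz; have A0 := maxcoef_ge0 z Hz.
have [c Hc Ec] := nslice_outer_coef z Hz.
pose w := t * (L z)%:C%C.
have LC : (L z)%:C%C != 0 :> R[i] by rewrite -cabs_gt0 cabs_real gtr0_norm.
have -> : F (z + t *: b) = h z w by rewrite /nslice /w mulfK // expr0 divr1.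
have w2 : cabs w <= 2^-1.
  by rewrite cabsM cabs_real gtr0_norm // -ler_pdivlMr // -invfM.
have rr1 : 1 < outer_radius by apply: lt_trans rr_beta.
have wr : cabs w < outer_radius by lra.
have [M M0 HM] := papprox_bounded _ _ _ _ (ltW rr0) (nslice_outer_papprox 0 z Hz).
have HM' v : cabs v <= outer_radius -> cabs (h z v) <= M by move=> Hu; apply: HM; rewrite subr0.
apply/ler_addgt0Pr => e e0.
have x1 : 0 <= cabs w / outer_radius < 1.
  by rewrite divr_ge0 ?cabs_ge0 ?(ltW rr0) //= ltr_pdivrMr ?mul1r.
have [K HK] := pow_small1 _ _ (M / (1 - cabs w / outer_radius)) _ x1 e0.
have := has_coef_taylor _ outer_radius (h z) c M K w rr0 (nslice_outer_papprox 0 z Hz) Hc HM' wr.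
rewrite mulrAC => /le_trans /(_ HK) T.
have S : cabs (\sum_(k < K) c k * w ^+ k) <= 2 * maxcoef N z.
  apply: le_trans (cabs_sum _ _ _ _ _) _.
  apply: (@le_trans _ _ (\sum_(k < K) maxcoef N z * 2^-1 ^+ k)).
    apply: ler_sum => k _; rewrite cabsM cabsX ler_pM ?cabs_ge0 ?exprn_ge0 ?cabs_ge0 //.
      by rewrite Ec cabs_coef // Hindex.
    by rewrite lerXn2r ?nnegrE ?cabs_ge0 // invr_ge0.
  rewrite -mulr_sumr [2 * _]mulrC ler_wpM2l //.
  have E2 : (1 - 2^-1)^-1 = 2 :> R by field.
  by rewrite -[leRHS]E2; apply: geo_sum_le; lra.
have := cabs_lower _ (h z w) (\sum_(k < K) c k * w ^+ k); lra.
Qed.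

(** The 2 is that of [growth_half], 4^k comes from Cauchy's estimate on a disc of radius 1/4, and
    l1^(-k) from replacing L z by L at the new point; k is at most N. *)
Definition step_const : R := 2 * (4 / l1) ^+ N.

Lemma step_const_ge1 : 1 <= step_const.
Proof.
rewrite /step_const; have : 1 <= (4 / l1) ^+ N.
  by rewrite exprn_ege1 // ler_pdivlMr //; move: l11; lra.
lra.
Qed.

Lemma growth_step z t : ball z -> cabs t <= (4 * L z)^-1 ->
  ball (z + t *: b) /\ maxcoef N (z + t *: b) <= step_const * maxcoef N z.
Proof.
move=> Hz Ht; have Lz := L0 z Hz; have A0 := maxcoef_ge0 z Hz.
have q2 : (2 * L z)^-1 = 2^-1 / L z by rewrite invfM.
have q4 : (4 * L z)^-1 = 4^-1 / L z by rewrite invfM.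
have Li : 0 < (L z)^-1 by rewrite invr_gt0.
have hnear (s : R[i]) : cabs s <= 4^-1 / L z -> cabs (t + s) <= (2 * L z)^-1.
  move=> Hs; apply: le_trans (cabsD _ _ _) _; rewrite q2; move: Ht Hs; rewrite q4.
  by move: (L z)^-1 Li => x x0; lra.
have tb : cabs t <= beta / L z.
  apply: half_disc => //; apply: le_trans Ht _; rewrite q2 q4; lra.
have Hy := disc_beta z Hz t tb; split=> //; set y := z + t *: b in Hy *.
have Ly := L0 y Hy; have /andP[HL _] := Lratio z t Hz tb; rewrite -/y in HL.
have disc : disc_in R n b y (4^-1 / L z).
  move=> s Hs; have := disc_beta z Hz (t + s) (half_disc _ _ Hz (hnear s Hs)).
  by rewrite scalerDl addrA.
have r4 : 0 < (4^-1 : R) by rewrite invr_gt0.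
have Hp := nslice_papprox R n b F Fpoly 0 y (L z) _ Lz r4 disc.
have [c Hc] := papprox_coef _ _ _ r4 Hp.
have Ec m := nslice_coef R n b F Fpoly y (L z) _ c m Lz r4 disc Hc.
have Hb w : cabs w <= 4^-1 -> cabs (nslice R n b F 0 y (L z) w) <= 2 * maxcoef N z.
  move=> w4; rewrite /nslice expr0 divr1 /y -addrA -scalerDl; apply: growth_half => //.
  by apply: hnear; rewrite cabs_div_real // ler_wpM2r // ltW.
have sA : 0 <= step_const * maxcoef N z by rewrite mulr_ge0 //; have := step_const_ge1; lra.
apply: maxcoef_le => // k kN.
have := has_coef_bound _ _ _ _ _ Hb Hc k.
have f0 : 0 < (k`!%:R : R) by rewrite ltr0n fact_gt0.
rewrite Ec !(cabsM, cabsV) cabs_nat cabsX cabs_real gtr0_norm // => H.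
rewrite ler_pdivrMr ?mulr_gt0 ?exprn_gt0 //.
have Lk : (l1 * L z) ^+ k <= L y ^+ k.
  by rewrite lerXn2r ?nnegrE ?mulr_ge0 ?(ltW Ly) ?(ltW Lz) // ltW.
have Hk : (4 / l1) ^+ k <= (4 / l1) ^+ N.
  by rewrite ler_weXn2l // ler_pdivlMr //; move: l11; lra.
have G : cabs (Fk k y) <= 2 * maxcoef N z * (4 / l1) ^+ k * (k`!%:R * (l1 * L z) ^+ k).
  have -> : 2 * maxcoef N z * (4 / l1) ^+ k * (k`!%:R * (l1 * L z) ^+ k) =
     2 * maxcoef N z * 4 ^+ k * (k`!%:R * L z ^+ k).
    rewrite expr_div_n exprMn; have : l1 ^+ k != 0 by rewrite gt_eqF // exprn_gt0.
    by move: (l1 ^+ k) (4 ^+ k) (L z ^+ k) => x1 x2 x3 x0; field.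
  rewrite -ler_pdivrMr ?mulr_gt0 ?exprn_gt0 //.
  by rewrite exprVn in H; rewrite -ler_pdivrMr ?exprn_gt0.
apply: le_trans G _; rewrite /step_const.
have p1 : 0 <= (l1 * L z) ^+ k by rewrite exprn_ge0 // mulr_ge0 ?ltW.
have p2 : 0 <= (4 / l1) ^+ k by rewrite exprn_ge0 // divr_ge0 // ltW.
apply: ler_pM; rewrite ?mulr_ge0 ?(ltW f0) //.
  by rewrite [leLHS]mulrAC ler_wpM2r // ler_wpM2l.
by rewrite ler_wpM2l // ltW.
Qed.

Lemma growth_beta : exists2 C, 1 <= C & forall z t, ball z -> cabs t <= beta / L z ->
  maxcoef N (z + t *: b) <= C * maxcoef N z.
Proof.
(* With K steps to t, each has length at most beta / (K L z), which is at most 1 / (4 L y) at every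
   intermediate point y because L y <= l2 L z. *)
pose K := (Num.truncn (4 * beta * l2)).+1.
have K0 : 0 < (K%:R : R) by rewrite ltr0n.
have HK : 4 * beta * l2 <= K%:R by apply/ltW/truncnS_gt.
exists (step_const ^+ K); first by rewrite exprn_ege1 // step_const_ge1.
move=> z t Hz Ht; have Lz := L0 z Hz; have A0 := maxcoef_ge0 z Hz.
have KC : (K%:R : R[i]) != 0 by rewrite -cabs_gt0 cabs_nat.
have step i : (i <= K)%N ->
    maxcoef N (z + (i%:R * (t / K%:R)) *: b) <= step_const ^+ i * maxcoef N z.
  elim: i => [_|i IH iK]; first by rewrite mul0r scale0r addr0 expr0 mul1r.
  have ti : cabs (i%:R * (t / K%:R)) <= beta / L z.
    rewrite !cabsM cabsV !cabs_nat mulrCA; apply: le_trans Ht.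
    rewrite ler_piMr ?cabs_ge0 // ler_pdivrMr // mul1r ler_nat; exact: ltnW.
  have Hy := disc_beta z Hz _ ti; have /andP[_ HL] := Lratio z _ Hz ti.
  set y := z + _ in Hy HL; have Ly := L0 y Hy.
  have tK : cabs (t / K%:R) <= (4 * L y)^-1.
    rewrite cabsM cabsV cabs_nat; apply: le_trans (_ : beta / L z / K%:R <= _).
      by rewrite ler_wpM2r // invr_ge0 ltW.
    rewrite -mulrA -invfM ler_pdivrMr ?mulr_gt0 // mulrC ler_pdivlMr ?mulr_gt0 //.
    have := ler_wpM2r (ltW Lz) HK; have := ler_wpM2l (ltW beta0) HL; nra.
  have [_ H] := growth_step y _ Hy tK.
  have -> : z + (i.+1%:R * (t / K%:R)) *: b = y + (t / K%:R) *: b.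
    by rewrite /y -addrA -scalerDl -natr1 mulrDl mul1r.
  apply: le_trans H _; rewrite exprS -mulrA ler_wpM2l ?IH //.
    by have := step_const_ge1; lra.
  exact: ltnW.
have := step K (leqnn _); by rewrite mulrCA divff ?mulr1.
Qed.

Lemma growth_outer_radius : exists2 C, 0 < C & forall z w, ball z -> cabs w <= outer_radius ->
  cabs (h z w) <= C * maxcoef N z.
Proof.
have [C C1 HC] := growth_beta; exists (2 * C); first by lra.
move=> z w Hz wr; have Lz := L0 z Hz.
have Hw : cabs (w / (L z)%:C%C) <= outer_radius / L z.
  by rewrite cabs_div_real // ler_wpM2r // invr_ge0 ltW.
have [t0 [h1 h2]] := outer_radius_split z _ Hz Hw.
have Hy := disc_beta z Hz t0 h1.
have := growth_half _ _ Hy h2; rewrite -addrA -scalerDl [t0 + _]addrC subrK.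
rewrite /nslice expr0 divr1 => /le_trans; apply.
by rewrite -mulrA ler_wpM2l //; exact: HC.
Qed.

Lemma maxcoef_gt0 z : ball z -> ~ slice_vanishes b F z -> 0 < maxcoef N z.
Proof.
move=> Hz Hv; rewrite lt_def maxcoef_ge0 // andbT; apply/eqP => A0.
have E0 : z + 0 *: b = z by rewrite scale0r addr0.
have [|m] := nonvanishing_deriv z 0 _ Hv; first by rewrite /slice_dom /= E0.
rewrite E0; apply; have := Hindex m z Hz; rewrite A0.
rewrite ler_pdivrMr ?mul0r ?mulr_gt0 ?exprn_gt0 ?ltr0n ?fact_gt0 ?L0 // => H.
by apply/eqP; rewrite -cabs_eq0 eq_le H cabs_ge0.
Qed.

Lemma zeros_bounded : exists N', forall z s u, ball z -> ~ slice_vanishes b F z ->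
  all (fun a => cabs a <= beta) s -> factors outer_radius (h z) s u -> (size s <= N')%N.
Proof.
have [C C0 HC] := growth_outer_radius; have b2 : 2^-1 < beta by move: beta1; lra.
have [N' HN'] := zero_bound _ outer_radius beta C N b2 rr_beta.
exists N' => z s u Hz Hv Hs Hf; have [c Hc Ec] := nslice_outer_coef z Hz.
have [k kN Ek] := maxcoef_attained N z Hz.
apply: (HN' (h z) c s u (maxcoef N z) k (nslice_outer_papprox 0 z Hz) Hc Hs Hf) => //.
- exact: maxcoef_gt0.
- by rewrite Ec cabs_coef // Ek.
- by move=> t tr; exact: HC.
Qed.

Lemma condition_zeros : forall r : R, 0 < r <= beta ->
     exists nt : nat,
       forall z0, unit_ball R n z0 -> ~ slice_vanishes b F z0 ->
       forall t0, slice_dom b z0 t0 ->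
         (zero_count b F (r / L (z0 + t0 *: b))%R z0 t0 <= nt%:R%:E)%E.
Proof.
move=> r /andP[r0 rb]; have [N' HN'] := zeros_bounded; exists N' => z0 Hz0 Hv t0 Ht0.
set z := z0 + t0 *: b; have Hz : ball z by [].
have Hvz : ~ slice_vanishes b F z.
  move=> Hvz; apply: Hv; rewrite (_ : z0 = z + (- t0) *: b); first exact: shift_vanishes.
  by rewrite /z -addrA -scalerDl subrr scale0r addr0.
have [s [u [Hs Hf u0]]] := max_factor _ _ _ (h z) N' rr_beta (nslice_outer_papprox 0 z Hz)
  (fun s u => HN' z s u Hz Hvz).
have rl : r / L z <= beta / L z by rewrite ler_wpM2r // invr_ge0 ltW // L0.
apply: le_trans (zero_count_le z0 t0 s u _ Ht0 Hv Hf u0 rl) _.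
by rewrite lee_fin ler_nat (HN' z s u).
Qed.

Lemma condition_logderiv : forall r : R, 0 < r <= beta ->
     exists P : R, 0 < P /\
       forall z, (unit_ball R n `\` Gset b L F r) z ->
         cabs ((F z)^-1 * dir_deriv b F z) <= P * L z.
Proof.
move=> r /andP[r0 rb]; have [N' HN'] := zeros_bounded; have [C C0 HC] := growth_outer_radius.
(* A zero of h closer to 0 than r / l2 would put z into [Gset b L F r], since L at that zero is at
   most l2 L z. *)
have d0 : 0 < r / l2 by exact: divr_gt0.
have [P HP] := log_deriv_core _ outer_radius beta C (r / l2) N N' beta1 rr_beta C0 d0.
exists (Num.max 1 P); split; first by rewrite lt_max ltr01.
move=> z [Hz zG]; have Lz := L0 z Hz.
have E0 : z + 0 *: b = z by rewrite scale0r addr0.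
have Hv : ~ slice_vanishes b F z.
  (* An identically vanishing slice is contained in the excluded set, and z with it. *)
  move=> Hv; apply: zG; exists z => //; rewrite /Gset_at.
  have Hzero : slice_zeros b F z 0.
    by split; [rewrite /slice_dom /= E0|apply: Hv; rewrite /slice_dom /= E0].
  case: asboolP => [E|_]; first by move: Hzero; rewrite E.
  by case: asboolP => // _; exists 0 => //; rewrite /slice_dom /= E0.
have [c Hc Ec] := nslice_outer_coef z Hz.
have [k kN Ek] := maxcoef_attained N z Hz.
have [s [u [Hs Hf u0]]] := max_factor _ _ _ (h z) N' rr_beta (nslice_outer_papprox 0 z Hz)
  (fun s u => HN' z s u Hz Hv).
have far a : a \in s -> r / l2 <= cabs a.
  move=> sa; have ab := allP Hs _ sa; rewrite /= in ab.
  have al : cabs (a / (L z)%:C%C) <= beta / L z.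
    by rewrite cabs_div_real // ler_wpM2r // invr_ge0 ltW.
  have Hy := disc_beta z Hz _ al.
  have arr : cabs a <= outer_radius by apply: le_trans ab (ltW rr_beta).
  have Fy : F (z + (a / (L z)%:C%C) *: b) = 0.
    have := Hf.2 a arr.
    by rewrite root_polyE (big_rem _ sa) /= subrr !mul0r /nslice expr0 divr1.
  have /andP[_ HL] := Lratio z _ Hz al; have Ly := L0 _ Hy.
  rewrite leNgt; apply/negP => Hlt; apply: zG.
  rewrite -[z]E0; apply: (zero_in_Gset r z (a / (L z)%:C%C) (ltW r0) Hz Hy Fy Hv).
  rewrite sub0r cabsN cabs_div_real // ler_pdivrMr // mulrAC ler_pdivlMr //.
  move: Hlt; rewrite ltr_pdivlMr // => Hlt.
  apply: le_trans (ler_wpM2l (cabs_ge0 _ a) HL) _.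
  by rewrite mulrA ler_wpM2r ?(ltW Lz) // ltW.
have Hz0 : ball (z + (0 / (L z)%:C%C) *: b) by rewrite mul0r E0.
have Hd := nslice_cderiv R n b F Fpoly 0 z (L z) 0 Lz Hz0.
have sN := HN' z s u Hz Hv Hs Hf.
have Ak : maxcoef N z <= cabs (c k) by rewrite Ec cabs_coef // Ek.
have := HP (h z) _ c s u (maxcoef N z) k (nslice_outer_papprox 0 z Hz) Hc Hd Hs sN Hf u0 far
  (maxcoef_gt0 z Hz Hv) kN Ak (fun t tr => HC z t Hz tr).
rewrite nslice0_at0 /nslice mul0r E0 expr1 => H.
have -> : (F z)^-1 * dir_deriv b F z = dir_deriv b F z / (L z)%:C%C / F z * (L z)%:C%C.
  have LC : (L z)%:C%C != 0 :> R[i] by rewrite -cabs_gt0 cabs_real gtr0_norm.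
  by rewrite [RHS]mulrAC divfK // mulrC.
rewrite cabsM cabs_real gtr0_norm // ler_wpM2r ?(ltW Lz) //.
by apply: le_trans H _; rewrite le_max lexx orbT.
Qed.
End Growth.
End Main.

Theorem theorem12 (R : realType) (n : nat) (beta : R) (b : 'rV[R[i]]_n)
    (F : 'rV[R[i]]_n -> R[i]) (L : 'rV[R[i]]_n -> R) :
  1 < beta ->
  b != 0 ->
  analytic_in_ball F ->
  classQ b beta L ->
  unit_ball R n `\` Gset b L F beta !=set0 ->
  bounded_L_index b L F <->
  (forall r : R, 0 < r <= beta ->
     exists P : R, 0 < P /\
       forall z, (unit_ball R n `\` Gset b L F r) z ->
         cabs ((F z)^-1 * dir_deriv b F z) <= P * L z) /\
  (forall r : R, 0 < r <= beta ->
     exists nt : nat,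
       forall z0, unit_ball R n z0 -> ~ slice_vanishes b F z0 ->
       forall t0, slice_dom b z0 t0 ->
         (zero_count b F (r / L (z0 + t0 *: b))%R z0 t0 <= nt%:R%:E)%E).
Proof.
move=> beta1 _ HF HQ _; have [_ L0 Lball _] := HQ.
have Fpoly z : unit_ball R n z -> locally_poly R n F z by exact: analytic_locally_poly.
have [l1 [l2 [l10 l11 l21 Lratio]]] := classQ_ratio R n beta b L (ltW (lt_trans ltr01 beta1)) HQ.
split=> [[N Hindex]|[C1 C2]].
  split; [apply: (condition_logderiv R n beta b F L l1 l2) => //; exact: Hindex|].
  apply: (condition_zeros R n beta b F L l1 l2) => //; exact: Hindex.
exact: (bounded_index_of_conditions R n beta b F L l1 l2).
Qed.
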